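(* Let $G_1$ be the simply connected seven-dimensional Lie group whose Lie algebra $L_1$ is given, in terms of a basis $e^1,\dots,e^7$ of left invariant 1-forms, by $$\begin{aligned} &de^1=0,\quad de^2=-e^{12}-2e^{34}-\tfrac12e^{37}+\tfrac12e^{46},\quad de^3=-e^{13}+2e^{24}+\tfrac12e^{27}-\tfrac12e^{45},\\ &de^4=-e^{14}-2e^{23}-\tfrac12e^{26}+\tfrac12e^{35},\quad de^5=2e^{12}+2e^{34}-\tfrac12e^{67},\\ &de^6=2e^{13}+2e^{42}+\tfrac12e^{57},\quad de^7=2e^{14}+2e^{23}-\tfrac12e^{56}. \end{aligned}$$ Let $e_1,\dots,e_7$ be the dual left invariant frame and equip $G_1$ with the left invariant quaternionic contact structure $(\eta,\mathbb Q)$ given by $\eta_1=e^5$, $\eta_2=e^6$, $\eta_3=e^7$, $H=\mathrm{span}\{e_1,\dots,e_4\}$ with $e_1,\dots,e_4$ orthonormal, $\omega_1=e^{12}+e^{34}$, $\omega_2=e^{13}+e^{42}$, $\omega_3=e^{14}+e^{23}$, with Reeb vector fields $\xi_1=e_5$, $\xi_2=e_6$, $\xi_3=e_7$. Then: (a) the torsion endomorphism of the Biquard connection is zero and the normalized qc scalar curvature is the negative constant $S=-\frac12$; (b) the qc conformal curvature is zero, $W^{qc}=0$, and therefore $(G_1,\eta,\mathbb Q)$ is locally qc conformally flat.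
   Context: Notation: $e^{ij}=e^i\wedge e^j$, and $d\alpha(A,B)=A\alpha(B)-B\alpha(A)-\alpha([A,B])$, $(\alpha\wedge\beta)(A,B)=\alpha(A)\beta(B)-\alpha(B)\beta(A)$ for 1-forms. Quaternionic contact (qc) structure in dimension 7: a codimension three distribution $H$ on a 7-manifold $M$ with a Riemannian metric $g$ on $H$ and a rank-three bundle $\mathbb Q\subset \mathrm{End}(H)$ locally generated by almost complex structures $I_1,I_2,I_3$ with $I_1I_2=-I_2I_1=I_3$, $I_1I_2I_3=-\mathrm{id}_H$, $g(I_s\cdot,I_s\cdot)=g$, such that $H$ is locally the kernel of a 1-form $\eta=(\eta_1,\eta_2,\eta_3)$ with values in $\mathbb R^3$ with $2g(I_sX,Y)=d\eta_s(X,Y)$ for $X,Y\in H$, $s=1,2,3$, and such that there exist (Reeb) vector fields $\xi_1,\xi_2,\xi_3$ with $\eta_s(\xi_k)=\delta_{sk}$, $(\xi_s\lrcorner d\eta_s)|_H=0$, $(\xi_s\lrcorner d\eta_k)|_H=-(\xi_k\lrcorner d\eta_s)|_H$. Put $V=\mathrm{span}\{\xi_1,\xi_2,\xi_3\}$; $g$ is extended to $TM=H\oplus V$ by $V\perp H$, $g(\xi_s,\xi_k)=\delta_{sk}$. The fundamental 2-forms are $\omega_s(X,Y)=g(I_sX,Y)$ on $H$, with $\xi\lrcorner\omega_s=0$ for $\xi\in V$. Biquard connection: the unique linear connection $\nabla$ on $M$, with torsion $T$, such that (i) $\nabla$ preserves $H\oplus V$ and the metric $g$; (ii) $T(X,Y)=-[X,Y]_{|V}$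 for $X,Y\in H$; (iii) $\nabla$ preserves the $Sp(1)Sp(1)$ structure on $H$ ($\nabla g=0$ and $\nabla\sigma\in\Gamma(\mathbb Q)$ for $\sigma\in\Gamma(\mathbb Q)$); (iv) for $\xi\in V$ the endomorphism $T_\xi:=T(\xi,\cdot)$ of $H$ lies in $(sp(1)\oplus sp(1))^\perp\subset gl(4)$, for the inner product $\langle A,B\rangle=\sum_i g(Ae_i,Be_i)$; (v) $\nabla\varphi=0$ where $\varphi$ identifies $V$ with $\mathbb Q\cong sp(1)$ by $\xi_s\mapsto I_s$. The endomorphisms $T_\xi:H\to H$, $\xi\in V$, form the torsion endomorphism of the Biquard connection. Curvature: $R(A,B)=[\nabla_A,\nabla_B]-\nabla_{[A,B]}$, $R(A,B,C,D)=g(R(A,B)C,D)$. The normalized qc scalar curvature $S$ is defined by $24S=\sum_{a,b=1}^4R(e_b,e_a,e_a,e_b)$ for an orthonormal basis $e_1,\dots,e_4$ of $H$. Put $T^0(X,Y)=g\big(\sum_{s}T_{\xi_s}I_sX,Y\big)$ for $X,Y\in H$. For (0,2) tensors $A,B$ on $H$ let $(A\star B)(X,Y,Z,W)=A(X,Z)B(Y,W)+A(Y,W)B(X,Z)-A(Y,Z)B(X,W)-A(X,W)B(Y,Z)$. In dimension seven the qc conformal curvature is the tensor on $H$ $$W^{qc}(X,Y,Z,W)=\tfrac14\Big[R(X,Y,Z,W)+\sum_{s}R(I_sX,I_sY,Z,W)\Big]-\tfrac12\sum_{s}\omega_s(Z,W)\big[T^0(X,I_sY)-T^0(I_sX,Y)\big]+\tfrac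 S4\Big[g\star g+\sum_{s}\omega_s\star\omega_s\Big](X,Y,Z,W).$$ Locally qc conformally flat means locally qc conformal to the 7-dimensional quaternionic Heisenberg group, i.e. around each point there is a local diffeomorphism to that group pulling its contact form back to $\mu\Psi\eta$ with $\mu>0$ a smooth function and $\Psi$ a smooth $SO(3)$-valued function. The quaternionic Heisenberg group is the simply connected Lie group with left invariant coframe $e^1,\dots,e^4,\eta_1,\eta_2,\eta_3$ satisfying $de^a=0$, $d\eta_1=2(e^{12}+e^{34})$, $d\eta_2=2(e^{13}+e^{42})$, $d\eta_3=2(e^{14}+e^{23})$, with its contact form $(\eta_1,\eta_2,\eta_3)$. *)

(* Defs.v *)
From HB Require Import structures.
From mathcomp Require Import all_boot all_order all_algebra.
From mathcomp Require Import all_classical all_reals all_analysis.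

Set Implicit Arguments.
Unset Strict Implicit.
Unset Printing Implicit Defensive.

Import Order.TTheory GRing.Theory Num.Theory.
Import numFieldNormedType.Exports.
Local Open Scope classical_set_scope.
Local Open Scope ring_scope.

Section smooth_maps.
Variables (R : realType) (V W : normedModType R).

Fixpoint Ck (k : nat) (U : set V) (f : V -> W) : Prop :=
  match k with
  | 0 => forall x, U x -> {for x, continuous f}
  | k'.+1 => (forall x, U x -> differentiable f x) /\
             (forall v : V, Ck k' U (fun x => 'D_v f x))
  end.

Definition Coo (U : set V) (f : V -> W) : Prop := forall k, Ck k U f.

Definition Coo_at (f : V -> W) (x : V) : Prop :=
  exists2 U : set V, open U /\ U x & Coo U f.

End smooth_maps.

(* A maximal atlas provides, for every point [p], a chart [chart p] whose
   domain [cdom p] contains [p]; we fix one such chart per point.  The tangent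
   space at [p] is then R^7, a vector [v] being read in [chart p]: it stands
   for the derivation [f |-> 'D_v (f \o cinv p) (chart p p)]. *)

Record manifold7 (R : realType) := Manifold7 {
  mcarrier :> topologicalType;
  chart : mcarrier -> mcarrier -> 'rV[R]_7;
  cinv : mcarrier -> 'rV[R]_7 -> mcarrier;
  cdom : mcarrier -> set mcarrier;
  m_hausdorff : hausdorff_space mcarrier;
  m_second_countable : @second_countable mcarrier;
  cdom_open : forall p, open (cdom p);
  cdom_center : forall p, cdom p p;
  chart_open : forall p, open (chart p @` cdom p);
  chartK : forall p q, cdom p q -> cinv p (chart p q) = q;
  chart_continuous : forall p q, cdom p q -> {for q, continuous (chart p)};
  cinv_continuous : forall p x, (chart p @` cdom p) x ->
    {for x, continuous (cinv p)};
  transition_smooth : forall p q,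
    Coo (chart p @` (cdom p `&` cdom q)) (chart q \o cinv p)
}.

Section calculus.
Variable R : realType.
Implicit Types M N : manifold7 R.

Definition tvec := 'rV[R]_7.

Definition vfield M := M -> tvec.
Definition form1 M := M -> tvec -> R.
Definition form2 M := M -> tvec -> tvec -> R.

Definition smooth_fun_at M (f : M -> R) (p : M) : Prop :=
  Coo_at (f \o cinv p) (chart p p).

Definition smooth_fun M (f : M -> R) : Prop := forall p, smooth_fun_at f p.

Definition smooth_map_at M N (f : M -> N) (p : M) : Prop :=
  {for p, continuous f} /\
  Coo_at (chart (f p) \o f \o cinv p) (chart p p).

Definition tangent_map M N (f : M -> N) (p : M) (v : tvec) : tvec :=
  'D_v (chart (f p) \o f \o cinv p) (chart p p).

Definition lieder M (A : vfield M) (f : M -> R) : M -> R :=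
  fun p => 'D_(A p) (f \o cinv p) (chart p p).

Definition coordfun M (p : M) (i : 'I_7) : M -> R := fun q => chart p q 0 i.

Definition smooth_vf M (A : vfield M) : Prop :=
  forall p i, smooth_fun_at (lieder A (coordfun p i)) p.

(* The value at [p] of the field [A, B] : f |-> A (B f) - B (A f), by its
   components in [chart p]. *)
Definition lie_bracket M (A B : vfield M) : vfield M := fun p =>
  \row_i (lieder A (lieder B (coordfun p i)) p -
          lieder B (lieder A (coordfun p i)) p).

Definition fscale M (f : M -> R) (A : vfield M) : vfield M :=
  fun p => f p *: A p.

(* On a manifold, testing against global smooth fields amounts to smoothness of
   the components in every chart, by bump functions. *)
Definition smooth_form1 M (a : form1 M) : Prop :=
  (forall p, scalar (a p)) /\
  (forall A : vfield M, smooth_vf A -> smooth_fun (fun p => a p (A p))).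

Definition wedge M (a b : form1 M) : form2 M :=
  fun p v w => a p v * b p w - b p v * a p w.

Definition dform M (a : form1 M) (A B : vfield M) : M -> R := fun p =>
  lieder A (fun q => a q (B q)) p - lieder B (fun q => a q (A q)) p
  - a p (lie_bracket A B p).

Definition d_eq M (a : form1 M) (w : form2 M) : Prop :=
  forall A B : vfield M, smooth_vf A -> smooth_vf B ->
  forall p, dform a A B p = w p (A p) (B p).

Definition pullback M N (f : M -> N) (a : form1 N) : form1 M :=
  fun p v => a (f p) (tangent_map f p v).

(* [f] restricts to a diffeomorphism of the open set [U] onto an open set. *)
Definition diffeo_on M N (U : set M) (f : M -> N) : Prop :=
  [/\ open U, open (f @` U), (forall p, U p -> smooth_map_at f p) &
      exists h : N -> M, forall p, U p ->
        h (f p) = p /\ smooth_map_at h (f p)].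

Definition simply_connected M : Prop :=
  (forall x y : M, exists c : R -> M,
     [/\ {within `[0, 1], continuous c}, c 0 = x & c 1 = y]) /\
  (forall c : R -> M, {within `[0, 1], continuous c} -> c 0 = c 1 ->
   exists h : R * R -> M,
     [/\ {within `[0, 1] `*` `[0, 1], continuous h},
         (forall t, t \in `[0, 1] -> h (0, t) = c t),
         (forall t, t \in `[0, 1] -> h (1, t) = c 0) &
         (forall s, s \in `[0, 1] -> h (s, 0) = c 0 /\ h (s, 1) = c 0)]).

End calculus.

Record lieGroup7 (R : realType) := LieGroup7 {
  lg_manifold :> manifold7 R;
  lg_mul : lg_manifold -> lg_manifold -> lg_manifold;
  lg_inv : lg_manifold -> lg_manifold;
  lg_one : lg_manifold;
  lg_mulA : associative lg_mul;
  lg_mul1 : left_id lg_one lg_mul;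
  lg_mulV : left_inverse lg_one lg_inv lg_mul;
  lg_mul_continuous :
    continuous (fun z : lg_manifold * lg_manifold => lg_mul z.1 z.2);
  lg_mul_smooth : forall p q : lg_manifold,
    Coo_at (fun z : 'rV[R]_7 * 'rV[R]_7 =>
              chart (lg_mul p q) (lg_mul (cinv p z.1) (cinv q z.2)))
           (chart p p, chart q q);
  lg_inv_smooth : forall p, smooth_map_at lg_inv p
}.

Section lie_groups.
Variable R : realType.
Implicit Type G : lieGroup7 R.

Definition left_invariant_form1 G (a : form1 G) : Prop :=
  forall (g p : G) (v : tvec R),
    a (lg_mul g p) (tangent_map (lg_mul g) p v) = a p v.

Definition left_invariant_vf G (A : vfield G) : Prop :=
  forall g p : G, A (lg_mul g p) = tangent_map (lg_mul g) p (A p).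

(* Since tangent spaces have dimension 7, duality makes [e] and [E] bases at
   every point. *)
Definition left_invariant_dual_frames G
    (e : 'I_7 -> form1 G) (E : 'I_7 -> vfield G) : Prop :=
  [/\ (forall i, smooth_form1 (e i) /\ left_invariant_form1 (e i)),
      (forall i, smooth_vf (E i) /\ left_invariant_vf (E i)) &
      (forall i j p, e i p (E j p) = (i == j)%:R)].

(* 1-based index: [ix 1], ..., [ix 7] enumerate 'I_7. *)
Definition ix (k : nat) : 'I_7 := Ordinal (ltn_pmod k.-1 (ltn0Sn 6)).

(* [vert s] and [hor a] are the indices of e^5, e^6, e^7 and e^1, ..., e^4. *)
Definition vert (s : 'I_3) : 'I_7 := rshift 4 s.
Definition hor (a : 'I_4) : 'I_7 := lshift 3 a.

Definition omega G (e : 'I_7 -> form1 G) (s : 'I_3) : form2 G :=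
  let w i j : form2 G := wedge (e (ix i)) (e (ix j)) in
  fun p v v' =>
  match val s with
  | 0 => w 1 2 p v v' + w 3 4 p v v'
  | 1 => w 1 3 p v v' + w 4 2 p v v'
  | _ => w 1 4 p v v' + w 2 3 p v v'
  end.

Definition L1_structure_equations G (e : 'I_7 -> form1 G) : Prop :=
  let w i j : form2 G := wedge (e (ix i)) (e (ix j)) in
  d_eq (e (ix 1)) (fun p v v' => 0) /\
  d_eq (e (ix 2)) (fun p v v' =>
    - w 1 2 p v v' - 2 * w 3 4 p v v'
    - 2^-1 * w 3 7 p v v' + 2^-1 * w 4 6 p v v') /\
  d_eq (e (ix 3)) (fun p v v' =>
    - w 1 3 p v v' + 2 * w 2 4 p v v'
    + 2^-1 * w 2 7 p v v' - 2^-1 * w 4 5 p v v') /\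
  d_eq (e (ix 4)) (fun p v v' =>
    - w 1 4 p v v' - 2 * w 2 3 p v v'
    - 2^-1 * w 2 6 p v v' + 2^-1 * w 3 5 p v v') /\
  d_eq (e (ix 5)) (fun p v v' =>
    2 * w 1 2 p v v' + 2 * w 3 4 p v v' - 2^-1 * w 6 7 p v v') /\
  d_eq (e (ix 6)) (fun p v v' =>
    2 * w 1 3 p v v' + 2 * w 4 2 p v v' + 2^-1 * w 5 7 p v v') /\
  d_eq (e (ix 7)) (fun p v v' =>
    2 * w 1 4 p v v' + 2 * w 2 3 p v v' - 2^-1 * w 5 6 p v v').

Definition is_quaternionic_heisenberg (N : lieGroup7 R) (e : 'I_7 -> form1 N) :
    Prop :=
  [/\ simply_connected N,
      (exists E, left_invariant_dual_frames e E),
      (forall a : 'I_4, d_eq (e (hor a)) (fun p v v' => 0)) &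
      (forall s : 'I_3, d_eq (e (vert s)) (fun p v v' => 2 * omega e s p v v'))].

End lie_groups.

(* A quaternionic contact structure whose contact form, almost complex
   structures and Reeb fields are globally defined.  [qg] is the metric already
   extended to TM.  Only the restriction of [qI s] to H is meaningful.  The bundle Q is the span of the [qI s]; H is the common
   kernel of the [qeta s] and V the span of the Reeb fields [qxi s]. *)
Record qc_data (R : realType) (M : manifold7 R) := QcData {
  qg : form2 M;
  qI : 'I_3 -> M -> tvec R -> tvec R;
  qeta : 'I_3 -> form1 M;
  qxi : 'I_3 -> vfield M
}.

Section qc.
Variables (R : realType) (M : manifold7 R) (q : qc_data M).
Implicit Types (A B C D X Y Z W : vfield M) (p : M) (s k : 'I_3).

Local Notation g := (qg q).
Local Notation I := (qI q).
Local Notation eta := (qeta q).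
Local Notation xi := (qxi q).

Definition inH p (v : tvec R) : Prop := forall s, eta s p v = 0.
Definition inV p (v : tvec R) : Prop :=
  exists c : 'I_3 -> R, v = \sum_s c s *: xi s p.

Definition H_section X : Prop := smooth_vf X /\ forall p, inH p (X p).
Definition V_section X : Prop := smooth_vf X /\ forall p, inV p (X p).

Definition actI s X : vfield M := fun p => I s p (X p).

Definition o1 : 'I_3 := @Ordinal 3 0 isT.
Definition o2 : 'I_3 := @Ordinal 3 1 isT.
Definition o3 : 'I_3 := @Ordinal 3 2 isT.

Definition is_qc_metric : Prop :=
  [/\ (forall p (v : tvec R), scalar (g p v)),
      (forall p v w, g p v w = g p w v),
      (forall p v, inH p v -> v != 0 -> 0 < g p v v),
      (forall p v s, inH p v -> g p (xi s p) v = 0) &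
      (forall p s k, g p (xi s p) (xi k p) = (s == k)%:R)] /\
  (forall A B, smooth_vf A -> smooth_vf B ->
     smooth_fun (fun p => g p (A p) (B p))).

Definition is_hyperhermitian : Prop :=
  [/\ (forall s p, linear (I s p)),
      (forall s X, H_section X -> H_section (actI s X)),
      (forall s p v, inH p v -> inH p (I s p v) /\ I s p (I s p v) = - v),
      (forall p v, inH p v ->
         [/\ I o1 p (I o2 p v) = I o3 p v,
             I o2 p (I o1 p v) = - I o3 p v &
             I o1 p (I o2 p (I o3 p v)) = - v]) &
      (forall s p v w, inH p v -> inH p w ->
         g p (I s p v) (I s p w) = g p v w)].

Definition is_contact_with_reeb : Prop :=
  (forall s, smooth_form1 (eta s)) /\
  (forall s, smooth_vf (xi s)) /\
  (forall s X Y, H_section X -> H_section Y ->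
     forall p, 2 * g p (I s p (X p)) (Y p) = dform (eta s) X Y p) /\
  (forall s k p, eta s p (xi k p) = (s == k)%:R) /\
  (forall s X, H_section X -> forall p, dform (eta s) (xi s) X p = 0) /\
  (forall s k X, H_section X ->
     forall p, dform (eta k) (xi s) X p = - dform (eta s) (xi k) X p).

Definition is_qc_structure : Prop :=
  [/\ is_qc_metric, is_hyperhermitian & is_contact_with_reeb].

Implicit Type nabla : vfield M -> vfield M -> vfield M.

Definition is_linear_connection nabla : Prop :=
  (forall A B, smooth_vf A -> smooth_vf B -> smooth_vf (nabla A B)) /\
  (forall A A' B, smooth_vf A -> smooth_vf A' -> smooth_vf B ->
     nabla (fun p => A p + A' p) B = fun p => nabla A B p + nabla A' B p) /\
  (forall f A B, smooth_fun f -> smooth_vf A -> smooth_vf B ->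
     nabla (fscale f A) B = fscale f (nabla A B)) /\
  (forall A B B', smooth_vf A -> smooth_vf B -> smooth_vf B' ->
     nabla A (fun p => B p + B' p) = fun p => nabla A B p + nabla A B' p) /\
  (forall f A B, smooth_fun f -> smooth_vf A -> smooth_vf B ->
     nabla A (fscale f B) =
     fun p => lieder A f p *: B p + f p *: nabla A B p).

Definition torsion nabla A B : vfield M :=
  fun p => nabla A B p - nabla B A p - lie_bracket A B p.

Definition curv nabla A B C : vfield M :=
  fun p => nabla A (nabla B C) p - nabla B (nabla A C) p
           - nabla (lie_bracket A B) C p.

Definition curv4 nabla A B C D : M -> R :=
  fun p => g p (curv nabla A B C p) (D p).

(* The projection onto V along H. *)
Definition projV p (v : tvec R) : tvec R := \sum_s eta s p v *: xi s p.

Definition orthonormal_H (x : 'I_4 -> vfield M) p : Prop :=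
  (forall a, H_section (x a)) /\
  (forall a b, g p (x a p) (x b p) = (a == b)%:R).

(* The section  sum_s f_s I_s  of Q, applied to [X]. *)
Definition actQ (f : 'I_3 -> M -> R) X : vfield M :=
  fun p => \sum_s f s p *: I s p (X p).

(* (nabla_A sigma) X  for  sigma = sum_s f_s I_s. *)
Definition nablaQ nabla A (f : 'I_3 -> M -> R) X : vfield M :=
  fun p => nabla A (actQ f X) p - actQ f (nabla A X) p.

(* sp(1) + sp(1) in gl(H_p): the span of the I_s plus the skew endomorphisms
   commuting with the I_s. *)
Definition in_sp1sp1 p (B : tvec R -> tvec R) : Prop :=
  exists (c : 'I_3 -> R) (B' : tvec R -> tvec R),
  [/\ linear B',
      (forall v, inH p v -> inH p (B' v)),
      (forall v w, inH p v -> inH p w -> g p (B' v) w = - g p v (B' w)),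
      (forall s v, inH p v -> B' (I s p v) = I s p (B' v)) &
      (forall v, inH p v -> B v = \sum_s c s *: I s p v + B' v)].

Definition is_biquard_connection nabla : Prop :=
  is_linear_connection nabla /\
  (forall A X, smooth_vf A -> H_section X -> H_section (nabla A X)) /\
  (forall A X, smooth_vf A -> V_section X -> V_section (nabla A X)) /\
  (forall A B C, smooth_vf A -> smooth_vf B -> smooth_vf C ->
     forall p, lieder A (fun y => g y (B y) (C y)) p =
               g p (nabla A B p) (C p) + g p (B p) (nabla A C p)) /\
  (forall X Y, H_section X -> H_section Y ->
     forall p, torsion nabla X Y p = - projV p (lie_bracket X Y p)) /\
  (forall A (f : 'I_3 -> M -> R), smooth_vf A -> (forall s, smooth_fun (f s)) ->
     exists2 h : 'I_3 -> M -> R, (forall s, smooth_fun (h s)) &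
     forall X, H_section X -> nablaQ nabla A f X = actQ h X) /\
  (forall Z X, V_section Z -> H_section X -> H_section (torsion nabla Z X)) /\
  (forall Z, V_section Z -> forall p (x : 'I_4 -> vfield M)
       (b : tvec R -> tvec R),
     orthonormal_H x p -> in_sp1sp1 p b ->
     \sum_a g p (torsion nabla Z (x a) p) (b (x a p)) = 0) /\
  (* nabla phi = 0, where phi Z = sum_s eta_s(Z) I_s *)
  (forall A Z X, smooth_vf A -> V_section Z -> H_section X ->
     nablaQ nabla A (fun s p => eta s p (Z p)) X =
     actQ (fun s p => eta s p (nabla A Z p)) X).

Definition torsion_endomorphism_zero nabla : Prop :=
  forall Z X, V_section Z -> H_section X ->
  forall p, torsion nabla Z X p = 0.

Definition is_normalized_qc_scalar nabla (S : M -> R) : Prop :=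
  forall p x, orthonormal_H x p ->
  24 * S p = \sum_a \sum_b curv4 nabla (x b) (x a) (x a) (x b) p.

Definition T0 nabla X Y : M -> R := fun p =>
  g p (\sum_s torsion nabla (xi s) (actI s X) p) (Y p).

Definition fundamental_form s : form2 M := fun p v w => g p (I s p v) w.

Definition star (a b : tvec R -> tvec R -> R) (x y z w : tvec R) : R :=
  a x z * b y w + a y w * b x z - a y z * b x w - a x w * b y z.

Definition Wqc nabla (S : M -> R) X Y Z W : M -> R := fun p =>
  4^-1 * (curv4 nabla X Y Z W p
          + \sum_s curv4 nabla (actI s X) (actI s Y) Z W p)
  - 2^-1 * (\sum_s fundamental_form s p (Z p) (W p) *
             (T0 nabla X (actI s Y) p - T0 nabla (actI s X) Y p))
  + S p / 4 * (star (g p) (g p) (X p) (Y p) (Z p) (W p)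
               + \sum_s star (fundamental_form s p) (fundamental_form s p)
                          (X p) (Y p) (Z p) (W p)).

Definition qc_conformal_curvature_zero nabla : Prop :=
  forall S, is_normalized_qc_scalar nabla S ->
  forall X Y Z W, H_section X -> H_section Y -> H_section Z -> H_section W ->
  forall p, Wqc nabla S X Y Z W p = 0.

Definition locally_qc_conformally_flat : Prop :=
  exists (N : lieGroup7 R) (th : 'I_7 -> form1 N),
  is_quaternionic_heisenberg th /\
  forall p : M, exists (U : set M) (f : M -> N) (mu : M -> R)
                       (Psi : M -> 'M[R]_3),
  [/\ U p,
      diffeo_on U f,
      (forall y, U y -> smooth_fun_at mu y /\ 0 < mu y),
      (forall y, U y -> (forall s k, smooth_fun_at (fun z => Psi z s k) y) /\
         Psi y *m (Psi y)^T = 1%:M /\ \det (Psi y) = 1) &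
      (forall y, U y -> forall s (v : tvec R),
         pullback f (th (vert s)) y v = mu y * \sum_k Psi y s k * eta k y v)].

End qc.

(* I_s v = sum_a omega_s(v, e_a) e_a, i.e. g(I_s v, .) = omega_s(v, .). *)
Definition coframe_qc (R : realType) (G : lieGroup7 R)
    (e : 'I_7 -> form1 G) (E : 'I_7 -> vfield G) : qc_data G :=
  {| qg := fun p v w => \sum_i e i p v * e i p w;
     qI := fun s p v =>
       \sum_(a < 4) omega e s p v (E (hor a) p) *: E (hor a) p;
     qeta := fun s => e (vert s);
     qxi := fun s => E (vert s) |}.

(* Main.v *)
From HB Require Import structures.
Require Import Defs.
From mathcomp Require Import all_boot all_order all_algebra.
From mathcomp Require Import all_classical all_reals all_analysis.
From mathcomp Require Import ring lra.

Set Implicit Arguments.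
Unset Strict Implicit.
Unset Printing Implicit Defensive.

Import Order.TTheory GRing.Theory Num.Theory.
Import numFieldNormedType.Exports.
Local Open Scope classical_set_scope.
Local Open Scope ring_scope.

(** Part (a) and the vanishing of W^qc are algebra in the left invariant frame.
    Take the connection that is the Levi-Civita connection of hyperbolic 4-space
    in horizontal directions, is the Lie derivative along the Reeb fields in
    vertical directions, and induces on V the action on Q ([L1_conn]). It
    satisfies the Biquard axioms ([L1_nabla_biquard]), and its torsion
    endomorphism is zero. Conversely, the vertical frame fields act skewly on H
    by brackets; hence the torsion endomorphism of any Biquard connection is
    skew, that is, in so(4) = sp(1) + sp(1), while it is orthogonal to that
    space. It vanishes, a Koszul argument determines the rest, and every Biquard
    connection is the one above ([biquard_L1_coefficients]). The curvature on H
    is the hyperbolic one, which gives [S = - 1/2], and the curvature terms of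
    W^qc cancel against its scalar term ([L1_scalar], [L1_Wqc_zero]).

    For flatness no differential equation has to be integrated, because the
    group supplies the solutions. Right invariant fields commute with left
    invariant ones (equality of mixed derivatives of [f (x y)]); so the
    components [r^i] of a right invariant field in the frame [e_k] have the
    derivatives [de^i(., r)] ([rfun_deriv]). The change of coframe
    [B_s = e^(4+s) + 2 e^(1+s)] exhibits the Lie algebra as so(3) acting on the
    solvable algebra of translations of hyperbolic 4-space. For suitable initial
    vectors the components [h_s = r^(1+s)] of these fields near the unit satisfy
    [dh = - e^1 h + a H + 1/2 h x B], where [H = (e^2, e^3, e^4)] and [a] is 0
    or 1. The three solutions with [a = 0] are, up to the factor [scale^2], the
    rows of a rotation [O] with [dO_i = 1/2 O_i x B]; the solution with [a = 1]
    that vanishes at the unit is denoted by [y].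

    Let [u] be the unit quaternion of [O], so that [du = 1/4 u B]
    ([rotation_quaternion], [spin_deriv]), and put
    [q = scale u], [z = - 1/2 scale^2 O y].
    Then [dz + Im (dq (conj q)) = 1/4 scale^2 O eta] ([flat_contact]). As the
    contact form of the Heisenberg group is [dz + Im (dx (conj x))], the map
    [(q, z)] pulls it back to a positive multiple of a rotation of [eta]. Its
    derivative at the unit is injective ([flat_deriv_inj]), so it is a local
    diffeomorphism by the inverse function theorem ([inverse_function]); left
    translations move it to any point of the group ([L1_flat]). *)

(** * Functions of class C^k on normed spaces *)

Section near_congruence.
Variables (R : realType) (V W : normedModType R).
Implicit Types (f g : V -> W) (x v : V) (U : set V).

Lemma differentiable_near_eq f g x :
  (\forall y \near x, f y = g y) -> differentiable f x -> differentiable g x.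
Proof.
move=> fg df.
have fgx : f x = g x by exact: nbhs_singleton fg.
have eqg : g \o shift x = cst (g x) + 'd f x +o_ 0 id.
  apply/eqaddoP => eps eps0.
  have /eqaddoP/(_ eps eps0) := diff_locally df.
  have := fg; rewrite (near_shift 0 x) => fg0.
  apply: filterS2 fg0 => y /=; rewrite /= subr0 => yfg.
  by rewrite !fctE /= yfg fgx.
have dgE : 'd g x = 'd f x :> (V -> W).
  by apply: diff_unique => //; exact: diff_continuous.
apply/diff_locallyP; split; first by rewrite dgE; exact: diff_continuous.
by rewrite dgE.
Qed.

Lemma derive_chain (U' : normedModType R) (f : U' -> V) (g : V -> W) (x v : U') :
  differentiable f x -> differentiable g (f x) ->
  'D_v (g \o f) x = 'D_('D_v f x) g (f x).
Proof.
move=> df dg; rewrite !deriveE //; last exact: differentiable_comp.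
by rewrite diff_comp.
Qed.

End near_congruence.

Lemma derive_real (R : realType) (h : R -> R) (y w : R) :
  differentiable h y -> 'D_w h y = w * 'D_1 h y.
Proof.
by move=> dh; rewrite !deriveE // -{1}[w]mulr1 -[w * 1]/(w *: 1) linearZ.
Qed.

Section Ck_closure.
Variables (R : realType) (V : normedModType R).
Implicit Types (U : set V) (k : nat).

Section vector_valued.
Variable W : normedModType R.
Implicit Types f g : V -> W.

Lemma Ck_eq k U f g : open U -> (forall x, U x -> f x = g x) ->
  Ck k U f -> Ck k U g.
Proof.
move=> oU; elim: k f g => [|k IH] f g fg /=.
  move=> cf x Ux; rewrite /prop_for /continuous_at -(fg _ Ux).
  apply: cvg_trans (cf x Ux); apply: near_eq_cvg.
  by apply: filterS (open_nbhs_nbhs (conj oU Ux)) => y /fg.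
move=> [df Cf]; split=> [x Ux|v].
  apply: differentiable_near_eq (df x Ux).
  by apply: filterS (open_nbhs_nbhs (conj oU Ux)) => y /fg.
apply: (IH _ _ _ (Cf v)) => x Ux; apply: near_eq_derive.
by apply: filterS (open_nbhs_nbhs (conj oU Ux)) => y /fg.
Qed.

Lemma Ck_sub k U U' f : U' `<=` U -> Ck k U f -> Ck k U' f.
Proof.
move=> U'U; elim: k f => [|k IH] f /=; first by move=> cf x /U'U; exact: cf.
by move=> [df Cf]; split=> [x /U'U|v]; [exact: df|exact: IH].
Qed.

Lemma Ck_pred k U f : Ck k.+1 U f -> Ck k U f.
Proof.
elim: k f => [|k IH] f [df Cf].
  by move=> x Ux; exact/differentiable_continuous/df.
by split=> // v; exact: IH.
Qed.

Lemma Ck_cst k U (a : W) : Ck k U (fun=> a).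
Proof.
elim: k a => [|k IH] a /=; first by move=> x _; exact: cst_continuous.
split=> [x _|v]; first exact: differentiable_cst.
have -> : (fun x : V => 'D_v (fun=> a) x) = (fun=> 0 : W).
  by apply: boolp.funext => x; exact: derive_cst.
exact: IH.
Qed.

Lemma CkD k U f g : open U -> Ck k U f -> Ck k U g ->
  Ck k U (fun x => f x + g x).
Proof.
move=> oU; elim: k f g => [|k IH] f g.
  by move=> cf cg x Ux; apply: cvgD; [exact: cf|exact: cg].
move=> [df Cf] [dg Cg]; split=> [x Ux|v].
  by apply: differentiableD; [exact: df|exact: dg].
apply: (Ck_eq oU _ (IH _ _ (Cf v) (Cg v))) => x Ux.
by rewrite -deriveD //; apply: diff_derivable; [exact: df|exact: dg].
Qed.

Lemma CkZ k U (a : R) f : open U -> Ck k U f -> Ck k U (fun x => a *: f x).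
Proof.
move=> oU; elim: k f => [|k IH] f.
  by move=> cf x Ux; apply: continuousZl_tmp; exact: cf.
move=> [df Cf]; split=> [x Ux|v]; first by apply: differentiableZ; exact: df.
apply: (Ck_eq oU _ (IH _ (Cf v))) => x Ux.
by rewrite -deriveZ //; apply: diff_derivable; exact: df.
Qed.

Lemma Ck_sum k U (I : Type) (r : seq I) (P : pred I) (F : I -> V -> W) :
  open U -> (forall i, P i -> Ck k U (F i)) ->
  Ck k U (fun x => \sum_(i <- r | P i) F i x).
Proof.
move=> oU CF; elim: r => [|i r IH].
  by apply: (Ck_eq oU _ (Ck_cst k U 0)) => x _; rewrite big_nil.
case Pi : (P i).
  by apply: (Ck_eq oU _ (CkD oU (CF i Pi) IH)) => x _; rewrite big_cons Pi.
by apply: (Ck_eq oU _ IH) => x _; rewrite big_cons Pi.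
Qed.

End vector_valued.

Section real_valued.
Implicit Types f g : V -> R.

Lemma CkM k U f g : open U -> Ck k U f -> Ck k U g ->
  Ck k U (fun x => f x * g x).
Proof.
move=> oU; elim: k f g => [|k IH] f g.
  by move=> cf cg x Ux; apply: cvgM; [exact: cf|exact: cg].
move=> Cf Cg; have [df Df] := Cf; have [dg Dg] := Cg.
split=> [x Ux|v]; first by apply: differentiableM; [exact: df|exact: dg].
apply: (Ck_eq oU _ (CkD oU (IH _ _ (Ck_pred Cf) (Dg v))
                           (IH _ _ (Ck_pred Cg) (Df v)))) => x Ux.
by rewrite -deriveM //; apply: diff_derivable; [exact: df|exact: dg].
Qed.

(** The derivative of [1/f] is [- f' / f^2], so each order of smoothness gives
    the next one. *)
Lemma CkV k U f : open U -> (forall x, U x -> f x != 0) -> Ck k U f ->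
  Ck k U (fun x => (f x)^-1).
Proof.
move=> oU f0; elim: k => [|k IH].
  by move=> cf x Ux; apply: cvgV; [exact: f0|exact: cf].
move=> Cf; have [df Df] := Cf; have CV := IH (Ck_pred Cf).
split=> [x Ux|v]; first by apply: differentiableV; [exact: df|exact: f0].
apply: (Ck_eq oU _ (CkZ (-1) oU (CkM oU (CkM oU CV CV) (Df v)))) => x Ux.
rewrite (@deriveV _ _ f x v) ?f0 //; last by apply: diff_derivable; exact: df.
by rewrite scaleN1r /GRing.scale /= mulNr expr2 invfM.
Qed.

Lemma Ck_prod k U (I : Type) (r : seq I) (P : pred I) (F : I -> V -> R) :
  open U -> (forall i, P i -> Ck k U (F i)) ->
  Ck k U (fun x => \prod_(i <- r | P i) F i x).
Proof.
move=> oU CF; elim: r => [|i r IH].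
  by apply: (Ck_eq oU _ (Ck_cst (W := R) k U 1)) => x _; rewrite big_nil.
case Pi : (P i).
  by apply: (Ck_eq oU _ (CkM oU (CF i Pi) IH)) => x _; rewrite big_cons Pi.
by apply: (Ck_eq oU _ IH) => x _; rewrite big_cons Pi.
Qed.

(** The derivative of [sqrt f] is [f' / (2 sqrt f)], so each order of smoothness
    gives the next one. *)
Lemma Ck_sqrt k U f : open U -> (forall x, U x -> 0 < f x) -> Ck k U f ->
  Ck k U (fun x => Num.sqrt (f x)).
Proof.
move=> oU f0; have s0 x : U x -> 2 * Num.sqrt (f x) != 0.
  by move=> Ux; rewrite mulf_neq0 ?pnatr_eq0 // gt_eqF // sqrtr_gt0 f0.
elim: k => [|k IH].
  move=> cf x Ux; apply: (@continuous_comp _ _ _ f (@Num.sqrt R)).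
    exact: cf.
  exact: sqrt_continuous.
move=> Cf; have [df Df] := Cf; have CS := IH (Ck_pred Cf).
have dsqrt x : U x -> is_derive (f x) 1 (@Num.sqrt R) (2 * Num.sqrt (f x))^-1.
  by move=> Ux; apply: is_derive1_sqrt; exact: f0.
have dS x : U x -> differentiable (@Num.sqrt R) (f x).
  by move=> /dsqrt [dx _]; exact/derivable1_diffP.
split=> [x Ux|v].
  by apply: (@differentiable_comp _ _ _ _ f); [exact: df|exact: dS].
have C2S := CkV oU s0 (CkZ 2 oU CS).
apply: (Ck_eq oU _ (CkM oU (Df v) C2S)) => x Ux.
transitivity ('D_('D_v f x) (@Num.sqrt R) (f x)); last first.
  by rewrite -(derive_chain v (df x Ux) (dS x Ux)).
by rewrite derive_real; [have [_ ->] := dsqrt x Ux|exact: dS].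
Qed.

End real_valued.

(** Componentwise smoothness is what makes compositions tractable: the chain
    rule then only involves products of scalar functions. *)
Lemma Ck_rowP n k U (f : V -> 'rV[R]_n) : open U ->
  Ck k U f <-> (forall i, Ck k U (fun x => f x 0 i)).
Proof.
move=> oU; split.
- elim: k f => [|k IH] f.
    move=> cf i x Ux; apply: (@continuous_comp _ _ _ f (fun M : 'rV[R]_n => M 0 i)).
      exact: cf.
    exact: coord_continuous.
  move=> [df Cf] i; split=> [x Ux|v].
    apply: (@differentiable_comp _ _ _ _ f (fun M : 'rV[R]_n => M 0 i)).
      exact: df.
    exact: differentiable_coord.
  apply: (Ck_eq oU _ (IH _ (Cf v) i)) => x Ux.
  rewrite derive_mx ?mxE //; apply: diff_derivable; exact: df.
- move=> Cf.
  have fE x : \sum_i f x 0 i *: (delta_mx 0 i : 'rV[R]_n) = f x.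
    by rewrite -row_sum_delta.
  suff Ce (h : V -> R) (w : 'rV[R]_n) : Ck k U h -> Ck k U (fun x => h x *: w).
    by apply: (Ck_eq oU (fun x _ => fE x)); apply: Ck_sum => // i _; exact: Ce.
  elim: k h {Cf} => [|k IH] h.
    by move=> ch x Ux; apply: continuousZr_tmp; exact: ch.
  move=> [dh Ch]; split=> [x Ux|v].
    by apply: differentiableZl; exact: dh.
  apply: (Ck_eq oU _ (IH _ (Ch v))) => x Ux.
  rewrite !deriveE ?diffZl //; try exact: dh.
  by apply: differentiableZl; exact: dh.
Qed.

Lemma derive_delta n (g : 'rV[R]_n -> R) (y v : 'rV[R]_n) :
  differentiable g y -> 'D_v g y = \sum_i v 0 i * 'D_(delta_mx 0 i) g y.
Proof.
move=> dg; rewrite {1}(row_sum_delta v) deriveE // linear_sum.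
by apply: eq_bigr => i _; rewrite linearZ -deriveE.
Qed.

(** The derivative of [g \o f] is a sum of products of components of [f'] with
    composites of partial derivatives of [g] with [f], to which the induction
    hypothesis applies. *)
Lemma Ck_comp n k U (D : set 'rV[R]_n) (f : V -> 'rV[R]_n) (g : 'rV[R]_n -> R) :
  open U -> (forall x, U x -> D (f x)) -> Ck k U f -> Ck k D g ->
  Ck k U (g \o f).
Proof.
move=> oU fD; elim: k f g fD => [|k IH] f g fD.
  move=> cf cg x Ux; apply: continuous_comp; first exact: cf.
  by apply: cg; exact: fD.
move=> Cf Cg; have [df Df] := Cf; have [dg Dg] := Cg.
split=> [x Ux|v].
  by apply: differentiable_comp; [exact: df|exact/dg/fD].
have CS : Ck k U (fun x => \sum_i ('D_v f x) 0 i * 'D_(delta_mx 0 i) g (f x)).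
  apply: Ck_sum => // i _; apply: CkM => //.
    by have /(Ck_rowP _ _ oU) := Df v; apply.
  exact: (IH f ('D_(delta_mx 0 i) g) fD (Ck_pred Cf) (Dg _)).
apply: (Ck_eq oU _ CS) => x Ux.
rewrite (derive_chain v (df x Ux) (dg _ (fD x Ux))).
by rewrite -derive_delta //; exact/dg/fD.
Qed.

(** Source and target are arbitrary normed spaces here, which gives the
    restriction of functions on a product to its slices. *)
Lemma Ck_affine (V' W : normedModType R) k (D : set V') (g : V' -> W)
    (c : V') (L : {linear V -> V'}) :
  continuous L -> Ck k D g ->
  Ck k [set x | D (c + L x)] (fun x => g (c + L x)).
Proof.
move=> cL; have dA x : differentiable (fun x => c + L x) x.
  by apply: differentiableD => //; apply: linear_differentiable.
elim: k g => [|k IH] g /=.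
  move=> cg x Dx; apply: (@continuous_comp _ _ _ (fun x => c + L x) g) => //.
    exact: differentiable_continuous.
  exact: cg.
move=> [dg Cg]; split=> [x Dx|v].
  by apply: (@differentiable_comp _ _ _ _ (fun x => c + L x) g) => //; exact: dg.
have -> : (fun x => 'D_v (fun x => g (c + L x)) x) =
          (fun x => 'D_(L v) g (c + L x)).
  2: exact: (IH ('D_(L v) g) (Cg _)).
apply: boolp.funext => x; rewrite /derive.
suff -> : (fun h : R => h^-1 *: (g (c + L (h *: v + x)) - g (c + L x))) =
          (fun h : R => h^-1 *: (g (h *: L v + (c + L x)) - g (c + L x))) by [].
by apply: boolp.funext => h; rewrite linearP addrCA.
Qed.

End Ck_closure.

Section Coo_at_closure.
Variables (R : realType) (V : normedModType R).

Section vector_valued.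
Variable W : normedModType R.
Implicit Types (f g : V -> W) (x v : V).

Lemma Coo_at_eq f g x : (\forall y \near x, f y = g y) ->
  Coo_at f x -> Coo_at g x.
Proof.
move=> fg [U [oU Ux] Cf].
exists (U `&` [set y | f y = g y]°).
  split; last by split.
  by apply: openI => //; exact: open_interior.
move=> k; apply: (@Ck_eq _ _ _ _ _ f).
- by apply: openI => //; exact: open_interior.
- by move=> y [_ /interior_subset].
- by apply: Ck_sub (Cf k) => y [].
Qed.

Lemma Coo_at_near f x : Coo_at f x -> \forall y \near x, Coo_at f y.
Proof.
move=> [U [oU Ux] Cf]; apply: filterS (open_nbhs_nbhs (conj oU Ux)) => y Uy.
by exists U.
Qed.

Lemma Coo_at_differentiable f x : Coo_at f x -> differentiable f x.
Proof. by move=> [U [oU Ux] /(_ 1) [df _]]; exact: df. Qed.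

Lemma Coo_at_continuous f x : Coo_at f x -> {for x, continuous f}.
Proof. by move=> /Coo_at_differentiable; exact: differentiable_continuous. Qed.

Lemma Coo_at_derivable f x v : Coo_at f x -> derivable f x v.
Proof. by move=> /Coo_at_differentiable; exact: diff_derivable. Qed.

Lemma Coo_at_derive f x v : Coo_at f x -> Coo_at ('D_v f) x.
Proof.
by move=> [U [oU Ux] Cf]; exists U => // k; have [_] := Cf k.+1; exact.
Qed.

Lemma Coo_of_Coo_at (U : set V) f : (forall x, U x -> Coo_at f x) -> Coo U f.
Proof.
move=> Cf k; elim: k f Cf => [|k IH] f Cf.
  by move=> x /Cf; exact: Coo_at_continuous.
split=> [x /Cf|v]; first exact: Coo_at_differentiable.
by apply: IH => x /Cf; exact: Coo_at_derive.
Qed.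

Lemma Coo_at_cst (a : W) x : Coo_at (fun=> a) x.
Proof. by exists setT; [split=> //; exact: openT|move=> k; exact: Ck_cst]. Qed.

Lemma Coo_atD f g x : Coo_at f x -> Coo_at g x -> Coo_at (fun y => f y + g y) x.
Proof.
move=> [U [oU Ux] Cf] [U' [oU' Ux'] Cg]; exists (U `&` U').
  by split=> //; exact: openI.
move=> k; apply: CkD; first exact: openI.
- by apply: Ck_sub (Cf k) => y [].
- by apply: Ck_sub (Cg k) => y [].
Qed.

Lemma Coo_atZ (a : R) f x : Coo_at f x -> Coo_at (fun y => a *: f y) x.
Proof.
by move=> [U [oU Ux] Cf]; exists U => // k; exact: CkZ.
Qed.

Lemma Coo_atN f x : Coo_at f x -> Coo_at (fun y => - f y) x.
Proof.
by move=> /(Coo_atZ (-1)); apply: Coo_at_eq; near=> y; rewrite scaleN1r.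
Unshelve. all: by end_near. Qed.

Lemma Coo_atB f g x : Coo_at f x -> Coo_at g x -> Coo_at (fun y => f y - g y) x.
Proof. by move=> Cf Cg; apply: Coo_atD => //; exact: Coo_atN. Qed.

Lemma Coo_at_sum (I : Type) (r : seq I) (P : pred I) (F : I -> V -> W) x :
  (forall i, P i -> Coo_at (F i) x) ->
  Coo_at (fun y => \sum_(i <- r | P i) F i y) x.
Proof.
move=> CF; elim: r => [|i r IH].
  by apply: Coo_at_eq (Coo_at_cst 0 x); near=> y; rewrite big_nil.
case Pi : (P i).
  by apply: Coo_at_eq (Coo_atD (CF i Pi) IH); near=> y; rewrite big_cons Pi.
by apply: Coo_at_eq IH; near=> y; rewrite big_cons Pi.
Unshelve. all: by end_near. Qed.

End vector_valued.

Section real_valued.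
Implicit Types (f g : V -> R) (x v : V).

Lemma Coo_atM f g x : Coo_at f x -> Coo_at g x -> Coo_at (fun y => f y * g y) x.
Proof.
move=> [U [oU Ux] Cf] [U' [oU' Ux'] Cg]; exists (U `&` U').
  by split=> //; exact: openI.
move=> k; apply: CkM; first exact: openI.
- by apply: Ck_sub (Cf k) => y [].
- by apply: Ck_sub (Cg k) => y [].
Qed.

(** Shrinking the neighbourhood keeps the values where inversion or the square
    root is smooth. *)
Lemma Coo_at_open f x (A : set R) : open A -> A (f x) -> Coo_at f x ->
  exists2 U : set V, open U /\ U x & Coo U f /\ (forall y, U y -> A (f y)).
Proof.
move=> oA Ax Cf; have cf := Coo_at_continuous Cf.
have nA : nbhs x (f @^-1` A) by apply: cf; exact: open_nbhs_nbhs.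
have [U [oU Ux] CU] := Cf.
exists (U `&` (f @^-1` A)°).
  split; last by split=> //; exact: nbhs_interior nA.
  by apply: openI => //; exact: open_interior.
split=> [k|y [_ /interior_subset]] //.
by apply: Ck_sub (CU k) => y [].
Qed.

Lemma Coo_atV f x : f x != 0 -> Coo_at f x -> Coo_at (fun y => (f y)^-1) x.
Proof.
move=> f0 /(Coo_at_open (@open_neq _ 0) f0) [U [oU Ux] [Cf fU]].
by exists U => // k; apply: CkV.
Qed.

Lemma Coo_at_sqrt f x : 0 < f x -> Coo_at f x ->
  Coo_at (fun y => Num.sqrt (f y)) x.
Proof.
move=> f0 /(Coo_at_open (@open_gt _ 0) f0) [U [oU Ux] [Cf fU]].
by exists U => // k; apply: Ck_sqrt.
Qed.

End real_valued.

Lemma Coo_at_rowP n (f : V -> 'rV[R]_n) x :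
  Coo_at f x <-> forall i, Coo_at (fun y => f y 0 i) x.
Proof.
split=> [[U [oU Ux] Cf] i|Cf].
  by exists U => // k; have /(Ck_rowP _ _ oU) := Cf k; apply.
have /choice [U HU] : forall i, exists U : set V,
    [/\ open U, U x & Coo U (fun y => f y 0 i)].
  by move=> i; have [U [oU Ux] CU] := Cf i; exists U.
exists [set y | forall i, U i y]°.
  split; first exact: open_interior.
  by apply: filter_forall => i; have [oU Ux _] := HU i; exact: open_nbhs_nbhs.
move=> k; apply/Ck_rowP; first exact: open_interior.
move=> i; have [_ _ CU] := HU i.
by apply: Ck_sub (CU k) => y /interior_subset; apply.
Qed.

Lemma Coo_at_comp n (f : V -> 'rV[R]_n) (g : 'rV[R]_n -> R) x :
  Coo_at f x -> Coo_at g (f x) -> Coo_at (g \o f) x.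
Proof.
move=> Cf [D [oD Dx] Cg]; have cf := Coo_at_continuous Cf.
have nD : nbhs x (f @^-1` D) by apply: cf; exact: open_nbhs_nbhs.
have [U [oU Ux] CU] := Cf; exists (U `&` (f @^-1` D)°).
  by split; [apply: openI => //; exact: open_interior|split].
move=> k; apply: (@Ck_comp _ _ _ _ _ D) => //.
- by apply: openI => //; exact: open_interior.
- by move=> y [_ /interior_subset].
- by apply: Ck_sub (CU k) => y [].
Qed.

Lemma Coo_at_affine (V' W : normedModType R) (g : V' -> W)
    (c : V') (L : {linear V -> V'}) x :
  continuous L -> Coo_at g (c + L x) -> Coo_at (fun x => g (c + L x)) x.
Proof.
move=> cL [D [oD Dx] Cg]; exists [set y | D (c + L y)]; last first.
  by move=> k; exact: Ck_affine.
split=> //; apply: (@open_comp _ _ (fun y => c + L y)) => // y _.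
by apply: cvgD; [exact: cvg_cst|exact: cL].
Qed.

Lemma Coo_at_linear (W : normedModType R) (L : {linear V -> W}) x :
  continuous L -> Coo_at L x.
Proof.
move=> cL; exists setT; first by split=> //; exact: openT.
case=> [|k] /=; first by move=> y _; exact: cL.
split=> [y _|v]; first exact: linear_differentiable.
have -> : 'D_v L = (fun=> L v); last exact: Ck_cst.
apply: boolp.funext => y; rewrite deriveE; last exact: linear_differentiable.
by rewrite diff_lin.
Qed.

Lemma Coo_at_id x : Coo_at (fun y : V => y) x.
Proof.
exists setT; first by split=> //; exact: openT.
case=> [|k] /=; first by move=> y _; exact: cvg_id.
split=> [y _|v] //.
have -> : 'D_v (fun y : V => y) = (fun=> v); last exact: Ck_cst.
by apply: boolp.funext => y; exact: derive_id.
Qed.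

End Coo_at_closure.

Lemma Coo_at_comp_row (R : realType) (V : normedModType R) n m (f : V -> 'rV[R]_n) (g : 'rV[R]_n -> 'rV[R]_m) x :
  Coo_at f x -> Coo_at g (f x) -> Coo_at (g \o f) x.
Proof.
move=> Cf /Coo_at_rowP Cg; apply/Coo_at_rowP => i.
exact: (Coo_at_comp Cf (Cg i)).
Qed.

(** * The mean value theorem and symmetry of second derivatives *)

(** The contraction principle behind the inverse function theorem needs row
    spaces to be complete normed modules. *)
HB.instance Definition _ (R : realType) m n :=
  Uniform_isComplete.Build 'M[R]_(m, n) (@cauchy_cvg 'M[R]_(m, n)).

Section mean_value.
Variables (R : realType) (V : normedModType R).
Implicit Types (f : V -> R) (x v w : V).

Lemma derive_shiftr (W : normedModType R) (f : V -> W) x v w :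
  'D_v (fun y => f (y + w)) x = 'D_v f (x + w).
Proof.
rewrite /derive; suff -> : (fun h : R => h^-1 *: (f (h *: v + x + w) - f (x + w)))
  = (fun h : R => h^-1 *: (f (h *: v + (x + w)) - f (x + w))) by [].
by apply: boolp.funext => h; rewrite addrA.
Qed.

Lemma differentiable_shiftr (W : normedModType R) (f : V -> W) x w :
  differentiable f (x + w) -> differentiable (fun y => f (y + w)) x.
Proof. by move=> df; apply: (@differentiable_comp _ _ _ _ (fun y => y + w) f). Qed.

Lemma mvt_line f x v :
  (forall t : R, 0 <= t <= 1 -> differentiable f (x + t *: v)) ->
  exists2 t : R, 0 <= t <= 1 & f (x + v) - f x = 'D_v f (x + t *: v).
Proof.
move=> df; pose g (t : R) := f (x + t *: v).
have dZ (t : R) : differentiable (fun t : R => t *: v) t.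
  by apply: differentiableZl.
have dl (t : R) : differentiable (fun t : R => x + t *: v) t.
  by apply: differentiableD.
have Dl (t : R) : 'D_1 (fun t : R => x + t *: v) t = v.
  rewrite [LHS](@deriveD _ _ _ (cst x) (fun t : R => t *: v)); last first.
  - exact: diff_derivable.
  - exact: derivable_cst.
  rewrite derive_cst add0r deriveE // diffZl // diff_val /=.
  by rewrite scale1r.
have dg (t : R) : 0 <= t <= 1 -> is_derive t 1 g ('D_v f (x + t *: v)).
  move=> t01; have dgt : differentiable g t.
    by apply: (@differentiable_comp _ _ _ _ (fun t : R => x + t *: v) f) => //; exact: df.
  split; first exact: diff_derivable.
  by rewrite (derive_chain (f := fun t : R => x + t *: v)) ?Dl //; exact: df.
have [||c c01 gE] := @MVT R g (fun t => 'D_v f (x + t *: v)) 0 1 ltr01.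
- by move=> t; rewrite in_itv /= => /andP[t0 t1]; apply: dg; rewrite !ltW.
- apply: continuous_in_subspaceT => t; rewrite inE /= in_itv /= => t01.
  by have [dgt _] := dg t t01; exact/differentiable_continuous/derivable1_diffP.
exists c; first by move: c01; rewrite in_itv /= => /andP[c0 c1]; rewrite !ltW.
by move: gE; rewrite /g scale1r scale0r addr0 subr0 mulr1.
Qed.

Lemma derive_scale f x v (a : R) : differentiable f x ->
  'D_(a *: v) f x = a * 'D_v f x.
Proof. by move=> df; rewrite !deriveE // linearZ. Qed.

(** The mean value theorem along [v] for the increment [f (y + w) - f y], then
    along [w] for ['D_v f]. *)
Lemma second_difference f x v w (U : set V) : Ck 2 U f ->
  (forall s t : R, 0 <= s <= 1 -> 0 <= t <= 1 -> U (x + s *: v + t *: w)) ->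
  exists s t : R, [/\ 0 <= s <= 1, 0 <= t <= 1 &
    f (x + v + w) - f (x + v) - (f (x + w) - f x) =
    'D_w ('D_v f) (x + s *: v + t *: w)].
Proof.
move=> [df Df] UP; have [dDf _] := Df v.
have UP0 (s : R) : 0 <= s <= 1 -> U (x + s *: v).
  by move=> s01; have := UP s 0 s01; rewrite scale0r addr0 lexx ler01; exact.
have UP1 (s : R) : 0 <= s <= 1 -> U (x + s *: v + w).
  by move=> s01; have := UP s 1 s01; rewrite scale1r lexx ler01; exact.
pose g y := f (y + w) - f y.
have dgs (s : R) : 0 <= s <= 1 -> differentiable (fun y => f (y + w)) (x + s *: v).
  by move=> s01; apply: differentiable_shiftr; apply/df/UP1.
have [s s01 gE] : exists2 s : R, 0 <= s <= 1 &
    g (x + v) - g x = 'D_v g (x + s *: v).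
  apply: mvt_line => s s01.
  by apply: differentiableB; [exact: dgs|exact/df/UP0].
have [t t01 hE] : exists2 t : R, 0 <= t <= 1 &
    'D_v f (x + s *: v + w) - 'D_v f (x + s *: v) =
    'D_w ('D_v f) (x + s *: v + t *: w).
  exact: (@mvt_line ('D_v f) _ w (fun t t01 => dDf _ (UP s t s01 t01))).
exists s, t; split => //; rewrite -hE -[LHS]/(g (x + v) - g x) gE.
rewrite -(derive_shiftr f (x + s *: v) v w) -[g]/((fun y => f (y + w)) - f).
by apply: deriveB; apply: diff_derivable; [exact: dgs|exact: df (UP0 _ s01)].
Qed.

(** Schwarz: both mixed derivatives are limits of the same second difference. *)
Lemma Coo_at_schwarz f x v w : Coo_at f x ->
  'D_w ('D_v f) x = 'D_v ('D_w f) x.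
Proof.
move=> Cf; apply/eqP; rewrite -subr_eq0 -normr_eq0.
apply/eqP/le_anti/andP; split=> //; apply/ler_addgt0Pr => e e0; rewrite add0r.
have Cvw := Coo_at_continuous (Coo_at_derive w (Coo_at_derive v Cf)).
have Cwv := Coo_at_continuous (Coo_at_derive v (Coo_at_derive w Cf)).
have [U [oU Ux] CU] := Cf.
have e20 : 0 < e / 2 by rewrite divr_gt0.
have nU : nbhs x U by exact: (open_nbhs_nbhs (conj oU Ux)).
have near_vw : \forall y \near x, `|'D_w ('D_v f) x - 'D_w ('D_v f) y| < e / 2.
  by move/cvgrPdist_lt : Cvw => /(_ _ e20).
have near_wv : \forall y \near x, `|'D_v ('D_w f) x - 'D_v ('D_w f) y| < e / 2.
  by move/cvgrPdist_lt : Cwv => /(_ _ e20).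
have [r /= r0 rP] := (nbhs_normP _ _).1 (filterI nU (filterI near_vw near_wv)).
(* Steps [h v], [h w] short enough to stay where both mixed derivatives vary by less than [e / 2]. *)
pose m : R := `|v| + `|w| + 1.
have m0 : 0 < m by rewrite ltr_wpDl // addr_ge0.
have [h h0 hm] : exists2 h : R, 0 < h & h * m = r / 2.
  exists (r / (2 * m)); first by rewrite divr_gt0 // mulr_gt0.
  by field; rewrite gt_eqF.
have ball_st (s t : R) : 0 <= s <= 1 -> 0 <= t <= 1 ->
    `|s *: (h *: v) + t *: (h *: w)| < r.
  move=> /andP[s0 s1] /andP[t0 t1].
  apply: (@le_lt_trans _ _ (h * m)); last by rewrite hm ltr_pdivrMr // ltr_pMr // ltr1n.
  apply: le_trans (ler_normD _ _) _; rewrite !normrZ (ger0_norm s0) (ger0_norm t0).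
  rewrite (gtr0_norm h0) /m !mulrDr mulr1 -addrA lerD //.
    by rewrite ler_piMl // mulr_ge0 // ltW.
  by rewrite ler_wpDr ?(ltW h0) // ler_piMl // mulr_ge0 // ltW.
have near_st (s t : R) : 0 <= s <= 1 -> 0 <= t <= 1 -> (U `&` ([set y |
    `|'D_w ('D_v f) x - 'D_w ('D_v f) y| < e / 2] `&` [set y |
    `|'D_v ('D_w f) x - 'D_v ('D_w f) y| < e / 2]))
    (x + s *: (h *: v) + t *: (h *: w)).
  move=> s01 t01; apply: rP; rewrite /= -addrA opprD addNKr normrN.
  exact: ball_st.
have near_ts (s t : R) : 0 <= s <= 1 -> 0 <= t <= 1 -> (U `&` ([set y |
    `|'D_w ('D_v f) x - 'D_w ('D_v f) y| < e / 2] `&` [set y |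
    `|'D_v ('D_w f) x - 'D_v ('D_w f) y| < e / 2]))
    (x + s *: (h *: w) + t *: (h *: v)).
  by move=> s01 t01; rewrite addrAC; exact: near_st.
have DD a b y : U y -> 'D_(h *: a) ('D_(h *: b) f) y = h * (h * 'D_a ('D_b f) y).
  move=> Uy; have [dfU DfU] := CU 2.
  have [dDb _] := DfU b.
  have -> : 'D_(h *: a) ('D_(h *: b) f) y = 'D_(h *: a) (fun z => h * 'D_b f z) y.
    apply: near_eq_derive; apply: filterS (open_nbhs_nbhs (conj oU Uy)) => z Uz.
    exact: derive_scale (dfU _ Uz).
  have dDby := dDb _ Uy.
  rewrite -[fun z => _]/(h \*: 'D_b f) deriveZ; last exact: diff_derivable.
  by rewrite derive_scale.
have [s [t [s01 t01]]] := second_difference (CU 2)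
  (fun s t s01 t01 => (near_st s t s01 t01).1).
have [] := near_st s t s01 t01.
move: (x + s *: (h *: v) + t *: (h *: w)) => y Uy [vw_lt _] E1.
have [s' [t' [s01' t01']]] := second_difference (CU 2)
  (fun s t s01 t01 => (near_ts s t s01 t01).1).
have [] := near_ts s' t' s01' t01'.
move: (x + s' *: (h *: w) + t' *: (h *: v)) => z Uz [_ wv_lt] E2.
have EE : 'D_w ('D_v f) y = 'D_v ('D_w f) z.
  apply: (mulfI (lt0r_neq0 h0)); apply: (mulfI (lt0r_neq0 h0)).
  have swap (a b c d : R) : a - b - (c - d) = a - c - (b - d) by ring.
  have := etrans E2 (DD v w _ Uz); rewrite (addrAC x (h *: w) (h *: v)) => E2'.
  exact: etrans (etrans (esym (DD w v _ Uy)) (esym E1)) (etrans (swap _ _ _ _) E2').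
move: vw_lt wv_lt; rewrite /= EE => vw_lt wv_lt.
apply: le_trans (_ : e / 2 + e / 2 <= _); last by rewrite -splitr.
have tri (a b c : R) : `|a - b| <= `|a - c| + `|b - c|.
  by rewrite (distrC b c); exact: ler_distD.
exact: le_trans (tri _ _ _) (lerD (ltW vw_lt) (ltW wv_lt)).
Qed.

Lemma derive0_constant_ball f x (r : R) :
  (forall y, ball x r y -> differentiable f y) ->
  (forall y v, ball x r y -> 'D_v f y = 0) ->
  forall y, ball x r y -> f y = f x.
Proof.
move=> df Df y xy.
have seg (t : R) : 0 <= t <= 1 -> ball x r (x + t *: (y - x)).
  move=> /andP[t0 t1]; move: xy; rewrite -ball_normE /= => xy.
  rewrite opprD addNKr normrN normrZ ger0_norm //.
  by apply: le_lt_trans xy; rewrite distrC ler_piMl.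
have [t t01] := mvt_line (fun t t01 => df _ (seg t t01)).
by rewrite Df; [rewrite [x + _]addrC subrK => /subr0_eq|exact: seg].
Qed.

End mean_value.

Section product_derivatives.
Variables (R : realType) (V W : normedModType R).

Lemma derive_pairl (Z : normedModType R) (F : V * W -> Z) x y v :
  'D_v (fun x => F (x, y)) x = 'D_(v, 0) F (x, y).
Proof.
rewrite /derive; suff -> : (fun h : R => h^-1 *: (F (h *: v + x, y) - F (x, y))) =
  (fun h : R => h^-1 *: (F (h *: (v, 0 : W) + (x, y)) - F (x, y))) by [].
apply: boolp.funext => h; congr (_ *: (F _ - _)).
by rewrite -[RHS]/(h *: v + x, h *: (0 : W) + y) scaler0 add0r.
Qed.

Lemma derive_pairr (Z : normedModType R) (F : V * W -> Z) x y v :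
  'D_v (fun y => F (x, y)) y = 'D_(0, v) F (x, y).
Proof.
rewrite /derive; suff -> : (fun h : R => h^-1 *: (F (x, h *: v + y) - F (x, y))) =
  (fun h : R => h^-1 *: (F (h *: (0 : V, v) + (x, y)) - F (x, y))) by [].
apply: boolp.funext => h; congr (_ *: (F _ - _)).
by rewrite -[RHS]/(h *: (0 : V) + x, h *: v + y) scaler0 add0r.
Qed.

Lemma Coo_at_pairl (Z : normedModType R) (F : V * W -> Z) x y :
  Coo_at F (x, y) -> Coo_at (fun x => F (x, y)) x.
Proof.
have li : linear (fun x : V => (x, 0 : W)).
  by move=> a u v; rewrite -[RHS]/(a *: u + v, a *: (0 : W) + 0) scaler0 addr0.
pose L : {linear V -> (V * W)%type} := HB.pack (fun x : V => (x, 0 : W)) (GRing.isLinear.Build _ _ _ _ _ li).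
have cL : continuous L by move=> u; apply: cvg_pair; [exact: cvg_id|exact: cvg_cst].
have E u : (0, y) + L u = (u, y) by congr (_, _); rewrite /= ?add0r ?addr0.
rewrite -(E x) => /(Coo_at_affine cL).
by apply: Coo_at_eq; near=> u; rewrite E.
Unshelve. all: by end_near. Qed.

Lemma Coo_at_pairr (Z : normedModType R) (F : V * W -> Z) x y :
  Coo_at F (x, y) -> Coo_at (fun y => F (x, y)) y.
Proof.
have li : linear (fun x : W => (0 : V, x)).
  by move=> a u v; rewrite -[RHS]/(a *: (0 : V) + 0, a *: u + v) scaler0 addr0.
pose L : {linear W -> (V * W)%type} := HB.pack (fun x : W => (0 : V, x)) (GRing.isLinear.Build _ _ _ _ _ li).
have cL : continuous L by move=> u; apply: cvg_pair; [exact: cvg_cst|exact: cvg_id].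
have E u : (x, 0) + L u = (x, u) by congr (_, _); rewrite /= ?add0r ?addr0.
rewrite -(E y) => /(Coo_at_affine cL).
by apply: Coo_at_eq; near=> u; rewrite E.
Unshelve. all: by end_near. Qed.

End product_derivatives.

(** * The inverse function theorem *)

Lemma near_forall (I : finType) (T : topologicalType) (x : T) (P : I -> T -> Prop) :
  (forall i, \forall z \near x, P i z) -> \forall z \near x, forall i, P i z.
Proof. exact: filter_forall. Qed.

Section first_order_expansion.
Variables (R : realType) (V W : normedModType R).
Implicit Types (f : V -> W) (x : V).

Lemma differentiable_expansion f x : differentiable f x ->
  forall eps : R, 0 < eps ->
  \forall u \near (0 : V), `|f (u + x) - (f x + 'D_u f x)| <= eps * `|u|.
Proof.
move=> df eps eps0; have := (eqaddoP _ _ _ _).1 (diff_locally df) _ eps0.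
by apply: filterS => u; rewrite !fctE /= -deriveE.
Qed.

Lemma differentiable_of_expansion f (L : {linear V -> W}) x : continuous L ->
  (forall eps : R, 0 < eps ->
   \forall u \near (0 : V), `|f (u + x) - (f x + L u)| <= eps * `|u|) ->
  differentiable f x /\ (forall u, 'D_u f x = L u).
Proof.
move=> cL fL; have fE : f \o shift x = cst (f x) + L +o_ 0 id.
  by apply/eqaddoP => eps eps0; apply: filterS (fL _ eps0) => u; rewrite !fctE.
have dE : 'd f x = L :> (V -> W) by exact: diff_unique.
have df : differentiable f x by apply/diff_locallyP; rewrite dE.
by split=> // u; rewrite deriveE // dE.
Qed.

End first_order_expansion.

Section row_norm.
Variables (R : realType) (n : nat).
Implicit Types v : 'rV[R]_n.

Lemma row_coord_le v i : `|v 0 i| <= `|v|.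
Proof. by rewrite [leRHS]/Num.Def.normr /= mx_normrE (le_bigmax _ _ (0, i)). Qed.

Lemma row_norm_le v (a : R) : 0 <= a -> (forall i, `|v 0 i| <= a) -> `|v| <= a.
Proof.
move=> a0 va; rewrite [leLHS]/Num.Def.normr /= mx_normrE.
by apply: bigmax_le => // -[i j] _ /=; rewrite ord1.
Qed.

Variables (W : normedModType R) (L : {linear 'rV[R]_n -> W}).

Lemma row_linearE v : L v = \sum_i v 0 i *: L (delta_mx 0 i).
Proof. by rewrite {1}(row_sum_delta v) linear_sum; apply: eq_bigr => i _; rewrite linearZ. Qed.

Lemma row_linear_continuous : continuous L.
Proof.
move=> v; suff CL : Ck 0 setT (fun v => \sum_i v 0 i *: L (delta_mx 0 i)).
  have -> : (L : _ -> _) = (fun v => \sum_i v 0 i *: L (delta_mx 0 i)).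
    by apply: boolp.funext => w; exact: row_linearE.
  exact: CL.
apply: Ck_sum; first exact: openT.
by move=> i _ w _; apply: continuousZr_tmp; exact: coord_continuous.
Qed.

Lemma row_linear_bounded : exists2 M : R, 0 < M & forall v, `|L v| <= M * `|v|.
Proof.
exists (\sum_i `|L (delta_mx 0 i)| + 1) => [|v].
  by rewrite ltr_wpDl // sumr_ge0.
rewrite row_linearE mulrDl mul1r ler_wpDr // mulr_suml.
apply: le_trans (ler_norm_sum _ _ _) _; apply: ler_sum => i _.
by rewrite normrZ mulrC ler_wpM2l // row_coord_le.
Qed.

End row_norm.

Section inverse_function.
Variables (R : realType) (n : nat).
Implicit Types (x y z v w : 'rV[R]_n) (phi : 'rV[R]_n -> 'rV[R]_n).

Lemma derive_coord phi x v i : differentiable phi x ->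
  ('D_v phi x) 0 i = 'D_v (fun y => phi y 0 i) x.
Proof. by move=> dp; rewrite derive_mx ?mxE //; exact: diff_derivable. Qed.

(** The partial derivatives are small near a critical point, and the mean value
    theorem turns this into a Lipschitz bound coordinate by coordinate. *)
Lemma flat_point_contraction phi x0 : Coo_at phi x0 ->
  (forall v, 'D_v phi x0 = 0) ->
  exists2 r : R, 0 < r &
    [/\ (forall z, ball x0 r z -> Coo_at phi z),
        (forall z v, ball x0 r z -> `|'D_v phi z| <= 2^-1 * `|v|) &
        (forall x y, ball x0 r x -> ball x0 r y ->
           `|phi x - phi y| <= 2^-1 * `|x - y|)].
Proof.
move=> Cp Dp0.
have Cpj := (Coo_at_rowP phi x0).1 Cp.
(* [n] partial derivatives below [e] bound the derivative of a coordinate by 1/2. *)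
pose e : R := (2 * n.+1%:R)^-1.
have e0 : 0 < e by rewrite invr_gt0 mulr_gt0.
have Dsmall : \forall z \near x0, forall i j : 'I_n,
    `|'D_(delta_mx 0 i) (fun y => phi y 0 j) z| < e.
  suff : \forall z \near x0, forall ij : 'I_n * 'I_n,
      `|'D_(delta_mx 0 ij.1) (fun y => phi y 0 ij.2) z| < e.
    by apply: filterS => z Hz i j; exact: (Hz (i, j)).
  apply: near_forall => -[i j] /=.
  have := Coo_at_continuous (Coo_at_derive (delta_mx 0 i) (Cpj j)).
  move/cvgrPdist_lt => /(_ _ e0); apply: filterS => z.
  rewrite -(derive_coord (delta_mx 0 i) j (Coo_at_differentiable Cp)) Dp0 mxE.
  by rewrite sub0r normrN.
have [r /= r0 rP] := (nbhs_ballP _ _).1 (filterI (Coo_at_near Cp) Dsmall).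
have Cz z : ball x0 r z -> Coo_at phi z by move=> /rP [].
have Dbound z v j : ball x0 r z ->
    `|'D_v (fun y => phi y 0 j) z| <= 2^-1 * `|v|.
  move=> xz; have [Cpz Dz] := rP z xz.
  have dpz := Coo_at_differentiable ((Coo_at_rowP _ _).1 Cpz j).
  rewrite derive_delta //; apply: le_trans (ler_norm_sum _ _ _) _.
  apply: (@le_trans _ _ (\sum_(i < n) `|v| * e)).
    apply: ler_sum => i _; rewrite normrM ler_pM // ?row_coord_le //.
    exact: ltW (Dz i j).
  have eE : e * n.+1%:R = 2^-1.
    by rewrite /e invfM divfK // pnatr_eq0.
  rewrite sumr_const card_ord -[_ *+ n]mulr_natr -eE -mulrA mulrC.
  by rewrite ler_wpM2r // ler_wpM2l ?(ltW e0) // ler_nat.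
exists r => //; split=> // [z v xz|x y x0x x0y].
  apply: row_norm_le => [|j]; first by rewrite mulr_ge0.
  rewrite derive_coord; first exact: Dbound.
  exact: Coo_at_differentiable (Cz z xz).
apply: row_norm_le => [|j]; first by rewrite mulr_ge0.
have seg (t : R) : 0 <= t <= 1 -> ball x0 r (y + t *: (x - y)).
  move=> /andP[t0 t1]; move: x0x x0y; rewrite -!ball_normE /= => xx yy.
  have -> : x0 - (y + t *: (x - y)) = (1 - t) *: (x0 - y) + t *: (x0 - x).
    by apply/rowP => i; rewrite !mxE; ring.
  apply: le_lt_trans (ler_normD _ _) _; rewrite !normrZ (ger0_norm t0).
  rewrite ger0_norm ?subr_ge0 //.
  have [->|tn0] := eqVneq t 0; first by rewrite mul0r addr0 subr0 mul1r.
  have tp : 0 < t by rewrite lt_neqAle eq_sym tn0.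
  have -> : r = (1 - t) * r + t * r by ring.
  by rewrite ler_ltD // ?ltr_pM2l // ler_wpM2l ?subr_ge0 // ltW.
have [t t01] := @mvt_line _ _ (fun y => phi y 0 j) y (x - y) (fun t t01 =>
  Coo_at_differentiable ((Coo_at_rowP _ _).1 (Cz _ (seg t t01)) j)).
have -> : y + (x - y) = x by rewrite addrC subrK.
rewrite !mxE => ->; exact: Dbound (seg t t01).
Qed.

Lemma perturbed_identity_inj phi (B : set 'rV[R]_n) :
  (forall x y, B x -> B y -> `|phi x - phi y| <= 2^-1 * `|x - y|) ->
  forall x y, B x -> B y -> `|x - y| <= 2 * `|(x + phi x) - (y + phi y)|.
Proof.
move=> cB x y Bx By; have := cB x y Bx By.
have -> : (x + phi x) - (y + phi y) = (x - y) + (phi x - phi y).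
  by rewrite opprD addrACA.
have : `|x - y| <= `|(x - y) + (phi x - phi y)| + `|phi x - phi y|.
  by rewrite -{1}[x - y](addrK (phi x - phi y)) ler_normB.
lra.
Qed.

(** A solution of [x + phi x = y] is a fixed point of the contraction
    [x |-> y - phi x]. *)
Lemma perturbed_identity_surj phi x1 (d : R) : 0 < d ->
  (forall x y, closed_ball x1 d x -> closed_ball x1 d y ->
     `|phi x - phi y| <= 2^-1 * `|x - y|) ->
  forall y, `|y - (x1 + phi x1)| <= d / 2 ->
  exists2 x, closed_ball x1 d x & x + phi x = y.
Proof.
move=> d0 cB y yd.
have x1B : closed_ball x1 d x1 by exact: closed_ballxx.
pose T x := y - phi x.
have TB : {homo T : x / closed_ball x1 d x >-> closed_ball x1 d x}.
  move=> x Bx; have := cB x1 x x1B Bx.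
  move: Bx; rewrite closed_ballE // /closed_ball_ /= => Bx cx.
  have -> : x1 - T x = - (y - (x1 + phi x1)) - (phi x1 - phi x).
    by rewrite /T; apply/rowP => i; rewrite !mxE; ring.
  have := ler_normB (- (y - (x1 + phi x1))) (phi x1 - phi x).
  rewrite normrN; lra.
have ctr : is_contraction [fun of mkfun TB].
  exists (2^-1)%:nng; split => /=.
    by rewrite invf_lt1 // ltr1n.
  move=> [x x'] [/= Bx Bx'] /=; rewrite /mkfun /T opprB addrC addrA subrK.
  by rewrite [in leRHS]distrC; exact: cB.
have [|x Bx xE] := banach_fixed_point ctr (@closed_ball_closed _ _ x1 d).
  by exists x1.
by exists x => //; rewrite {1}xE /= /mkfun /T subrK.
Qed.

(** The inverse of a Lipschitz-close-to-identity map inherits differentiability: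
    its increments are comparable with those of the map. *)
Lemma inverse_differentiable (F h : 'rV[R]_n -> 'rV[R]_n) (D : 'M[R]_n) x y (c : R) :
  differentiable F x -> (forall v, 'D_v F x = v *m D) -> D \in unitmx ->
  F x = y -> 0 < c ->
  (\forall z \near y, F (h z) = z /\ `|h z - x| <= c * `|z - y|) ->
  h y = x /\ differentiable h y /\ (forall w, 'D_w h y = w *m invmx D).
Proof.
move=> dF DF Du Fx c0 hnear.
have hy : h y = x.
  have [_] := nbhs_singleton hnear; rewrite subrr normr0 mulr0 normr_le0.
  by rewrite subr_eq0 => /eqP.
pose L : {linear 'rV[R]_n -> 'rV[R]_n} := mulmxr (invmx D).
have cL : continuous L by exact: row_linear_continuous.
have [M M0 LM] := row_linear_bounded L.
split=> //; apply: (differentiable_of_expansion cL) => eps eps0.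
have e'0 : 0 < eps / (c * M) by rewrite divr_gt0 // mulr_gt0.
have [r /= r0 rP] := (nbhs_normP _ _).1 (differentiable_expansion dF e'0).
have nr : \forall k \near (0 : 'rV[R]_n), `|k| < r / c.
  apply/nbhs_normP; exists (r / c) => /=; first by rewrite divr_gt0.
  by move=> k /=; rewrite sub0r normrN.
have hn0 := hnear; rewrite (near_shift 0 y) in hn0.
apply: filterS2 nr hn0 => k kr; rewrite /= subr0 => -[Fz uz].
rewrite hy; move: uz; have -> : k + y - y = k by rewrite addrK.
set u := h (k + y) - x => uz.
have ur : ball_ Num.Def.normr 0 r u.
  rewrite /= sub0r normrN; apply: le_lt_trans uz _.
  by rewrite mulrC -ltr_pdivlMr.
have uD : `|u *m D - k| <= eps / (c * M) * (c * `|k|).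
  have := rP u ur; rewrite /= DF /u subrK Fz Fx -/u => kuD.
  have -> : u *m D - k = - (k + y - (y + u *m D)).
    by apply/rowP => i; rewrite !mxE; ring.
  by rewrite normrN; apply: le_trans kuD _; rewrite ler_pM2l.
have -> : h (k + y) - (x + L k) = L (u *m D - k).
  by rewrite /L /= mulmxBl mulmxK // /u opprD addrA.
apply: le_trans (LM _) _; apply: le_trans (ler_wpM2l (ltW M0) uD) _.
suff -> : M * (eps / (c * M) * (c * `|k|)) = eps * `|k| by [].
by field; rewrite !gt_eqF.
Qed.

Lemma Ck_det m k (U : set 'rV[R]_n) (A : 'rV[R]_n -> 'M[R]_m) : open U ->
  (forall i j, Ck k U (fun x => A x i j)) -> Ck k U (fun x => \det (A x)).
Proof.
move=> oU CA; apply: Ck_sum => // s _; apply: CkM => //; first exact: Ck_cst.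
exact: Ck_prod.
Qed.

(** Cramer's rule: the entries of the inverse are rational in those of the matrix. *)
Lemma Ck_invmx m k (U : set 'rV[R]_n) (A : 'rV[R]_n -> 'M[R]_m) i j : open U ->
  (forall x, U x -> A x \in unitmx) ->
  (forall i j, Ck k U (fun x => A x i j)) -> Ck k U (fun x => (invmx (A x)) i j).
Proof.
move=> oU Au CA; have detn0 x : U x -> \det (A x) != 0.
  by move=> /Au; rewrite unitmxE unitfE.
have CV := CkV oU detn0 (Ck_det oU CA).
have Cadj : Ck k U (fun x => (\adj (A x)) i j).
  apply: (@Ck_eq _ _ _ _ _ (fun x => (-1) ^+ (j + i) * \det (row' j (col' i (A x))))).
  - exact: oU.
  - by move=> x _; rewrite mxE.
  apply: CkM => //; first exact: Ck_cst.
  apply: Ck_det => // a b; apply: (Ck_eq oU _ (CA (lift j a) (lift i b))) => x _.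
  by rewrite !mxE.
apply: (Ck_eq oU _ (CkM oU CV Cadj)) => x Ux.
by rewrite /invmx (Au x Ux) !mxE.
Qed.

(** Vectors are rows, on which matrices act from the right: the direction of
    differentiation is the row index. *)
Definition jacobian_rows phi x : 'M[R]_n :=
  \matrix_(i, j) 'D_(delta_mx 0 i) (fun y => phi y 0 j) x.

Lemma derive_jacobian phi x v : differentiable phi x ->
  'D_v phi x = v *m jacobian_rows phi x.
Proof.
move=> dp; apply/rowP => j; rewrite derive_coord // !mxE derive_delta.
  by apply: eq_bigr => i _; rewrite mxE.
by apply: (@differentiable_comp _ _ _ _ phi (fun M : 'rV[R]_n => M 0 j)) => //;
  exact: differentiable_coord.
Qed.

(** The derivative of the inverse is the inverse Jacobian composed with the
    inverse itself, which gains one order of smoothness at each step. *)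
Lemma inverse_smooth (B V : set 'rV[R]_n) (F h : 'rV[R]_n -> 'rV[R]_n) :
  open B -> open V -> Coo B F -> (forall x, B x -> jacobian_rows F x \in unitmx) ->
  (forall y, V y -> B (h y)) ->
  (forall y, V y -> differentiable h y /\
     forall w, 'D_w h y = w *m invmx (jacobian_rows F (h y))) ->
  Coo V h.
Proof.
move=> oB oV CF Ju hB Dh.
have CJ k i j : Ck k B (fun x => invmx (jacobian_rows F x) i j).
  apply: Ck_invmx => // a b.
  have /(Ck_rowP _ _ oB)/(_ b) [_ /(_ (delta_mx 0 a))] := CF k.+1.
  by apply: Ck_eq => // x _; rewrite mxE.
elim=> [|k IH]; first by move=> y /Dh [dh _]; exact: differentiable_continuous.
split=> [y /Dh[] //|w]; apply/(Ck_rowP _ _ oV) => j.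
have CS : Ck k V (fun y => \sum_i w 0 i * invmx (jacobian_rows F (h y)) i j).
  apply: Ck_sum => // i _; apply: CkM => //; first exact: Ck_cst.
  exact: (@Ck_comp _ _ _ _ _ B h (fun x => invmx (jacobian_rows F x) i j)).
apply: (Ck_eq oV _ CS) => y /Dh [_ ->]; by rewrite mxE.
Qed.

(** The map is the identity plus a perturbation that is 1/2-Lipschitz near the
    base point: comparing increments gives injectivity, and the fixed point
    argument shows that the image is open. *)
Lemma inverse_function_normalised (G : 'rV[R]_n -> 'rV[R]_n) x0 (O : set 'rV[R]_n) :
  nbhs x0 O -> Coo_at G x0 -> (forall v, 'D_v G x0 = v) ->
  exists (B : set 'rV[R]_n) (h : 'rV[R]_n -> 'rV[R]_n),
    [/\ open B, B x0 & B `<=` O] /\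
    [/\ (forall x, B x -> Coo_at G x), open (G @` B),
        (forall x, B x -> h (G x) = x) & Coo (G @` B) h].
Proof.
move=> nO CG DG; pose phi x := G x - x.
have Cid x : Coo_at (fun y : 'rV[R]_n => y) x by exact: Coo_at_id.
have Cphi : Coo_at phi x0 by exact: Coo_atB.
have Dphi0 v : 'D_v phi x0 = 0.
  rewrite /phi -[fun x => _]/(G - id) deriveB; last exact: derivable_id.
    by rewrite DG derive_id subrr.
  exact: Coo_at_derivable.
have [r0 r0_gt [Cr0 Dr0 Lr0]] := flat_point_contraction Cphi Dphi0.
have [r1 /= r1_gt r1O] := (nbhs_ballP _ _).1 nO.
pose r := Num.min r0 r1.
have r_gt : 0 < r by rewrite lt_min r0_gt.
have sub0 x : ball x0 r x -> ball x0 r0 x by apply: le_ball; rewrite ge_min lexx.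
have sub1 x : ball x0 r x -> ball x0 r1 x by apply: le_ball; rewrite ge_min lexx orbT.
pose B := ball x0 r.
have GE x : x + phi x = G x by rewrite /phi addrC subrK.
have oB : open B by exact: ball_open.
have CGB x : B x -> Coo_at G x.
  move=> /sub0/Cr0 Cp; apply: Coo_at_eq (Coo_atD (Cid x) Cp).
  by near=> y; exact: GE.
have LB x y : B x -> B y -> `|phi x - phi y| <= 2^-1 * `|x - y|.
  by move=> /sub0 Bx /sub0 By; exact: Lr0.
have GL x y : B x -> B y -> `|x - y| <= 2 * `|G x - G y|.
  by move=> Bx By; have := perturbed_identity_inj LB Bx By; rewrite !GE.
have Ginj x y : B x -> B y -> G x = G y -> x = y.
  move=> Bx By Gxy; have := GL x y Bx By; rewrite Gxy subrr normr0 mulr0.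
  by rewrite normr_le0 subr_eq0 => /eqP.
pose V := G @` B.
have oV : open V.
  rewrite openE => _ [x1 Bx1 <-].
  have [d /= d0 dB] : exists2 d : R, 0 < d & closed_ball x1 d `<=` B.
    have [d /= d0 dB] := (nbhs_ballP _ _).1 (open_nbhs_nbhs (conj oB Bx1)).
    have d20 : 0 < d / 2 by rewrite divr_gt0.
    exists (d / 2) => // z; rewrite closed_ballE // /closed_ball_ /= => zd.
    apply: dB; rewrite -ball_normE /=; apply: le_lt_trans zd _.
    by rewrite ltr_pdivrMr // ltr_pMr // ltr1n.
  apply: (nbhs_ballP (G x1) V).2; exists (d / 2) => /=; first by rewrite divr_gt0.
  move=> y /=; rewrite -ball_normE /= => yd; have [||x xd xy] := @perturbed_identity_surj phi x1 d d0 _ y.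
  - by move=> x z /dB Bx /dB Bz; exact: LB.
  - by rewrite GE distrC ltW.
  by exists x; [exact: dB|rewrite -xy GE].
pose h y := xget x0 [set x | B x /\ G x = y].
have hV y : V y -> B (h y) /\ G (h y) = y.
  move=> [x Bx Gx]; have : [set x | B x /\ G x = y] !=set0 by exists x.
  by move=> /(xgetPex x0).
have hG x : B x -> h (G x) = x.
  move=> Bx; have [Bh Gh] : B (h (G x)) /\ G (h (G x)) = G x.
    by apply: hV; exists x.
  exact: Ginj.
exists B, h; split; first by split=> //; [exact: ballxx|move=> x /sub1; exact: r1O].
split=> //.
have Ju x : B x -> jacobian_rows G x \in unitmx.
  move=> Bx; rewrite -row_free_unit -kermx_eq0; apply/rowV0P => v /sub_kermxP vJ.
  have dG := Coo_at_differentiable (CGB x Bx).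
  have := Dr0 x v (sub0 _ Bx).
  rewrite /phi -[fun x => _]/(G - id) deriveB; last exact: derivable_id.
    rewrite (derive_jacobian _ dG) vJ derive_id sub0r normrN => vle.
    by apply/eqP; rewrite -normr_le0; lra.
  exact: diff_derivable.
apply: (@inverse_smooth B V G) => //.
- exact: Coo_of_Coo_at.
- by move=> y /hV [].
- move=> y Vy; have [Bh Gh] := hV y Vy.
  have dG := Coo_at_differentiable (CGB _ Bh).
  have near_h : \forall z \near y, G (h z) = z /\ `|h z - h y| <= 2 * `|z - y|.
    apply: filterS (open_nbhs_nbhs (conj oV Vy)) => z /hV [Bz Gz]; split=> //.
    by have := GL _ _ Bz Bh; rewrite Gz Gh.
  have [] := inverse_differentiable dG (fun v => derive_jacobian v dG)
    (Ju _ Bh) Gh (ltr0Sn R 1) near_h.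
  by [].
Unshelve. all: by end_near. Qed.

(** Composing with the inverse of the derivative at the base point reduces to a
    derivative equal to the identity. *)
Theorem inverse_function (F : 'rV[R]_n -> 'rV[R]_n) x0 (O : set 'rV[R]_n) :
  nbhs x0 O -> Coo_at F x0 -> (forall v, 'D_v F x0 = 0 -> v = 0) ->
  exists (B : set 'rV[R]_n) (h : 'rV[R]_n -> 'rV[R]_n),
    [/\ open B, B x0 & B `<=` O] /\
    [/\ (forall x, B x -> Coo_at F x), open (F @` B),
        (forall x, B x -> h (F x) = x) & (forall x, B x -> Coo_at h (F x))].
Proof.
move=> nO CF Finj; pose J := jacobian_rows F x0.
have dF := Coo_at_differentiable CF.
have Ju : J \in unitmx.
  rewrite -row_free_unit -kermx_eq0; apply/rowV0P => v /sub_kermxP vJ.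
  by apply: Finj; rewrite derive_jacobian.
pose L : {linear 'rV[R]_n -> 'rV[R]_n} := mulmxr (invmx J).
pose L' : {linear 'rV[R]_n -> 'rV[R]_n} := mulmxr J.
have CL x : Coo_at L x by apply: Coo_at_linear; exact: row_linear_continuous.
have CL' x : Coo_at L' x by apply: Coo_at_linear; exact: row_linear_continuous.
have LK x : L (L' x) = x by rewrite /L /L' /= mulmxK.
have L'K x : L' (L x) = x by rewrite /L /L' /= mulmxKV.
pose G := L \o F.
have CG : Coo_at G x0 by exact: Coo_at_comp_row.
have DG v : 'D_v G x0 = v.
  rewrite /G derive_chain //; last exact: Coo_at_differentiable (CL _).
  have dL := Coo_at_differentiable (CL (F x0)).
  rewrite deriveE // diff_lin; last exact: row_linear_continuous.
  by rewrite derive_jacobian // /L /= mulmxK.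
have [B [h [[oB Bx0 BO] [CGB oV hG Ch]]]] := inverse_function_normalised nO CG DG.
exists B, (h \o L); split=> //.
have FE : L' \o G = F by apply: boolp.funext => x; exact: L'K.
split.
- by move=> x Bx; rewrite -FE; apply: Coo_at_comp_row => //; exact: CGB.
- have -> : F @` B = L @^-1` (G @` B).
    apply/seteqP; split=> [_ [x Bx <-]|y [x Bx xy]]; first by exists x.
    by exists x => //; rewrite -(L'K y) -xy; exact/esym/L'K.
  by apply: open_comp => // y _; exact: row_linear_continuous.
- by move=> x Bx; exact: hG.
- move=> x Bx; apply: Coo_at_comp_row => //.
  by exists (G @` B) => //; split=> //; exists x.
Qed.

End inverse_function.

(** * Smooth functions and vector fields in charts *)

(* From here on derivatives are only used through their algebraic rules. *)
Opaque derive.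

Section manifold_calculus.
Variables (R : realType) (M : manifold7 R).
Implicit Types (p q z : M) (f g : M -> R) (A B : vfield M) (v w : tvec R).

Lemma cinv_chart p q : cdom p q -> cinv p (chart p q) = q.
Proof. exact: chartK. Qed.

Lemma near_cdom p q : cdom p q -> \forall z \near q, cdom p z.
Proof. by move=> pq; apply: open_nbhs_nbhs; split=> //; exact: cdom_open. Qed.

Lemma cinv_cvg p q : cdom p q -> cinv p x @[x --> chart p q] --> q.
Proof.
move=> pq; rewrite -[X in _ --> X](cinv_chart pq).
by apply: cinv_continuous; exists q.
Qed.

Lemma near_cinv p q (P : M -> Prop) : cdom p q ->
  (\forall z \near q, P z) -> \forall x \near chart p q, P (cinv p x).
Proof. by move=> /cinv_cvg; exact. Qed.

Lemma near_chart p q (P : 'rV[R]_7 -> Prop) : cdom p q ->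
  (\forall x \near chart p q, P x) -> \forall z \near q, P (chart p z).
Proof. by move=> /chart_continuous; exact. Qed.

Lemma near_chart_cinv p q : cdom p q -> \forall x \near chart p q, chart p (cinv p x) = x.
Proof.
move=> pq; have := @chart_open _ _ p; rewrite openE => /(_ (chart p q)).
have pq' : (chart p @` cdom p) (chart p q) by exists q.
move=> /(_ pq'); apply: filterS => x [z pz <-].
by rewrite chartK.
Qed.

Lemma transition_Coo_at p q z : cdom p z -> cdom q z ->
  Coo_at (chart q \o cinv p) (chart p z).
Proof.
move=> pz qz; have CT := @transition_smooth _ M p q.
pose D := chart p @` (cdom p `&` cdom q).
exists (D°); last by move=> k; apply: Ck_sub (CT k) => y /interior_subset.
split; first exact: open_interior.
have nD : \forall x \near chart p z, D x.
  have nc := near_cinv pz (near_cdom pz).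
  apply: filterS3 (near_cinv pz (near_cdom qz)) nc (near_chart_cinv pz).
  by move=> x qx px xx; exists (cinv p x).
exact: nD.
Qed.

Lemma near_change_chart p p' q f : cdom p q -> cdom p' q ->
  \forall x \near chart p' q, ((f \o cinv p) \o (chart p \o cinv p')) x = (f \o cinv p') x.
Proof.
move=> pq p'q; apply: filterS (near_cinv p'q (near_cdom pq)) => x px /=.
by rewrite chartK.
Qed.

Lemma change_chart p p' q f : cdom p q -> cdom p' q ->
  Coo_at (f \o cinv p) (chart p q) -> Coo_at (f \o cinv p') (chart p' q).
Proof.
move=> pq p'q Cf; apply: Coo_at_eq (near_change_chart f pq p'q) _.
apply: Coo_at_comp; first exact: transition_Coo_at.
by rewrite /= chartK.
Qed.

(** The transition maps being smooth, any chart around a point can be used. *)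
Lemma smooth_fun_atP p q f : cdom p q ->
  smooth_fun_at f q <-> Coo_at (f \o cinv p) (chart p q).
Proof.
by move=> pq; split; apply: change_chart => //; exact: cdom_center.
Qed.

Lemma smooth_fun_at_near f p : smooth_fun_at f p ->
  \forall q \near p, smooth_fun_at f q.
Proof.
move=> /Coo_at_near nf; have cp := cdom_center p.
apply: filterS2 (near_cdom cp) (near_chart cp nf) => q pq Cf.
exact/(smooth_fun_atP f pq).
Qed.

Lemma smooth_fun_at_eq f g p : (\forall q \near p, f q = g q) ->
  smooth_fun_at f p -> smooth_fun_at g p.
Proof.
by move=> fg; apply: Coo_at_eq; exact: near_cinv (cdom_center p) fg.
Qed.

Lemma lieder_eq A f g p : (\forall q \near p, f q = g q) ->
  lieder A f p = lieder A g p.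
Proof.
by move=> fg; apply: near_eq_derive; exact: near_cinv (cdom_center p) fg.
Qed.

Lemma smooth_cst (c : R) p : smooth_fun_at (fun=> c : R) p.
Proof. exact: Coo_at_cst. Qed.

Lemma smoothD f g p : smooth_fun_at f p -> smooth_fun_at g p ->
  smooth_fun_at (fun q => f q + g q) p.
Proof. exact: Coo_atD. Qed.

Lemma smoothN f p : smooth_fun_at f p -> smooth_fun_at (fun q => - f q) p.
Proof. exact: Coo_atN. Qed.

Lemma smoothB f g p : smooth_fun_at f p -> smooth_fun_at g p ->
  smooth_fun_at (fun q => f q - g q) p.
Proof. exact: Coo_atB. Qed.

Lemma smoothM f g p : smooth_fun_at f p -> smooth_fun_at g p ->
  smooth_fun_at (fun q => f q * g q) p.
Proof. exact: Coo_atM. Qed.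

Lemma smooth_sum (I : Type) (r : seq I) (P : pred I) (F : I -> M -> R) p :
  (forall i, P i -> smooth_fun_at (F i) p) ->
  smooth_fun_at (fun q => \sum_(i <- r | P i) F i q) p.
Proof. by move=> SF; exact: (@Coo_at_sum _ _ _ _ _ _ (fun i => F i \o cinv p)). Qed.

Lemma smooth_cstM (c : R) f p : smooth_fun_at f p -> smooth_fun_at (fun q => c * f q) p.
Proof. by move=> Sf; apply: smoothM => //; exact: smooth_cst. Qed.

Lemma cinv_center p : cinv p (chart p p) = p.
Proof. exact: chartK (cdom_center p). Qed.

Lemma smoothV f p : f p != 0 -> smooth_fun_at f p -> smooth_fun_at (fun q => (f q)^-1) p.
Proof. by move=> f0; apply: Coo_atV; rewrite /= cinv_center. Qed.

Lemma smooth_sqrt f p : 0 < f p -> smooth_fun_at f p ->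
  smooth_fun_at (fun q => Num.sqrt (f q)) p.
Proof. by move=> f0; apply: Coo_at_sqrt; rewrite /= cinv_center. Qed.

Lemma smooth_coordfun p q i : cdom p q -> smooth_fun_at (coordfun p i) q.
Proof.
move=> pq; apply/(smooth_fun_atP _ pq).
apply: Coo_at_eq ((Coo_at_rowP id (chart p q)).1 (@Coo_at_id _ _ _) i).
by apply: filterS (near_chart_cinv pq) => x /= xE; rewrite /coordfun xE.
Qed.

(** * Tangent vectors as derivations *)

Definition dfun f p v : R := 'D_v (f \o cinv p) (chart p p).

Lemma liederE A f p : lieder A f p = dfun f p (A p). Proof. by []. Qed.

Lemma dfun_linear f p (a : R) v w : smooth_fun_at f p ->
  dfun f p (a *: v + w) = a * dfun f p v + dfun f p w.
Proof.
by move=> /Coo_at_differentiable df; rewrite /dfun !deriveE // linearP.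
Qed.

Lemma dfunD f p v w : smooth_fun_at f p ->
  dfun f p (v + w) = dfun f p v + dfun f p w.
Proof. by move=> Sf; rewrite -[v]scale1r dfun_linear // !scale1r mul1r. Qed.

Lemma dfun0 f p : smooth_fun_at f p -> dfun f p 0 = 0.
Proof. by move=> Sf; rewrite /dfun derive0. Qed.

Lemma dfunZ f p (a : R) v : smooth_fun_at f p -> dfun f p (a *: v) = a * dfun f p v.
Proof. by move=> Sf; rewrite -[a *: v]addr0 dfun_linear // dfun0 // addr0. Qed.

Lemma dfun_sumv f p (I : Type) (r : seq I) (P : pred I) (F : I -> tvec R) :
  smooth_fun_at f p ->
  dfun f p (\sum_(i <- r | P i) F i) = \sum_(i <- r | P i) dfun f p (F i).
Proof.
move=> Sf; apply: (big_morph (dfun f p)); last exact: dfun0.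
by move=> v w; exact: dfunD.
Qed.

Lemma dfun_cst (c : R) p v : dfun (fun=> c : R) p v = 0.
Proof. exact: derive_cst. Qed.

Lemma dfun_addf f g p v : smooth_fun_at f p -> smooth_fun_at g p ->
  dfun (fun q => f q + g q) p v = dfun f p v + dfun g p v.
Proof.
by move=> Sf Sg; apply: (@deriveD _ _ _ (f \o cinv p) (g \o cinv p));
  exact: Coo_at_derivable.
Qed.

Lemma dfun_subf f g p v : smooth_fun_at f p -> smooth_fun_at g p ->
  dfun (fun q => f q - g q) p v = dfun f p v - dfun g p v.
Proof.
by move=> Sf Sg; apply: (@deriveB _ _ _ (f \o cinv p) (g \o cinv p));
  exact: Coo_at_derivable.
Qed.

Lemma dfun_mulf f g p v : smooth_fun_at f p -> smooth_fun_at g p ->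
  dfun (fun q => f q * g q) p v = f p * dfun g p v + g p * dfun f p v.
Proof.
move=> Sf Sg; have := @deriveM _ _ (f \o cinv p) (g \o cinv p) (chart p p) v
  (Coo_at_derivable (v := v) Sf) (Coo_at_derivable (v := v) Sg).
by rewrite /= cinv_center.
Qed.

Lemma dfun_cstM (c : R) f p v : smooth_fun_at f p ->
  dfun (fun q => c * f q) p v = c * dfun f p v.
Proof. by move=> Sf; rewrite dfun_mulf ?dfun_cst ?mulr0 ?addr0 //; exact: smooth_cst. Qed.

Lemma dfun_sumf (I : Type) (r : seq I) (P : pred I) (F : I -> M -> R) p v :
  (forall i, P i -> smooth_fun_at (F i) p) ->
  dfun (fun q => \sum_(i <- r | P i) F i q) p v = \sum_(i <- r | P i) dfun (F i) p v.
Proof.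
move=> SF; elim: r => [|i r IH].
  rewrite big_nil -[RHS](dfun_cst 0 p v); congr (dfun _ p v).
  by apply: boolp.funext => q; rewrite big_nil.
rewrite big_cons; case: ifP => Pi.
  rewrite -IH -dfun_addf; [|exact: SF|exact: smooth_sum].
  by congr (dfun _ p v); apply: boolp.funext => q; rewrite big_cons Pi.
rewrite -IH; congr (dfun _ p v).
by apply: boolp.funext => q; rewrite big_cons Pi.
Qed.

Lemma dfun_eq f g p v : (\forall q \near p, f q = g q) -> dfun f p v = dfun g p v.
Proof. exact: (@lieder_eq (fun=> v)). Qed.

Lemma dfun_coordfun p v i : dfun (coordfun p i) p v = v 0 i.
Proof.
rewrite /dfun (near_eq_derive (g := fun x : 'rV[R]_7 => x 0 i)).
  rewrite -(@derive_coord _ _ (fun x => x)) //.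
  by rewrite derive_id.
by apply: filterS (near_chart_cinv (cdom_center p)) => x xE; rewrite /= /coordfun xE.
Qed.

(** In the chart of a nearby point, a tangent vector has the components of its
    action on the coordinate functions. *)
Lemma dfun_chart p q f v : cdom p q -> smooth_fun_at f q ->
  dfun f q v = \sum_i dfun (coordfun p i) q v *
                 'D_(delta_mx 0 i) (f \o cinv p) (chart p q).
Proof.
move=> pq Sf; have qq := cdom_center q.
have CT := transition_Coo_at qq pq.
have Cf : Coo_at (f \o cinv p) ((chart p \o cinv q) (chart q q)).
  by rewrite /= chartK //; exact/(smooth_fun_atP _ pq).
rewrite /dfun -(near_eq_derive _ (near_change_chart f pq qq)).
rewrite derive_chain; [|exact: Coo_at_differentiable..].
rewrite derive_delta; last exact: Coo_at_differentiable.
rewrite /= chartK //; apply: eq_bigr => i _; congr (_ * _).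
by rewrite derive_coord //; exact: Coo_at_differentiable.
Qed.

Lemma partial_smooth p f i : smooth_fun_at f p ->
  smooth_fun_at (fun q => 'D_(delta_mx 0 i) (f \o cinv p) (chart p q)) p.
Proof.
move=> Sf; apply: Coo_at_eq (Coo_at_derive (delta_mx 0 i) Sf).
by apply: filterS (near_chart_cinv (cdom_center p)) => x xE; rewrite /= xE.
Qed.

(** [lieder] reads each point in its own chart; differentiating the result again
    requires an expression in the single chart at [p]. *)
Lemma lieder_near_chart p f A : smooth_fun_at f p ->
  \forall q \near p, lieder A f q = \sum_i lieder A (coordfun p i) q *
                 'D_(delta_mx 0 i) (f \o cinv p) (chart p q).
Proof.
move=> Sf; apply: filterS2 (near_cdom (cdom_center p)) (smooth_fun_at_near Sf).
by move=> q pq Sfq; exact: dfun_chart.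
Qed.

Lemma lieder_smooth A f p : smooth_vf A -> smooth_fun_at f p ->
  smooth_fun_at (lieder A f) p.
Proof.
move=> SA Sf.
have [E] : exists h, (\forall q \near p, h q = lieder A f q) /\ smooth_fun_at h p.
  exists (fun q => \sum_i lieder A (coordfun p i) q *
                 'D_(delta_mx 0 i) (f \o cinv p) (chart p q)); split.
    by apply: filterS (lieder_near_chart A Sf) => q ->.
  by apply: smooth_sum => i _; apply: smoothM; [exact: SA|exact: partial_smooth].
by move=> [hE Sh]; exact: smooth_fun_at_eq hE Sh.
Qed.

(** The second order terms of [A (B f)] are symmetric in [A] and [B] by the
    equality of mixed derivatives and cancel in the commutator; the first order
    terms are the components of the bracket. *)
Lemma lie_bracket_commutator A B f p : smooth_vf A -> smooth_vf B ->
  smooth_fun_at f p ->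
  lieder (lie_bracket A B) f p =
  lieder A (lieder B f) p - lieder B (lieder A f) p.
Proof.
move=> SA SB Sf.
pose df i := fun q : M => 'D_(delta_mx 0 i) (f \o cinv p) (chart p q).
have Sdf i : smooth_fun_at (df i) p by exact: partial_smooth.
pose T A' B' : R := \sum_i \sum_j B' p 0 i * A' p 0 j *
      'D_(delta_mx 0 j) ('D_(delta_mx 0 i) (f \o cinv p)) (chart p p).
have half A' B' : smooth_vf A' -> smooth_vf B' -> lieder A' (lieder B' f) p =
    \sum_i lieder A' (lieder B' (coordfun p i)) p * df i p + T A' B'.
  move=> SA' SB'; rewrite (lieder_eq _ (lieder_near_chart B' Sf)) liederE.
  rewrite dfun_sumf => [|i _]; last by apply: smoothM; [exact: SB'|exact: Sdf].
  rewrite -big_split; apply: eq_bigr => i _ /=.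
  rewrite dfun_mulf; [|exact: SB'|exact: Sdf].
  rewrite addrC [df i p * _]mulrC; congr (_ + _).
  rewrite liederE dfun_coordfun.
  have -> : dfun (df i) p (A' p) = 'D_(A' p) ('D_(delta_mx 0 i) (f \o cinv p)) (chart p p).
    apply: near_eq_derive.
    by apply: filterS (near_chart_cinv (cdom_center p)) => x xE; rewrite /= /df xE.
  rewrite derive_delta; last first.
    by apply: Coo_at_differentiable; exact: Coo_at_derive.
  by rewrite mulr_sumr; apply: eq_bigr => j _; rewrite mulrA.
have Tsym : T A B = T B A.
  rewrite /T exchange_big; apply: eq_bigr => i _; apply: eq_bigr => j _.
  by rewrite (Coo_at_schwarz (delta_mx 0 j) (delta_mx 0 i) Sf) (mulrC (B p 0 j)).
have := half _ _ SB SA; have := half _ _ SA SB; rewrite Tsym.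
move: (T B A) => t EA EB.
apply: etrans (esym (congr2 (fun a b : R => a - b) EA EB)).
have cancel (a b c : R) : a + c - (b + c) = a - b by ring.
apply: etrans (esym (cancel _ _ _)); rewrite -sumrB.
rewrite liederE (dfun_chart _ (cdom_center p) Sf); apply: eq_bigr => i _.
by rewrite dfun_coordfun mxE mulrBl.
Qed.

Lemma lie_bracket_smooth A B : smooth_vf A -> smooth_vf B ->
  smooth_vf (lie_bracket A B).
Proof.
move=> SA SB p i.
have Sx : smooth_fun_at (coordfun p i) p by apply: smooth_coordfun; exact: cdom_center.
apply: (@smooth_fun_at_eq (fun q => lieder A (lieder B (coordfun p i)) q -
  lieder B (lieder A (coordfun p i)) q)).
  apply: filterS (near_cdom (cdom_center p)) => q pq.
  by apply/esym; apply: lie_bracket_commutator => //; exact: smooth_coordfun.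
apply: smoothB; do 2 apply: lieder_smooth => //.
Qed.

End manifold_calculus.

Lemma dfun_chain (R : realType) (M N : manifold7 R) (F : M -> N) (h : N -> R) (p : M) (v : tvec R) :
  smooth_map_at F p -> smooth_fun_at h (F p) ->
  smooth_fun_at (h \o F) p /\
  dfun (h \o F) p v = dfun h (F p) (tangent_map F p v).
Proof.
move=> [cF CF] Sh.
have hE : \forall x \near chart p p,
    ((h \o cinv (F p)) \o (chart (F p) \o F \o cinv p)) x = ((h \o F) \o cinv p) x.
  have nF : \forall q \near p, cdom (F p) (F q).
    by apply: cF; apply: near_cdom; exact: cdom_center.
  by apply: filterS (near_cinv (cdom_center p) nF) => x Fx; rewrite /= chartK.
have ctr : (chart (F p) \o F \o cinv p) (chart p p) = chart (F p) (F p).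
  by rewrite /= cinv_center.
split.
  by apply: Coo_at_eq hE _; apply: Coo_at_comp => //; rewrite ctr.
rewrite /dfun -(near_eq_derive _ hE) derive_chain.
- by rewrite ctr.
- exact: Coo_at_differentiable CF.
- by rewrite ctr; exact: Coo_at_differentiable Sh.
Qed.

(** * Global frames *)

Section framed_manifold.
Variables (R : realType) (M : manifold7 R).
Variables (e : 'I_7 -> form1 M) (E : 'I_7 -> vfield M).
Hypothesis e_smooth : forall i, smooth_form1 (e i).
Hypothesis E_smooth : forall i, smooth_vf (E i).
Hypothesis dual : forall i j p, e i p (E j p) = (i == j)%:R.
Implicit Types (p q : M) (A B C : vfield M) (v w : tvec R) (f g : M -> R).

Lemma form_linear i p (a : R) v w : e i p (a *: v + w) = a * e i p v + e i p w.
Proof. by have [l _] := e_smooth i; exact: l. Qed.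

Lemma formD i p v w : e i p (v + w) = e i p v + e i p w.
Proof. by rewrite -[v]scale1r form_linear mul1r scale1r. Qed.

Lemma form0 i p : e i p 0 = 0.
Proof. by apply: (@addrI _ (e i p 0)); rewrite -formD !addr0. Qed.

Lemma formZ i p (a : R) v : e i p (a *: v) = a * e i p v.
Proof. by rewrite -[a *: v]addr0 form_linear form0 addr0. Qed.

Lemma formN i p v : e i p (- v) = - e i p v.
Proof. by rewrite -scaleN1r formZ mulN1r. Qed.

Lemma formB i p v w : e i p (v - w) = e i p v - e i p w.
Proof. by rewrite formD formN. Qed.

Lemma form_sum i p (I : Type) (r : seq I) (P : pred I) (F : I -> tvec R) :
  e i p (\sum_(j <- r | P j) F j) = \sum_(j <- r | P j) e i p (F j).
Proof. by apply: (big_morph (e i p)); [exact: formD|exact: form0]. Qed.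

Lemma form_comb i p (c : 'I_7 -> R) : e i p (\sum_j c j *: E j p) = c i.
Proof.
rewrite form_sum (bigD1 i) //= formZ dual eqxx mulr1 big1 ?addr0 // => j ji.
by rewrite formZ dual eq_sym (negbTE ji) mulr0.
Qed.

Lemma frame_expand p v : v = \sum_i e i p v *: E i p.
Proof.
pose em : 'M[R]_7 := \matrix_(k, i) e i p (delta_mx 0 k).
pose Em : 'M[R]_7 := \matrix_(i, k) E i p 0 k.
have emE w i : (w *m em) 0 i = e i p w.
  rewrite {2}(row_sum_delta w) form_sum mxE; apply: eq_bigr => k _.
  by rewrite formZ mxE.
have Eme : Em *m em = 1%:M.
  apply/matrixP => i j; have -> : (Em *m em) i j = (row i Em *m em) 0 j.
    by rewrite -row_mul [RHS]mxE.
  by rewrite rowK emE dual mxE eq_sym.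
have eEm : em *m Em = 1%:M by exact: mulmx1C.
rewrite -{1}[v]mulmx1 -eEm mulmxA; apply/rowP => k; rewrite mxE summxE.
by apply: eq_bigr => i _; rewrite emE !mxE.
Qed.

Lemma frame_ext p v w : (forall i, e i p v = e i p w) -> v = w.
Proof.
move=> vw; rewrite [v](frame_expand p) [w](frame_expand p).
by apply: eq_bigr => i _; rewrite vw.
Qed.

Lemma field_ext A B : (forall i p, e i p (A p) = e i p (B p)) -> A = B.
Proof. by move=> AB; apply: boolp.funext => p; apply: (@frame_ext p). Qed.

Lemma form_smooth i A p : smooth_vf A -> smooth_fun_at (fun q => e i q (A q)) p.
Proof. by move=> SA; have [_ Se] := e_smooth i; exact: Se. Qed.

Lemma smooth_vfD A B : smooth_vf A -> smooth_vf B -> smooth_vf (fun p => A p + B p).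
Proof.
move=> SA SB p i.
apply: smooth_fun_at_eq (smoothD (SA p i) (SB p i)).
apply: filterS (near_cdom (cdom_center p)) => q pq.
by rewrite !liederE dfunD //; exact: smooth_coordfun.
Qed.

Lemma smooth_vfZ f A : (forall p, smooth_fun_at f p) -> smooth_vf A ->
  smooth_vf (fun p => f p *: A p).
Proof.
move=> Sf SA p i; apply: smooth_fun_at_eq (smoothM (Sf p) (SA p i)).
apply: filterS (near_cdom (cdom_center p)) => q pq.
by rewrite !liederE dfunZ //; exact: smooth_coordfun.
Qed.

Lemma smooth_vf0 : smooth_vf (fun _ : M => 0).
Proof.
move=> p i; apply: smooth_fun_at_eq (smooth_cst 0 p).
apply: filterS (near_cdom (cdom_center p)) => q pq.
by rewrite liederE dfun0 //; exact: smooth_coordfun.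
Qed.

Lemma smooth_vf_sum (I : Type) (r : seq I) (F : I -> vfield M) :
  (forall i, smooth_vf (F i)) -> smooth_vf (fun p => \sum_(i <- r) F i p).
Proof.
move=> SF; elim: r => [|i r IH].
  by under boolp.eq_fun do rewrite big_nil; exact: smooth_vf0.
by under boolp.eq_fun do rewrite big_cons; exact: smooth_vfD.
Qed.

Lemma smooth_vf_comb (f : 'I_7 -> M -> R) : (forall i p, smooth_fun_at (f i) p) ->
  smooth_vf (fun p => \sum_i f i p *: E i p).
Proof. by move=> Sf; apply: smooth_vf_sum => i; apply: smooth_vfZ. Qed.

Lemma smooth_vfP A :
  (forall i p, smooth_fun_at (fun q => e i q (A q)) p) -> smooth_vf A.
Proof.
move=> SA; have -> : A = (fun p => \sum_i e i p (A p) *: E i p).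
  by apply: boolp.funext => p; exact: frame_expand.
exact: smooth_vf_comb.
Qed.

(** * Linear connections in a global frame *)

Variable nabla : vfield M -> vfield M -> vfield M.
Hypothesis nablaL : is_linear_connection nabla.

Lemma nabla_smooth A B : smooth_vf A -> smooth_vf B -> smooth_vf (nabla A B).
Proof. by have [h _] := nablaL; exact: h. Qed.

Lemma nabla0r A : smooth_vf A -> nabla A (fun=> 0) = (fun=> 0).
Proof.
move=> SA; have [_ [_ [_ [_ nL]]]] := nablaL.
have S0 := smooth_vf0.
have := nL (fun=> 0) A _ (fun p => smooth_cst 0 p) SA S0.
rewrite /fscale; under [X in nabla A X]boolp.eq_fun do rewrite scaler0.
move=> ->; apply: boolp.funext => p.
by rewrite scaler0 scale0r addr0.
Qed.

Lemma nabla0l B : smooth_vf B -> nabla (fun=> 0) B = (fun=> 0).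
Proof.
move=> SB; have [_ [_ [nL _]]] := nablaL.
have S0 := smooth_vf0.
have := nL (fun=> 0) _ B (fun p => smooth_cst 0 p) S0 SB.
rewrite /fscale; under [X in nabla X B]boolp.eq_fun do rewrite scaler0.
by move=> ->; apply: boolp.funext => p; rewrite scale0r.
Qed.

Lemma nabla_sumr A (I : Type) (r : seq I) (F : I -> vfield M) : smooth_vf A ->
  (forall i, smooth_vf (F i)) ->
  nabla A (fun p => \sum_(i <- r) F i p) = fun p => \sum_(i <- r) nabla A (F i) p.
Proof.
move=> SA SF; elim: r => [|i r IH].
  under [X in nabla A X]boolp.eq_fun do rewrite big_nil.
  by rewrite nabla0r //; under [RHS]boolp.eq_fun do rewrite big_nil.
under [X in nabla A X]boolp.eq_fun do rewrite big_cons.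
have [_ [_ [_ [nD _]]]] := nablaL.
rewrite (nD _ _ _ SA (SF i) (smooth_vf_sum r SF)) IH.
by under [RHS]boolp.eq_fun do rewrite big_cons.
Qed.

Lemma nabla_suml B (I : Type) (r : seq I) (F : I -> vfield M) : smooth_vf B ->
  (forall i, smooth_vf (F i)) ->
  nabla (fun p => \sum_(i <- r) F i p) B = fun p => \sum_(i <- r) nabla (F i) B p.
Proof.
move=> SB SF; elim: r => [|i r IH].
  under [X in nabla X B]boolp.eq_fun do rewrite big_nil.
  by rewrite nabla0l //; under [RHS]boolp.eq_fun do rewrite big_nil.
under [X in nabla X B]boolp.eq_fun do rewrite big_cons.
have [_ [nD _]] := nablaL.
rewrite (nD _ _ _ (SF i) (smooth_vf_sum r SF) SB) IH.
by under [RHS]boolp.eq_fun do rewrite big_cons.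
Qed.

Definition christoffel i j k p : R := e k p (nabla (E i) (E j) p).

Lemma nabla_frame A B k p : smooth_vf A -> smooth_vf B ->
  e k p (nabla A B p) = lieder A (fun q => e k q (B q)) p +
    \sum_i \sum_j e i p (A p) * e j p (B p) * christoffel i j k p.
Proof.
move=> SA SB; have [_ [_ [nZl [_ nZr]]]] := nablaL.
have SBj j : forall q, smooth_fun_at (fun q => e j q (B q)) q.
  by move=> q; exact: form_smooth.
have SAi i : forall q, smooth_fun_at (fun q => e i q (A q)) q.
  by move=> q; exact: form_smooth.
have -> : nabla A B p = \sum_j (lieder A (fun q => e j q (B q)) p *: E j p +
    e j p (B p) *: nabla A (E j) p).
  have {1}-> : B = (fun p => \sum_j fscale (fun q => e j q (B q)) (E j) p).
    by apply: boolp.funext => q; exact: frame_expand.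
  rewrite (nabla_sumr _ SA (fun j => smooth_vfZ (SBj j) (E_smooth j))).
  by apply: eq_bigr => j _; rewrite (nZr _ _ _ (SBj j) SA (E_smooth j)).
rewrite form_sum; under eq_bigr do rewrite formD formZ dual formZ.
rewrite big_split /=; congr (_ + _).
  rewrite (bigD1 k) //= eqxx mulr1 big1 ?addr0 // => j jk.
  by rewrite eq_sym (negbTE jk) mulr0.
rewrite exchange_big; apply: eq_bigr => j _ /=.
have -> : nabla A (E j) p = \sum_i e i p (A p) *: nabla (E i) (E j) p.
  have {1}-> : A = (fun p => \sum_i fscale (fun q => e i q (A q)) (E i) p).
    by apply: boolp.funext => q; exact: frame_expand.
  rewrite (nabla_suml _ (E_smooth j) (fun i => smooth_vfZ (SAi i) (E_smooth i))).
  by apply: eq_bigr => i _; rewrite (nZl _ _ _ (SAi i) (E_smooth i) (E_smooth j)).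
rewrite form_sum mulr_sumr; apply: eq_bigr => i _.
by rewrite formZ mulrCA mulrA.
Qed.

End framed_manifold.

(** * The structure equations as bilinear algebra *)

Lemma ord3E (s : 'I_3) : [\/ s = o1, s = o2 | s = o3].
Proof.
by case: s => [[|[|[|//]]] ?]; [constructor 1|constructor 2|constructor 3]; exact: val_inj.
Qed.

Lemma vertE : (vert o1 = ix 5) * (vert o2 = ix 6) * (vert o3 = ix 7).
Proof. by split; [split|]; exact: val_inj. Qed.

Definition h1 := @Ordinal 4 0 isT.
Definition h2 := @Ordinal 4 1 isT.
Definition h3 := @Ordinal 4 2 isT.
Definition h4 := @Ordinal 4 3 isT.

Lemma ord4E (a : 'I_4) : [\/ a = h1, a = h2, a = h3 | a = h4].
Proof.
by case: a => [[|[|[|[|//]]]] ?];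
  [constructor 1|constructor 2|constructor 3|constructor 4]; exact: val_inj.
Qed.

Lemma horE : (hor h1 = ix 1) * (hor h2 = ix 2) * (hor h3 = ix 3) * (hor h4 = ix 4).
Proof. by split; [split; [split|]|]; exact: val_inj. Qed.

Lemma ix_ind (P : 'I_7 -> Prop) : P (ix 1) -> P (ix 2) -> P (ix 3) -> P (ix 4) ->
  P (ix 5) -> P (ix 6) -> P (ix 7) -> forall k, P k.
Proof.
move=> P1 P2 P3 P4 P5 P6 P7 k.
have [i [i0 i7 ->]] : exists i, [/\ (0 < i)%N, (i <= 7)%N & k = ix i].
  exists k.+1; split=> //; apply: val_inj; rewrite /= modn_small //.
by case: i i0 i7 => [//|[//|[//|[//|[//|[//|[//|[//|//]]]]]]]].
Qed.

Lemma vert_eq (s t : 'I_3) : (vert s == vert t) = (s == t).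
Proof. by case: (ord3E s) => ->; case: (ord3E t) => ->; rewrite !vertE. Qed.

Lemma hor_eq (a b : 'I_4) : (hor a == hor b) = (a == b).
Proof. by case: (ord4E a) => ->; case: (ord4E b) => ->; rewrite !horE. Qed.

Section sums.
Variable V : zmodType.

Lemma sum3E (F : 'I_3 -> V) : \sum_s F s = F o1 + F o2 + F o3.
Proof.
rewrite !big_ord_recl big_ord0 addr0 addrA; congr (_ + _ + _); congr F; exact: val_inj.
Qed.

Lemma sum4E (F : 'I_4 -> V) : \sum_a F a = F h1 + F h2 + F h3 + F h4.
Proof.
rewrite !big_ord_recl big_ord0 addr0 !addrA.
by congr (_ + _ + _ + _); congr F; exact: val_inj.
Qed.

Lemma sum7E (F : 'I_7 -> V) :
  \sum_i F i = F (ix 1) + F (ix 2) + F (ix 3) + F (ix 4) + F (ix 5) + F (ix 6) + F (ix 7).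
Proof.
rewrite !big_ord_recl big_ord0 addr0 !addrA.
by congr (_ + _ + _ + _ + _ + _ + _); congr F; exact: val_inj.
Qed.

End sums.
Lemma ix_eq i j : (ix i == ix j) = (i.-1 %% 7 == j.-1 %% 7)%N. Proof. by []. Qed.
Section L1_algebra.
Variable R : realFieldType.
Implicit Types x y z : 'I_7 -> R.

Definition wedge_coord x y (i j : nat) : R := x (ix i) * y (ix j) - x (ix j) * y (ix i).

(** The structure equations of L1 as a bilinear map on coordinates. *)
Definition L1_d (k : 'I_7) x y : R :=
  let w := wedge_coord x y in
  match val k with
  | 0 => 0
  | 1 => - w 1%N 2%N - 2 * w 3%N 4%N - 2^-1 * w 3%N 7%N + 2^-1 * w 4%N 6%N
  | 2 => - w 1%N 3%N + 2 * w 2%N 4%N + 2^-1 * w 2%N 7%N - 2^-1 * w 4%N 5%N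
  | 3 => - w 1%N 4%N - 2 * w 2%N 3%N - 2^-1 * w 2%N 6%N + 2^-1 * w 3%N 5%N
  | 4 => 2 * w 1%N 2%N + 2 * w 3%N 4%N - 2^-1 * w 6%N 7%N
  | 5 => 2 * w 1%N 3%N + 2 * w 4%N 2%N + 2^-1 * w 5%N 7%N
  | _ => 2 * w 1%N 4%N + 2 * w 2%N 3%N - 2^-1 * w 5%N 6%N
  end.

(** The connection forms of the Biquard connection: horizontally the
    Levi-Civita connection of hyperbolic 4-space, and along the Reeb fields the
    infinitesimal rotations given by their brackets. *)
Definition L1_conn (k : 'I_7) x y : R :=
  match val k with
  | 0 => x (ix 2) * y (ix 2) + x (ix 3) * y (ix 3) + x (ix 4) * y (ix 4)
  | 1 => - x (ix 2) * y (ix 1) + (x (ix 3) + 2^-1 * x (ix 6)) * y (ix 4)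
         - (x (ix 4) + 2^-1 * x (ix 7)) * y (ix 3)
  | 2 => - x (ix 3) * y (ix 1) + (x (ix 4) + 2^-1 * x (ix 7)) * y (ix 2)
         - (x (ix 2) + 2^-1 * x (ix 5)) * y (ix 4)
  | 3 => - x (ix 4) * y (ix 1) + (x (ix 2) + 2^-1 * x (ix 5)) * y (ix 3)
         - (x (ix 3) + 2^-1 * x (ix 6)) * y (ix 2)
  | 4 => 2^-1 * (x (ix 6) * y (ix 7) - x (ix 7) * y (ix 6))
  | 5 => 2^-1 * (x (ix 7) * y (ix 5) - x (ix 5) * y (ix 7))
  | _ => 2^-1 * (x (ix 5) * y (ix 6) - x (ix 6) * y (ix 5))
  end.

(** The endomorphisms I_s in coordinates. *)
Definition L1_I (s : 'I_3) (k : 'I_7) x : R :=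
  match val s, val k with
  | 0, 0 => - x (ix 2) | 0, 1 => x (ix 1) | 0, 2 => - x (ix 4) | 0, 3 => x (ix 3)
  | 1, 0 => - x (ix 3) | 1, 1 => x (ix 4) | 1, 2 => x (ix 1) | 1, 3 => - x (ix 2)
  | 2, 0 => - x (ix 4) | 2, 1 => - x (ix 3) | 2, 2 => x (ix 2) | 2, 3 => x (ix 1)
  | _, _ => 0
  end.

Lemma L1_dE x y : let w := wedge_coord x y in
  (L1_d (ix 1) x y = 0) *
  (L1_d (ix 2) x y = - w 1%N 2%N - 2 * w 3%N 4%N - 2^-1 * w 3%N 7%N + 2^-1 * w 4%N 6%N) *
  (L1_d (ix 3) x y = - w 1%N 3%N + 2 * w 2%N 4%N + 2^-1 * w 2%N 7%N - 2^-1 * w 4%N 5%N) *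
  (L1_d (ix 4) x y = - w 1%N 4%N - 2 * w 2%N 3%N - 2^-1 * w 2%N 6%N + 2^-1 * w 3%N 5%N) *
  (L1_d (ix 5) x y = 2 * w 1%N 2%N + 2 * w 3%N 4%N - 2^-1 * w 6%N 7%N) *
  (L1_d (ix 6) x y = 2 * w 1%N 3%N + 2 * w 4%N 2%N + 2^-1 * w 5%N 7%N) *
  (L1_d (ix 7) x y = 2 * w 1%N 4%N + 2 * w 2%N 3%N - 2^-1 * w 5%N 6%N).
Proof. by []. Qed.

Lemma L1_connE x y :
  (L1_conn (ix 1) x y = x (ix 2) * y (ix 2) + x (ix 3) * y (ix 3) + x (ix 4) * y (ix 4)) *
  (L1_conn (ix 2) x y = - x (ix 2) * y (ix 1) + (x (ix 3) + 2^-1 * x (ix 6)) * y (ix 4)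
         - (x (ix 4) + 2^-1 * x (ix 7)) * y (ix 3)) *
  (L1_conn (ix 3) x y = - x (ix 3) * y (ix 1) + (x (ix 4) + 2^-1 * x (ix 7)) * y (ix 2)
         - (x (ix 2) + 2^-1 * x (ix 5)) * y (ix 4)) *
  (L1_conn (ix 4) x y = - x (ix 4) * y (ix 1) + (x (ix 2) + 2^-1 * x (ix 5)) * y (ix 3)
         - (x (ix 3) + 2^-1 * x (ix 6)) * y (ix 2)) *
  (L1_conn (ix 5) x y = 2^-1 * (x (ix 6) * y (ix 7) - x (ix 7) * y (ix 6))) *
  (L1_conn (ix 6) x y = 2^-1 * (x (ix 7) * y (ix 5) - x (ix 5) * y (ix 7))) *
  (L1_conn (ix 7) x y = 2^-1 * (x (ix 5) * y (ix 6) - x (ix 6) * y (ix 5))).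
Proof. by []. Qed.

Lemma L1_IE x :
  (L1_I o1 (ix 1) x = - x (ix 2)) * (L1_I o1 (ix 2) x = x (ix 1)) *
  (L1_I o1 (ix 3) x = - x (ix 4)) * (L1_I o1 (ix 4) x = x (ix 3)) *
  (L1_I o1 (ix 5) x = 0) * (L1_I o1 (ix 6) x = 0) * (L1_I o1 (ix 7) x = 0) *
  ((L1_I o2 (ix 1) x = - x (ix 3)) * (L1_I o2 (ix 2) x = x (ix 4)) *
  (L1_I o2 (ix 3) x = x (ix 1)) * (L1_I o2 (ix 4) x = - x (ix 2)) *
  (L1_I o2 (ix 5) x = 0) * (L1_I o2 (ix 6) x = 0) * (L1_I o2 (ix 7) x = 0)) *
  ((L1_I o3 (ix 1) x = - x (ix 4)) * (L1_I o3 (ix 2) x = - x (ix 3)) *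
  (L1_I o3 (ix 3) x = x (ix 2)) * (L1_I o3 (ix 4) x = x (ix 1)) *
  (L1_I o3 (ix 5) x = 0) * (L1_I o3 (ix 6) x = 0) * (L1_I o3 (ix 7) x = 0)).
Proof. by []. Qed.

Definition unit_coord (i : 'I_7) : 'I_7 -> R := fun j => (j == i)%:R.

Lemma L1_conn_bilinear k x y :
  \sum_i \sum_j x i * y j * L1_conn k (unit_coord i) (unit_coord j) = L1_conn k x y.
Proof.
have linr u : \sum_j y j * L1_conn k u (unit_coord j) = L1_conn k u y.
  by move: k; apply: ix_ind; rewrite !sum7E !L1_connE /unit_coord !ix_eq /=; ring.
have linl : \sum_i x i * L1_conn k (unit_coord i) y = L1_conn k x y.
  by move: k {linr}; apply: ix_ind; rewrite !sum7E !L1_connE /unit_coord !ix_eq /=; ring.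
rewrite -linl; apply: eq_bigr => i _; rewrite -linr mulr_sumr.
by apply: eq_bigr => j _; rewrite mulrA.
Qed.

Lemma L1_conn_linearl k (a : R) x x' y :
  L1_conn k (fun i => a * x i + x' i) y = a * L1_conn k x y + L1_conn k x' y.
Proof. by move: k; apply: ix_ind; rewrite !L1_connE; ring. Qed.

Lemma L1_conn_linearr k (a : R) x y y' :
  L1_conn k x (fun i => a * y i + y' i) = a * L1_conn k x y + L1_conn k x y'.
Proof. by move: k; apply: ix_ind; rewrite !L1_connE; ring. Qed.

Lemma L1_conn_metric x y z :
  \sum_k (L1_conn k x y * z k + y k * L1_conn k x z) = 0.
Proof. by rewrite !sum7E !L1_connE; ring. Qed.

Definition horizontal x := forall s, x (vert s) = 0.
Definition vertical x := forall a, x (hor a) = 0.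

Lemma horizontalE x : horizontal x -> (x (ix 5) = 0) * (x (ix 6) = 0) * (x (ix 7) = 0).
Proof. by move=> hx; rewrite -!vertE !hx. Qed.

Lemma verticalE x : vertical x ->
  (x (ix 1) = 0) * (x (ix 2) = 0) * (x (ix 3) = 0) * (x (ix 4) = 0).
Proof. by move=> hx; rewrite -!horE !hx. Qed.

Lemma L1_conn_horizontal x y : horizontal y -> horizontal (fun k => L1_conn k x y).
Proof.
by move=> /horizontalE hy s; case: (ord3E s) => ->; rewrite !vertE !L1_connE !hy; ring.
Qed.

Lemma L1_conn_vertical x y : vertical y -> vertical (fun k => L1_conn k x y).
Proof.
by move=> /verticalE hy a; case: (ord4E a) => ->; rewrite !horE !L1_connE !hy; ring.
Qed.

Lemma L1_conn_torsion_horizontal x y a : horizontal x -> horizontal y ->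
  L1_conn (hor a) x y - L1_conn (hor a) y x + L1_d (hor a) x y = 0.
Proof.
move=> /horizontalE hx /horizontalE hy.
by case: (ord4E a) => ->; rewrite !horE !(L1_connE, L1_dE) /wedge_coord ?(hx, hy); ring.
Qed.

Lemma L1_conn_torsion_mixed k z x : vertical z -> horizontal x ->
  L1_conn k z x - L1_conn k x z + L1_d k z x = 0.
Proof.
move=> /verticalE hz /horizontalE hx; move: k.
by apply: ix_ind; rewrite !(L1_connE, L1_dE) /wedge_coord !(hx, hz); ring.
Qed.

(** The coefficients respect the identification of V with Q: the derivative of
    [sum_s f_s I_s] is governed by the vertical coefficients. *)
Lemma L1_conn_parallel_I k x f y : horizontal y ->
  L1_conn k x (fun j => \sum_s f s * L1_I s j y) -
    \sum_s f s * L1_I s k (fun j => L1_conn j x y) =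
  \sum_s L1_conn (vert s) x (fun j => \sum_t (vert t == j)%:R * f t) * L1_I s k y.
Proof.
move=> /horizontalE hy; move: k.
by apply: ix_ind; rewrite !(L1_connE, sum3E, vertE) /= !(L1_IE, L1_connE, ix_eq, hy) /=; ring.
Qed.

(** On H the connection has the curvature of hyperbolic 4-space. *)
Lemma L1_curvature_horizontal x y z w :
  horizontal x -> horizontal y -> horizontal z -> horizontal w ->
  \sum_k (L1_conn k x (fun j => L1_conn j y z) - L1_conn k y (fun j => L1_conn j x z)
          + L1_conn k (fun j => L1_d j x y) z) * w k =
  (\sum_k x k * z k) * (\sum_k y k * w k) - (\sum_k y k * z k) * (\sum_k x k * w k).
Proof.
move=> /horizontalE hx /horizontalE hy /horizontalE hz /horizontalE hw.
by rewrite !(sum7E, L1_connE, L1_dE) /wedge_coord /= ?(L1_connE, L1_dE) /wedge_coord ?(hx, hy, hz, hw); field.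
Qed.

End L1_algebra.

Section L1_koszul.
Variable R : realFieldType.

Lemma unit_coord_horizontal (a : 'I_4) : horizontal (unit_coord R (hor a)).
Proof.
by move=> s; case: (ord3E s) => ->; case: (ord4E a) => ->;
  rewrite /unit_coord !horE !vertE ix_eq.
Qed.

Lemma unit_coord_vertical (s : 'I_3) : vertical (unit_coord R (vert s)).
Proof.
by move=> a; case: (ord3E s) => ->; case: (ord4E a) => ->;
  rewrite /unit_coord !horE !vertE ix_eq.
Qed.

Lemma sum_unit_coordr i (y : 'I_7 -> R) : \sum_k y k * unit_coord R i k = y i.
Proof.
rewrite (bigD1 i) //= /unit_coord eqxx mulr1 big1 ?addr0 // => k ki.
by rewrite (negbTE ki) mulr0.
Qed.

Lemma sum_unit_coordl i (y : 'I_7 -> R) : \sum_k unit_coord R i k * y k = y i.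
Proof. by under eq_bigr do rewrite mulrC; exact: sum_unit_coordr. Qed.

Lemma L1_conn_skew (x : 'I_7 -> R) i j :
  L1_conn j x (unit_coord R i) = - L1_conn i x (unit_coord R j).
Proof.
have := L1_conn_metric x (unit_coord R i) (unit_coord R j).
by rewrite big_split /= sum_unit_coordr sum_unit_coordl => /eqP; rewrite addr_eq0 => /eqP.
Qed.

(** The algebraic core of the uniqueness of a metric connection with given
    torsion: alternating the skewness and the symmetry yields [D = - D]. *)
Lemma koszul_unique (D : 'I_4 -> 'I_4 -> 'I_4 -> R) :
  (forall a b c, D a b c = - D a c b) -> (forall a b c, D a b c = D b a c) ->
  forall a b c, D a b c = 0.
Proof.
move=> skew sym a b c; have : D a b c = - D a b c.
  by rewrite {1}sym skew sym skew sym skew opprK sym.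
lra.
Qed.

End L1_koszul.

(** * The quaternionic contact structure *)

Section L1_geometry.
Variables (R : realType) (G : lieGroup7 R).
Variables (e : 'I_7 -> form1 G) (E : 'I_7 -> vfield G).
Hypothesis e_smooth : forall i, smooth_form1 (e i).
Hypothesis E_smooth : forall i, smooth_vf (E i).
Hypothesis dual : forall i j p, e i p (E j p) = (i == j)%:R.
Hypothesis L1_eqs : L1_structure_equations e.
Local Notation q := (coframe_qc e E).
Implicit Types (p : G) (A B C X Y Z W : vfield G) (v w : tvec R) (s t : 'I_3).

Definition frame_coord p v : 'I_7 -> R := fun i => e i p v.

Lemma L1_d_eq k : d_eq (e k) (fun p v w => L1_d k (frame_coord p v) (frame_coord p w)).
Proof.
have [d1 [d2 [d3 [d4 [d5 [d6 d7]]]]]] := L1_eqs.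
move: k; apply: ix_ind => A B SA SB p.
- exact: d1.
- exact: d2.
- exact: d3.
- exact: d4.
- exact: d5.
- exact: d6.
- exact: d7.
Qed.

Lemma bracket_coord k A B p : smooth_vf A -> smooth_vf B ->
  e k p (lie_bracket A B p) =
  lieder A (fun y => e k y (B y)) p - lieder B (fun y => e k y (A y)) p -
  L1_d k (frame_coord p (A p)) (frame_coord p (B p)).
Proof. by move=> SA SB; rewrite -(L1_d_eq k SA SB) /dform; ring. Qed.

Lemma coord_frame p i : frame_coord p (E i p) = unit_coord R i.
Proof. by apply: boolp.funext => j; rewrite /frame_coord dual. Qed.

Lemma qI_coord s p v : frame_coord p (qI q s p v) = fun k => L1_I s k (frame_coord p v).
Proof.
apply: boolp.funext; apply: ix_ind; rewrite /frame_coord /= (form_sum e_smooth) sum4E !horE;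
  rewrite !(formZ e_smooth) !dual !ix_eq /=;
  by case: (ord3E s) => ->; rewrite L1_IE /omega /wedge /= !dual !ix_eq /=; ring.
Qed.

Lemma inHP p v : inH q p v <-> horizontal (frame_coord p v).
Proof. by []. Qed.

Lemma inVP p v : inV q p v <-> vertical (frame_coord p v).
Proof.
split=> [[c ->] a|hv].
  rewrite /frame_coord (form_sum e_smooth) big1 // => s _.
  rewrite (formZ e_smooth) /= dual -[X in _ * X]/(unit_coord R (vert s) (hor a)).
  by rewrite unit_coord_vertical mulr0.
exists (fun s => e (vert s) p v); rewrite {1}(frame_expand e_smooth dual p v).
have := verticalE hv; rewrite /frame_coord => hv'.
by rewrite sum7E sum3E !hv' !scale0r !add0r /= !vertE.
Qed.

Lemma qg_frame p i j : qg q p (E i p) (E j p) = (i == j)%:R.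
Proof.
rewrite /= -[LHS]/(\sum_k frame_coord p (E i p) k * frame_coord p (E j p) k) !coord_frame.
by rewrite sum_unit_coordl.
Qed.

Lemma qg_frame_r p v k : qg q p v (E k p) = e k p v.
Proof.
rewrite /= -[LHS]/(\sum_i frame_coord p v i * frame_coord p (E k p) i) coord_frame.
by rewrite sum_unit_coordr.
Qed.

Lemma actI_smooth s X : smooth_vf X -> smooth_vf (actI q s X).
Proof.
move=> SX; apply: (smooth_vfP e_smooth E_smooth dual) => k p.
have -> : (fun y => e k y (actI q s X y)) = (fun y => L1_I s k (frame_coord y (X y))).
  by apply: boolp.funext => y; rewrite -[LHS]/(frame_coord y (qI q s y (X y)) k) qI_coord.
have S i : smooth_fun_at (fun y => e i y (X y)) p by exact: form_smooth.
have SN i : smooth_fun_at (fun y => - e i y (X y)) p by exact: smoothN.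
have S0 := smooth_cst 0 p.
move: k; apply: ix_ind; case: (ord3E s) => ->; first
  [exact: S|exact: SN|exact: S0].
Qed.

Lemma qI_horizontal s p v : inH q p (qI q s p v).
Proof.
apply/inHP; rewrite qI_coord => t.
by case: (ord3E s) => ->; case: (ord3E t) => ->; rewrite vertE L1_IE.
Qed.

Lemma frame_horizontal a : H_section q (E (hor a)).
Proof.
split=> // p; apply/inHP; rewrite coord_frame; exact: unit_coord_horizontal.
Qed.

Lemma frame_vertical s : V_section q (E (vert s)).
Proof.
split=> // p; apply/inVP; rewrite coord_frame; exact: unit_coord_vertical.
Qed.

Lemma lieder_form_frame A i j p : lieder A (fun y => e i y (E j y)) p = 0.
Proof.
rewrite -[RHS](dfun_cst ((i == j)%:R : R) p (A p)).
by congr (lieder A _ p); apply: boolp.funext => y; rewrite dual.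
Qed.

Lemma lieder_horizontal A X s p : H_section q X ->
  lieder A (fun y => e (vert s) y (X y)) p = 0.
Proof.
move=> [_ hX]; rewrite -[RHS](dfun_cst (0 : R) p (A p)).
by congr (lieder A _ p); apply: boolp.funext => y; exact: hX.
Qed.

Lemma lieder_vertical A X a p : V_section q X ->
  lieder A (fun y => e (hor a) y (X y)) p = 0.
Proof.
move=> [_ hX]; rewrite -[RHS](dfun_cst (0 : R) p (A p)).
by congr (lieder A _ p); apply: boolp.funext => y; have /inVP := hX y; exact.
Qed.

Lemma L1_is_qc_metric : is_qc_metric q.
Proof.
split; first split.
- move=> p v a w w'; rewrite /= mulr_sumr -big_split /=; apply: eq_bigr => i _.
  by rewrite (form_linear e_smooth); ring.
- by move=> p v w; apply: eq_bigr => i _; exact: mulrC.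
- move=> p v _ v0; rewrite lt_neqAle; apply/andP; split; last first.
    by apply: sumr_ge0 => i _; rewrite -expr2 sqr_ge0.
  apply: contra v0 => /eqP/esym/eqP.
  rewrite psumr_eq0 => [/allP v0|i _]; last by rewrite -expr2 sqr_ge0.
  apply/eqP/(frame_ext e_smooth dual (p := p)) => i; rewrite (form0 e_smooth).
  by apply/eqP; have := v0 i (mem_index_enum i); rewrite -expr2 sqrf_eq0.
- move=> p v s hv; rewrite /= -[RHS](hv s) -[LHS]/(\sum_i frame_coord p (E (vert s) p) i * frame_coord p v i).
  by rewrite coord_frame sum_unit_coordl.
- move=> p s t; apply: etrans (qg_frame p (vert s) (vert t)) _.
  by rewrite vert_eq.
- move=> A B SA SB p; apply: smooth_sum => i _.
  by apply: smoothM; exact: form_smooth.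
Qed.

Lemma L1_I_linear s k (a : R) (x y : 'I_7 -> R) :
  L1_I s k (fun i => a * x i + y i) = a * L1_I s k x + L1_I s k y.
Proof.
by move: k; apply: ix_ind; case: (ord3E s) => ->; rewrite !L1_IE; ring.
Qed.

Lemma coord_linear p (a : R) v w : frame_coord p (a *: v + w) = fun i => a * frame_coord p v i + frame_coord p w i.
Proof. by apply: boolp.funext => i; exact: form_linear. Qed.

Lemma coord_ext p v w : frame_coord p v = frame_coord p w -> v = w.
Proof.
by move=> vw; apply: (frame_ext e_smooth dual (p := p)) => i; exact: (congr1 (@^~ i) vw).
Qed.

Lemma coordN p v : frame_coord p (- v) = fun i => - frame_coord p v i.
Proof. by apply: boolp.funext => i; exact: formN. Qed.

Lemma L1_is_hyperhermitian : is_hyperhermitian q.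
Proof.
split.
- move=> s p a v w; apply: (@coord_ext p); rewrite coord_linear !qI_coord coord_linear.
  by apply: boolp.funext => k; exact: L1_I_linear.
- by move=> s X [SX _]; split; [exact: actI_smooth|move=> p; exact: qI_horizontal].
- move=> s p v /inHP/horizontalE hv; split; first exact: qI_horizontal.
  apply: (@coord_ext p); rewrite coordN !qI_coord; apply: boolp.funext.
  by apply: ix_ind; case: (ord3E s) => ->; rewrite !L1_IE ?opprK ?hv ?oppr0.
- move=> p v /inHP/horizontalE hv; split; apply: (@coord_ext p);
    rewrite ?coordN !qI_coord; apply: boolp.funext;
    by apply: ix_ind; rewrite !L1_IE ?opprK ?hv ?oppr0.
- move=> s p v w /inHP/horizontalE hv /inHP/horizontalE hw.
  rewrite /= -[LHS]/(\sum_i frame_coord p (qI q s p v) i * frame_coord p (qI q s p w) i).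
  rewrite -[RHS]/(\sum_i frame_coord p v i * frame_coord p w i) !qI_coord !sum7E.
  by case: (ord3E s) => ->; rewrite !L1_IE !hv; ring.
Qed.

Lemma dform_coord k A B p : smooth_vf A -> smooth_vf B ->
  dform (e k) A B p = L1_d k (frame_coord p (A p)) (frame_coord p (B p)).
Proof. by move=> SA SB; exact: L1_d_eq. Qed.

Lemma L1_is_contact : is_contact_with_reeb q.
Proof.
split; first by move=> s; exact: e_smooth.
split; first by move=> s; exact: E_smooth.
split.
  move=> s X Y [SX hX] [SY hY] p; rewrite /= dform_coord //.
  rewrite -[X in 2 * X]/(\sum_i frame_coord p (qI q s p (X p)) i * frame_coord p (Y p) i).
  have {}hX := horizontalE (hX p : horizontal (frame_coord p (X p))).
  have {}hY := horizontalE (hY p : horizontal (frame_coord p (Y p))).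
  rewrite qI_coord sum7E.
  by case: (ord3E s) => ->; rewrite vertE !L1_IE L1_dE /wedge_coord !hX !hY; ring.
split.
  by move=> s k p; rewrite /= dual vert_eq.
split.
  move=> s X [SX hX] p; rewrite /= dform_coord // coord_frame.
  have {}hX := horizontalE (hX p : horizontal (frame_coord p (X p))).
  by case: (ord3E s) => ->; rewrite vertE L1_dE /wedge_coord /unit_coord !ix_eq /= !hX; ring.
move=> s t X [SX hX] p; rewrite /= !dform_coord // !coord_frame.
have {}hX := horizontalE (hX p : horizontal (frame_coord p (X p))).
by case: (ord3E s) => ->; case: (ord3E t) => ->;
  rewrite !vertE !L1_dE /wedge_coord /unit_coord !ix_eq /= !hX; ring.
Qed.

Lemma L1_is_qc : is_qc_structure q.
Proof.
by split; [exact: L1_is_qc_metric|exact: L1_is_hyperhermitian|exact: L1_is_contact].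
Qed.

End L1_geometry.

(** * Existence of the Biquard connection *)

Section bilinear_functions.
Variables (R : realType) (M : manifold7 R) (b : ('I_7 -> R) -> ('I_7 -> R) -> R).
Hypothesis bE : forall x y,
  \sum_i \sum_j x i * y j * b (unit_coord R i) (unit_coord R j) = b x y.

Lemma bilinear_smooth (f g : 'I_7 -> M -> R) p :
  (forall i, smooth_fun_at (f i) p) -> (forall i, smooth_fun_at (g i) p) ->
  smooth_fun_at (fun y => b (f^~ y) (g^~ y)) p.
Proof.
move=> Sf Sg; have -> : (fun y => b (f^~ y) (g^~ y)) =
  (fun y => \sum_i \sum_j f i y * g j y * b (unit_coord R i) (unit_coord R j)).
  by apply: boolp.funext => y; rewrite -(bE (f^~ y)).
apply: smooth_sum => i _; apply: smooth_sum => j _; apply: smoothM; last exact: smooth_cst.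
exact: smoothM.
Qed.

Lemma bilinear_derivation (f g : 'I_7 -> M -> R) p v :
  (forall i, smooth_fun_at (f i) p) -> (forall i, smooth_fun_at (g i) p) ->
  dfun (fun y => b (f^~ y) (g^~ y)) p v =
  b (fun i => dfun (f i) p v) (g^~ p) + b (f^~ p) (fun i => dfun (g i) p v).
Proof.
move=> Sf Sg; have -> : (fun y => b (f^~ y) (g^~ y)) =
  (fun y => \sum_i \sum_j f i y * g j y * b (unit_coord R i) (unit_coord R j)).
  by apply: boolp.funext => y; rewrite -(bE (f^~ y)).
have Sfg i j : smooth_fun_at (fun y => f i y * g j y) p by exact: smoothM.
have Sc (c : R) := smooth_cst c p.
rewrite dfun_sumf => [|i _]; last first.
  by apply: smooth_sum => j _; apply: smoothM; [exact: Sfg|exact: Sc].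
rewrite -!bE -big_split; apply: eq_bigr => i _ /=.
rewrite dfun_sumf => [|j _]; last by apply: smoothM; [exact: Sfg|exact: Sc].
rewrite -big_split; apply: eq_bigr => j _ /=.
rewrite (dfun_mulf v (Sfg i j) (Sc _)) dfun_cst (dfun_mulf v (Sf i) (Sg j)); ring.
Qed.

End bilinear_functions.

Section L1_biquard.
Variables (R : realType) (G : lieGroup7 R).
Variables (e : 'I_7 -> form1 G) (E : 'I_7 -> vfield G).
Hypothesis e_smooth : forall i, smooth_form1 (e i).
Hypothesis E_smooth : forall i, smooth_vf (E i).
Hypothesis dual : forall i j p, e i p (E j p) = (i == j)%:R.
Hypothesis L1_eqs : L1_structure_equations e.
Local Notation q := (coframe_qc e E).
Local Notation coord := (frame_coord e).
Implicit Types (p : G) (A B C X Y Z W : vfield G) (v w : tvec R) (s t : 'I_3).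

Definition L1_nabla A B : vfield G := fun p =>
  \sum_k (lieder A (fun y => e k y (B y)) p +
          L1_conn k (coord p (A p)) (coord p (B p))) *: E k p.

Definition has_L1_coefficients (nabla : vfield G -> vfield G -> vfield G) :=
  forall A B, smooth_vf A -> smooth_vf B -> forall k p,
  e k p (nabla A B p) = lieder A (fun y => e k y (B y)) p +
                        L1_conn k (coord p (A p)) (coord p (B p)).

Lemma L1_nabla_coefficients : has_L1_coefficients L1_nabla.
Proof. by move=> A B _ _ k p; rewrite /L1_nabla (form_comb e_smooth dual). Qed.

Lemma coord_smooth A k p : smooth_vf A -> smooth_fun_at (fun y => coord y (A y) k) p.
Proof. by move=> SA; exact: form_smooth. Qed.

Lemma L1_conn_smooth k (f g : 'I_7 -> G -> R) p :
  (forall i, smooth_fun_at (f i) p) -> (forall i, smooth_fun_at (g i) p) ->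
  smooth_fun_at (fun y => L1_conn k (f^~ y) (g^~ y)) p.
Proof. exact: (bilinear_smooth (@L1_conn_bilinear R k)). Qed.

Lemma L1_conn_derivation k (f g : 'I_7 -> G -> R) p v :
  (forall i, smooth_fun_at (f i) p) -> (forall i, smooth_fun_at (g i) p) ->
  dfun (fun y => L1_conn k (f^~ y) (g^~ y)) p v =
  L1_conn k (fun i => dfun (f i) p v) (g^~ p) + L1_conn k (f^~ p) (fun i => dfun (g i) p v).
Proof. exact: (bilinear_derivation (@L1_conn_bilinear R k)). Qed.

Lemma lieder_addv A A' f p : smooth_fun_at f p ->
  lieder (fun y => A y + A' y) f p = lieder A f p + lieder A' f p.
Proof. exact: dfunD. Qed.

Lemma L1_nabla_linear : is_linear_connection L1_nabla.
Proof.
have C := L1_nabla_coefficients.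
have fD A A' : smooth_vf A -> smooth_vf A' -> smooth_vf (fun p => A p + A' p).
  exact: smooth_vfD.
have ext A B : (forall k p, e k p (A p) = e k p (B p)) -> A = B.
  exact: (field_ext e_smooth dual).
have c1 p (x : 'I_7 -> R) y : (fun i => x i + y i) = (fun i => 1 * x i + y i).
  by apply: boolp.funext => i; rewrite mul1r.
have c2 p (a : R) (x : 'I_7 -> R) : (fun i => a * x i) = (fun i => a * x i + 0).
  by apply: boolp.funext => i; rewrite addr0.
have cD p v w : coord p (v + w) = fun i => 1 * coord p v i + coord p w i.
  by rewrite -{1}[v]scale1r (coord_linear e_smooth).
have cZ p a v : coord p (a *: v) = fun i => a * coord p v i + coord p 0 i.
  by rewrite -{1}[_ *: v]addr0 (coord_linear e_smooth).
have conn0l k y p : L1_conn k (coord p 0) y = 0.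
  by move: k; apply: ix_ind; rewrite L1_connE /frame_coord !(form0 e_smooth); ring.
have conn0r k x p : L1_conn k x (coord p 0) = 0.
  by move: k; apply: ix_ind; rewrite L1_connE /frame_coord !(form0 e_smooth); ring.
split.
  move=> A B SA SB; apply: (smooth_vf_comb E_smooth) => k p.
  apply: smoothD; first by apply: lieder_smooth => //; exact: form_smooth.
  by apply: (@L1_conn_smooth k (fun i y => coord y (A y) i)
    (fun i y => coord y (B y) i)) => i; exact: coord_smooth.
split.
  move=> A A' B SA SA' SB; apply: ext => k p.
  rewrite (formD e_smooth) (C _ _ (fD _ _ SA SA') SB) (C _ _ SA SB) (C _ _ SA' SB).
  rewrite lieder_addv; last exact: form_smooth.
  by rewrite cD L1_conn_linearl; ring.
split.
  move=> f A B Sf SA SB; apply: ext => k p.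
  rewrite /fscale (formZ e_smooth) (C _ _ (smooth_vfZ Sf SA) SB) (C _ _ SA SB).
  rewrite [X in X + _]liederE dfunZ; last exact: form_smooth.
  by rewrite cZ L1_conn_linearl conn0l liederE; ring.
split.
  move=> A B B' SA SB SB'; apply: ext => k p.
  rewrite (formD e_smooth) (C _ _ SA (fD _ _ SB SB')) (C _ _ SA SB) (C _ _ SA SB').
  have -> : (fun y => e k y (B y + B' y)) = (fun y => e k y (B y) + e k y (B' y)).
    by apply: boolp.funext => y; rewrite (formD e_smooth).
  rewrite [X in X + _]liederE dfun_addf; try exact: form_smooth.
  by rewrite cD L1_conn_linearr -!liederE; ring.
move=> f A B Sf SA SB; apply: ext => k p.
rewrite (formD e_smooth) !(formZ e_smooth) (C _ _ SA (smooth_vfZ Sf SB)) (C _ _ SA SB).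
have -> : (fun y => e k y (fscale f B y)) = (fun y => f y * e k y (B y)).
  by apply: boolp.funext => y; rewrite (formZ e_smooth).
rewrite [X in X + _]liederE dfun_mulf; [|exact: Sf|exact: form_smooth].
by rewrite cZ L1_conn_linearr conn0r -!liederE /frame_coord; ring.
Qed.

(** The derivatives of the components cancel against those in the bracket. *)
Lemma torsion_coord (nabla : vfield G -> vfield G -> vfield G) A B k p :
  has_L1_coefficients nabla -> smooth_vf A -> smooth_vf B ->
  e k p (torsion nabla A B p) = L1_conn k (coord p (A p)) (coord p (B p)) -
    L1_conn k (coord p (B p)) (coord p (A p)) + L1_d k (coord p (A p)) (coord p (B p)).
Proof.
move=> C SA SB; rewrite /torsion !(formB e_smooth) !C // (bracket_coord L1_eqs) //; ring.
Qed.

Lemma torsion_mixed_zero nabla : has_L1_coefficients nabla -> torsion_endomorphism_zero q nabla.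
Proof.
move=> C Z X [SZ hZ] [SX hX] p; apply: (frame_ext e_smooth dual (p := p)) => k.
rewrite torsion_coord // (form0 e_smooth); apply: L1_conn_torsion_mixed.
  exact/(inVP e_smooth dual).
exact: hX.
Qed.

Lemma L1_I_sum s k (x : 'I_7 -> R) : \sum_i x i * L1_I s k (unit_coord R i) = L1_I s k x.
Proof.
by move: k; apply: ix_ind; case: (ord3E s) => ->;
  rewrite sum7E !L1_IE /unit_coord ?ix_eq /=; ring.
Qed.

Lemma L1_I_derivation s k (f : 'I_7 -> G -> R) p v :
  (forall i, smooth_fun_at (f i) p) ->
  dfun (fun y => L1_I s k (f^~ y)) p v = L1_I s k (fun i => dfun (f i) p v).
Proof.
move=> Sf; have -> : (fun y => L1_I s k (f^~ y)) =
  (fun y => \sum_i f i y * L1_I s k (unit_coord R i)).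
  by apply: boolp.funext => y; rewrite L1_I_sum.
have Sc (c : R) := smooth_cst c p.
rewrite dfun_sumf => [|i _]; last exact: smoothM (Sf i) (Sc _).
rewrite -L1_I_sum; apply: eq_bigr => i _.
by rewrite (dfun_mulf v (Sf i) (Sc _)) dfun_cst mulr0 add0r mulrC.
Qed.

Lemma actI_coord s X i y : e i y (actI q s X y) = L1_I s i (coord y (X y)).
Proof. by rewrite -[LHS]/(frame_coord e y (qI q s y (X y)) i) (qI_coord e_smooth dual). Qed.

(** The derivatives of the components of [X] cancel, and the remaining commutator
    of the connection with the [I_s] is again in the span of the [I_s]. *)
Lemma nablaQ_coord nabla A (f : 'I_3 -> G -> R) X k p : has_L1_coefficients nabla ->
  smooth_vf A -> (forall s, smooth_fun (f s)) -> H_section q X ->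
  e k p (nablaQ q nabla A f X p) =
  \sum_s (lieder A (f s) p + L1_conn (vert s) (coord p (A p))
     (fun j => \sum_t (vert t == j)%:R * f t p)) * L1_I s k (coord p (X p)).
Proof.
move=> C SA Sf [SX hX].
have SI s : smooth_vf (actI q s X) by exact: (actI_smooth e_smooth E_smooth dual).
have SQ : smooth_vf (actQ q f X) := smooth_vf_sum _ (fun s => smooth_vfZ (Sf s) (SI s)).
have QE i y Y : e i y (actQ q f Y y) = \sum_s f s y * L1_I s i (coord y (Y y)).
  rewrite (form_sum e_smooth); apply: eq_bigr => s _; rewrite (formZ e_smooth).
  by congr (_ * _); exact: actI_coord.
have SIc s i : smooth_fun_at (fun y => L1_I s i (coord y (X y))) p.
  have -> : (fun y => L1_I s i (coord y (X y))) = (fun y => e i y (actI q s X y)).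
    by apply: boolp.funext => y; rewrite actI_coord.
  exact: form_smooth (SI s).
rewrite /nablaQ (formB e_smooth) (C _ _ SA SQ) QE.
have -> : (fun y => e k y (actQ q f X y)) = (fun y => \sum_s f s y * L1_I s k (coord y (X y))).
  by apply: boolp.funext => y; exact: QE.
rewrite [X in X + _ - _]liederE dfun_sumf => [|s _]; last exact: smoothM (Sf s p) (SIc s k).
have -> : coord p (actQ q f X p) = (fun j => \sum_s f s p * L1_I s j (coord p (X p))).
  by apply: boolp.funext => j; exact: QE.
have -> : coord p (nabla A X p) = (fun i => 1 * dfun (fun y => coord y (X y) i) p (A p)
   + L1_conn i (coord p (A p)) (coord p (X p))).
  by apply: boolp.funext => i; rewrite mul1r -[LHS]/(e i p (nabla A X p)) (C _ _ SA SX).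
under [X in X + _ - _]eq_bigr => s _.
  rewrite (dfun_mulf _ (Sf s p) (SIc s k)) (@L1_I_derivation s k (fun i y => coord y (X y) i));
    last by move=> i; exact: coord_smooth.
  over.
under [X in _ - X]eq_bigr => s _ do rewrite L1_I_linear mul1r mulrDr.
under [RHS]eq_bigr => s _ do rewrite mulrDl.
rewrite [RHS]big_split /=.
rewrite -(L1_conn_parallel_I k (coord p (A p)) (f^~ p) (hX p : horizontal (coord p (X p)))).
rewrite !big_split /=.
under [X in _ = X + _]eq_bigr => s _ do rewrite mulrC.
ring.
Qed.

Lemma V_section_comb Z p : V_section q Z ->
  (fun j => \sum_t (vert t == j)%:R * e (vert t) p (Z p)) = coord p (Z p).
Proof.
move=> [_ hZ]; have hv := verticalE ((inVP e_smooth dual _ _).1 (hZ p)).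
by apply: boolp.funext; apply: ix_ind;
  rewrite sum3E !vertE !ix_eq /= ?hv /frame_coord; ring.
Qed.

Lemma L1_nabla_preserves_H A X : smooth_vf A -> H_section q X ->
  H_section q (L1_nabla A X).
Proof.
move=> SA HX; have [SX hX] := HX.
split=> [|p s]; first exact: (nabla_smooth L1_nabla_linear).
have hx : horizontal (coord p (X p)) := hX p.
rewrite /= (L1_nabla_coefficients SA SX) (lieder_horizontal A s p HX) add0r.
exact: L1_conn_horizontal.
Qed.

Lemma L1_nabla_preserves_V A X : smooth_vf A -> V_section q X ->
  V_section q (L1_nabla A X).
Proof.
move=> SA VX; have [SX hX] := VX.
split=> [|p]; first exact: (nabla_smooth L1_nabla_linear).
have hx := (inVP e_smooth dual _ _).1 (hX p); apply/(inVP e_smooth dual) => a.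
rewrite /frame_coord (L1_nabla_coefficients SA SX).
by rewrite (lieder_vertical e_smooth dual A a p VX) add0r L1_conn_vertical.
Qed.

Lemma L1_nabla_metric A B C p : smooth_vf A -> smooth_vf B -> smooth_vf C ->
  lieder A (fun y => qg q y (B y) (C y)) p =
  qg q p (L1_nabla A B p) (C p) + qg q p (B p) (L1_nabla A C p).
Proof.
move=> SA SB SC; rewrite liederE /= dfun_sumf => [|i _]; last first.
  exact: smoothM (form_smooth e_smooth i p SB) (form_smooth e_smooth i p SC).
rewrite -big_split /= -[LHS]addr0.
rewrite -[X in _ + X = _](L1_conn_metric (coord p (A p)) (coord p (B p)) (coord p (C p))).
rewrite -big_split; apply: eq_bigr => i _ /=.
rewrite (dfun_mulf _ (form_smooth e_smooth i p SB) (form_smooth e_smooth i p SC)).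
rewrite (L1_nabla_coefficients SA SB) (L1_nabla_coefficients SA SC) !liederE /frame_coord.
ring.
Qed.

Lemma projV_coord k p v : e k p (projV q p v) =
  if (k < 4)%N then 0 else e k p v.
Proof.
rewrite /projV /= (form_sum e_smooth) sum3E !(formZ e_smooth) !vertE !dual.
by move: k; apply: ix_ind; rewrite !ix_eq /=; ring.
Qed.

Lemma L1_nabla_torsion_H X Y p : H_section q X -> H_section q Y ->
  torsion L1_nabla X Y p = - projV q p (lie_bracket X Y p).
Proof.
move=> HX HY; have [SX hX] := HX; have [SY hY] := HY.
have hx : horizontal (coord p (X p)) := hX p.
have hy : horizontal (coord p (Y p)) := hY p.
have Hh a : e (hor a) p (torsion L1_nabla X Y p) = 0.
  rewrite torsion_coord //; first exact: L1_conn_torsion_horizontal.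
  exact: L1_nabla_coefficients.
have Hv s : e (vert s) p (torsion L1_nabla X Y p) = - e (vert s) p (lie_bracket X Y p).
  rewrite (torsion_coord _ _ L1_nabla_coefficients SX SY) (bracket_coord L1_eqs _ _ SX SY).
  rewrite (lieder_horizontal X s p HY) (lieder_horizontal Y s p HX).
  by rewrite !(L1_conn_horizontal _ hx) !(L1_conn_horizontal _ hy) !subr0 !add0r opprK.
apply: (frame_ext e_smooth dual (p := p)) => k; rewrite (formN e_smooth) projV_coord.
move: k; apply: ix_ind => /=.
- by rewrite oppr0 -[RHS](Hh h1) horE.
- by rewrite oppr0 -[RHS](Hh h2) horE.
- by rewrite oppr0 -[RHS](Hh h3) horE.
- by rewrite oppr0 -[RHS](Hh h4) horE.
- by rewrite -!vertE Hv.
- by rewrite -!vertE Hv.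
- by rewrite -!vertE Hv.
Qed.

Lemma L1_nabla_Q A (f : 'I_3 -> G -> R) X : smooth_vf A ->
  (forall s, smooth_fun (f s)) -> H_section q X ->
  nablaQ q L1_nabla A f X = actQ q (fun s p => lieder A (f s) p +
    L1_conn (vert s) (coord p (A p)) (fun j => \sum_t (vert t == j)%:R * f t p)) X.
Proof.
move=> SA Sf HX; apply: (field_ext e_smooth dual) => k p.
rewrite (nablaQ_coord k p L1_nabla_coefficients SA Sf HX) (form_sum e_smooth).
apply: eq_bigr => s _; rewrite (formZ e_smooth); congr (_ * _).
exact/esym/actI_coord.
Qed.

Lemma L1_nabla_biquard : is_biquard_connection q L1_nabla.
Proof.
split; first exact: L1_nabla_linear.
split; first exact: L1_nabla_preserves_H.
split; first exact: L1_nabla_preserves_V.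
split; first by move=> A B C SA SB SC p; exact: L1_nabla_metric.
split; first by move=> X Y HX HY p; exact: L1_nabla_torsion_H.
have T0 := torsion_mixed_zero L1_nabla_coefficients.
split.
  move=> A f SA Sf; eexists; last by move=> X; exact: L1_nabla_Q.
  move=> s p; apply: smoothD; first exact: lieder_smooth SA (Sf s p).
  apply: (@L1_conn_smooth (vert s) (fun i y => coord y (A y) i)
    (fun j y => \sum_t (vert t == j)%:R * f t y)) => i; first exact: coord_smooth.
  by apply: smooth_sum => t _; apply: smooth_cstM; exact: Sf.
split.
  move=> Z X VZ HX; rewrite (_ : torsion L1_nabla Z X = (fun=> 0)).
    split; first exact: (@smooth_vf0 _ G).
    by move=> p s; exact: form0.
  by apply: boolp.funext => p; exact: T0.
split.
  move=> Z VZ p x b [Hx _] _; apply: big1 => a _.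
  rewrite (T0 Z (x a) VZ (Hx a)) /=; apply: big1 => i _.
  by rewrite (form0 e_smooth) mul0r.
move=> A Z X SA VZ HX; have [SZ _] := VZ.
rewrite L1_nabla_Q //; last by move=> s p; exact: form_smooth SZ.
congr (actQ q _ X); apply: boolp.funext => s; apply: boolp.funext => p.
by rewrite /= (V_section_comb p VZ) (L1_nabla_coefficients SA SZ).
Qed.

End L1_biquard.

(** * Uniqueness of the Biquard connection, and its curvature *)

Section L1_uniqueness.
Variables (R : realType) (G : lieGroup7 R).
Variables (e : 'I_7 -> form1 G) (E : 'I_7 -> vfield G).
Hypothesis e_smooth : forall i, smooth_form1 (e i).
Hypothesis E_smooth : forall i, smooth_vf (E i).
Hypothesis dual : forall i j p, e i p (E j p) = (i == j)%:R.
Hypothesis L1_eqs : L1_structure_equations e.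
Local Notation q := (coframe_qc e E).
Local Notation coord := (frame_coord e).
Local Notation gam := (christoffel e E).
Implicit Types (p : G) (A B C X Y Z W : vfield G) (v w : tvec R) (s t : 'I_3).
Implicit Types (a b c : 'I_4) (i j k : 'I_7).

Section biquard.
Variable nabla : vfield G -> vfield G -> vfield G.
Hypothesis bq : is_biquard_connection q nabla.

Lemma biquard_skew i j k p : gam nabla i j k p = - gam nabla i k j p.
Proof.
have [_ [_ [_ [nM _]]]] := bq; have := nM _ _ _ (E_smooth i) (E_smooth j) (E_smooth k) p.
rewrite (qg_frame_r dual).
have -> : qg q p (E j p) (nabla (E i) (E k) p) = gam nabla i k j p.
  have [[_ sym _ _ _] _] := L1_is_qc_metric e_smooth dual.
  by rewrite sym (qg_frame_r dual).
have -> : (fun y => qg q y (E j y) (E k y)) = (fun=> (j == k)%:R).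
  by apply: boolp.funext => y; exact: qg_frame.
rewrite liederE dfun_cst => /esym/eqP; rewrite addr_eq0 => /eqP; exact.
Qed.

Lemma biquard_hor_vert i a s p : gam nabla i (hor a) (vert s) p = 0.
Proof.
have [_ [nH _]] := bq.
by have [_ h] := nH _ _ (E_smooth i) (frame_horizontal E_smooth dual a); exact: h.
Qed.

Lemma biquard_vert_hor i a s p : gam nabla i (vert s) (hor a) p = 0.
Proof. by rewrite biquard_skew biquard_hor_vert oppr0. Qed.

Lemma biquard_torsion_hor a b c p :
  gam nabla (hor a) (hor b) (hor c) p - gam nabla (hor b) (hor a) (hor c) p =
  e (hor c) p (lie_bracket (E (hor a)) (E (hor b)) p).
Proof.
have [_ [_ [_ [_ [nT _]]]]] := bq; have fH := frame_horizontal E_smooth dual.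
have /(congr1 (e (hor c) p)) := nT _ _ (fH a) (fH b) p.
rewrite /torsion !(formB e_smooth) (formN e_smooth) (projV_coord e_smooth dual).
by rewrite /= ltn_ord oppr0 => /eqP; rewrite subr_eq0 => /eqP.
Qed.

(** [I_s] maps the first horizontal frame vector to the one of index
    [second_axis s]. *)
Definition second_axis s : 'I_4 := match val s with 0 => h2 | 1 => h3 | _ => h4 end.

Lemma second_axisE :
  (second_axis o1 = h2) * (second_axis o2 = h3) * (second_axis o3 = h4).
Proof. by []. Qed.

(** The condition [nabla phi = 0] along the first horizontal frame vector expresses
    the coefficients on V through those on H. *)
Lemma biquard_vert i s t p : gam nabla i (vert s) (vert t) p =
  gam nabla i (hor (second_axis s)) (hor (second_axis t)) p -
  L1_I s (hor (second_axis t)) (fun k => gam nabla i (hor h1) k p).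
Proof.
have [_ [_ [_ [_ [_ [_ [_ [_ nphi]]]]]]]] := bq.
have fH := frame_horizontal E_smooth dual h1.
have fV := frame_vertical e_smooth E_smooth dual s.
have := nphi _ _ _ (E_smooth i) fV fH.
move=> /(congr1 (fun A => e (hor (second_axis t)) p (A p))).
rewrite /nablaQ.
have -> : actQ q (fun t y => qeta q t y (E (vert s) y)) (E (hor h1)) = E (hor (second_axis s)).
  apply: (field_ext e_smooth dual) => k y.
  rewrite (form_sum e_smooth) sum3E !(formZ e_smooth) /= !dual.
  rewrite -!/(actI q _ _ y) !(actI_coord e_smooth dual) (coord_frame dual).
  by move: k; case: (ord3E s) => ->; apply: ix_ind;
    rewrite !vertE ?horE !ix_eq !L1_IE /unit_coord ?ix_eq /=; ring.
rewrite (formB e_smooth) => nE.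
have actE (f : 'I_3 -> R) k v : e k p (\sum_s f s *: qI q s p v) = \sum_s f s * L1_I s k (coord p v).
  rewrite (form_sum e_smooth); apply: eq_bigr => u _; rewrite (formZ e_smooth).
  by congr (_ * _); exact: (congr1 (@^~ k) (qI_coord e_smooth dual u p v)).
move: nE; rewrite /actQ !actE (coord_frame dual).
have -> : \sum_u qeta q u p (E (vert s) p) *
    L1_I u (hor (second_axis t)) (coord p (nabla (E i) (E (hor h1)) p)) =
    L1_I s (hor (second_axis t)) (fun k => gam nabla i (hor h1) k p).
  rewrite (bigD1 s) //= dual eqxx mul1r big1 ?addr0 // => u us.
  by rewrite dual vert_eq (negbTE us) mul0r.
rewrite -/(christoffel e E nabla i (hor (second_axis s)) (hor (second_axis t)) p) => ->.
rewrite sum3E -/(christoffel e E nabla i (vert s) (vert t) p).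
by case: (ord3E t) => ->; rewrite !second_axisE !horE !L1_IE /unit_coord ?ix_eq /christoffel /=; ring.
Qed.

(** In dimension four so(4) = sp(1) + sp(1): removing from a skew endomorphism
    its component along the [I_s] leaves one that commutes with them. *)
Lemma skew_in_sp1sp1 p (tau : 'I_4 -> 'I_4 -> R) :
  (forall a b, tau a b = - tau b a) ->
  in_sp1sp1 q p (fun v => \sum_b (\sum_a e (hor a) p v * tau a b) *: E (hor b) p).
Proof.
move=> skew.
have t0 a : tau a a = 0 by have := skew a a; lra.
pose c s : R := match val s with
  | 0 => (tau h1 h2 + tau h3 h4) / 2
  | 1 => (tau h1 h3 - tau h2 h4) / 2
  | _ => (tau h1 h4 + tau h2 h3) / 2 end.
pose Bv v := \sum_b (\sum_a e (hor a) p v * tau a b) *: E (hor b) p.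
pose B' v := Bv v - \sum_s c s *: qI q s p v.
pose T k (x : 'I_7 -> R) : R := match val k with
  | 0 => - tau h1 h2 * x (ix 2) - tau h1 h3 * x (ix 3) - tau h1 h4 * x (ix 4)
  | 1 => tau h1 h2 * x (ix 1) - tau h2 h3 * x (ix 3) - tau h2 h4 * x (ix 4)
  | 2 => tau h1 h3 * x (ix 1) + tau h2 h3 * x (ix 2) - tau h3 h4 * x (ix 4)
  | 3 => tau h1 h4 * x (ix 1) + tau h2 h4 * x (ix 2) + tau h3 h4 * x (ix 3)
  | _ => 0 end.
have TE v k : e k p (Bv v) = T k (coord p v).
  rewrite (form_sum e_smooth) sum4E !(formZ e_smooth) !sum4E !dual !horE !t0.
  rewrite (skew h2 h1) (skew h3 h1) (skew h3 h2) (skew h4 h1) (skew h4 h2) (skew h4 h3).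
  by move: k; apply: ix_ind; rewrite !ix_eq /T /frame_coord /=; ring.
have B'E v : coord p (B' v) = fun k => T k (coord p v) - \sum_s c s * L1_I s k (coord p v).
  apply: boolp.funext => k; rewrite /frame_coord (formB e_smooth) TE (form_sum e_smooth).
  congr (_ - _); apply: eq_bigr => s _; rewrite (formZ e_smooth).
  by congr (_ * _); exact: (congr1 (@^~ k) (qI_coord e_smooth dual s p v)).
exists c, B'; split.
- move=> a v w; apply: (@coord_ext _ _ _ _ e_smooth dual p).
  rewrite (coord_linear e_smooth) !B'E (coord_linear e_smooth).
  apply: boolp.funext; apply: ix_ind; rewrite !sum3E !L1_IE /T /=; ring.
- move=> v hv s; rewrite -[LHS]/(frame_coord e p (B' v) (vert s)) B'E sum3E.
  by case: (ord3E s) => ->; rewrite vertE !L1_IE /T /=; ring.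
- move=> v w hv0 hw0.
  have hv := horizontalE (hv0 : horizontal (coord p v)).
  have hw := horizontalE (hw0 : horizontal (coord p w)).
  rewrite /= -[LHS]/(\sum_i frame_coord e p (B' v) i * frame_coord e p w i).
  rewrite -[X in - X]/(\sum_i frame_coord e p v i * frame_coord e p (B' w) i) !B'E.
  move: (frame_coord e p v) (frame_coord e p w) hv hw => x y hx hy.
  by rewrite !sum7E !sum3E !L1_IE /T /= !hx !hy; ring.
- move=> s v hv0; have hv := horizontalE (hv0 : horizontal (coord p v)).
  apply: (@coord_ext _ _ _ _ e_smooth dual p).
  rewrite B'E !(qI_coord e_smooth dual) B'E.
  move: (frame_coord e p v) hv => x hx; apply: boolp.funext.
  by apply: ix_ind; case: (ord3E s) => ->; rewrite ?L1_IE /= ?sum3E /T /= ?L1_IE /c /= ?hx; field.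
- by move=> v _; rewrite /B' addrC subrK.
Qed.

Lemma biquard_torsion_mixed a b s p : e (hor b) p (torsion nabla (E (vert s)) (E (hor a)) p) =
  gam nabla (vert s) (hor a) (hor b) p -
  e (hor b) p (lie_bracket (E (vert s)) (E (hor a)) p).
Proof.
rewrite /torsion !(formB e_smooth).
by rewrite -!/(christoffel e E nabla _ _ _ p) biquard_vert_hor subr0.
Qed.

Lemma biquard_mixed_bracket_skew a b s p :
  e (hor b) p (lie_bracket (E (vert s)) (E (hor a)) p) =
  - e (hor a) p (lie_bracket (E (vert s)) (E (hor b)) p).
Proof.
rewrite !(bracket_coord L1_eqs) // !(lieder_form_frame dual) !(coord_frame dual) !subr0.
have T k c := L1_conn_torsion_mixed k (unit_coord_vertical R s) (unit_coord_horizontal R c).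
have V c c' : L1_conn (hor c) (unit_coord R (hor c')) (unit_coord R (vert s)) = 0.
  by apply: L1_conn_vertical; exact: unit_coord_vertical.
have := T (hor b) a; have := T (hor a) b; rewrite !V !subr0 => E1 E2.
have := L1_conn_skew (unit_coord R (vert s)) (hor a) (hor b); lra.
Qed.

(** The brackets of the vertical with the horizontal frame fields act skewly on H,
    so the torsion endomorphism is skew, hence lies in sp(1) + sp(1), to which
    it is orthogonal. *)
Lemma biquard_torsion_zero a b s p :
  e (hor b) p (torsion nabla (E (vert s)) (E (hor a)) p) = 0.
Proof.
pose tau a b := e (hor b) p (torsion nabla (E (vert s)) (E (hor a)) p).
have skew a' b' : tau a' b' = - tau b' a'.
  by rewrite /tau !biquard_torsion_mixed biquard_skew (biquard_mixed_bracket_skew a'); ring.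
have [_ [_ [_ [_ [_ [_ [_ [nO _]]]]]]]] := bq.
have on : orthonormal_H q (fun a => E (hor a)) p.
  split=> [c|c d]; first exact: frame_horizontal.
  by rewrite (qg_frame dual) hor_eq.
have := nO _ (frame_vertical e_smooth E_smooth dual s) p _ _ on (skew_in_sp1sp1 p skew).
have bE c : \sum_b (\sum_a e (hor a) p (E (hor c) p) * tau a b) *: E (hor b) p =
            \sum_b tau c b *: E (hor b) p.
  apply: eq_bigr => b' _; congr (_ *: _); rewrite (bigD1 c) //= dual eqxx mul1r.
  by rewrite big1 ?addr0 // => a' ac; rewrite dual hor_eq (negbTE ac) mul0r.
have gE c : qg q p (torsion nabla (E (vert s)) (E (hor c)) p) (\sum_b tau c b *: E (hor b) p) =
            \sum_b tau c b ^+ 2.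
  have eE d : e (hor d) p (\sum_b tau c b *: E (hor b) p) = tau c d.
    rewrite (form_sum e_smooth) (bigD1 d) //= (formZ e_smooth) dual eqxx mulr1.
    by rewrite big1 ?addr0 // => f fd; rewrite (formZ e_smooth) dual hor_eq eq_sym (negbTE fd) mulr0.
  have eV u : e (vert u) p (\sum_b tau c b *: E (hor b) p) = 0.
    rewrite (form_sum e_smooth) big1 // => f _; rewrite (formZ e_smooth) dual.
    by rewrite -[X in _ * X]/(unit_coord R (hor f) (vert u)) unit_coord_horizontal mulr0.
  rewrite /= sum7E -!horE -!vertE !eE !eV sum4E !expr2 !mulr0 !addr0.
  by rewrite -!/(tau _ _).
under eq_bigr do rewrite bE gE.
move=> /eqP; rewrite psumr_eq0 => [/allP/(_ a (mem_index_enum a))/=|c _]; last first.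
  by apply: sumr_ge0 => d _; exact: sqr_ge0.
rewrite psumr_eq0 => [/allP/(_ b (mem_index_enum b))/=|d _]; last exact: sqr_ge0.
by rewrite sqrf_eq0 => /eqP.
Qed.

End biquard.

(** On H the coefficients in horizontal directions are given by the Koszul
    argument and those in vertical directions by the vanishing of the torsion
    endomorphism; the coefficients on V follow from those on H. *)
Lemma biquard_unique_christoffel nabla nabla' i j k p :
  is_biquard_connection q nabla -> is_biquard_connection q nabla' ->
  gam nabla i j k p = gam nabla' i j k p.
Proof.
move=> bq bq'.
have hh a b c : gam nabla (hor a) (hor b) (hor c) p = gam nabla' (hor a) (hor b) (hor c) p.
  pose D a b c := gam nabla (hor a) (hor b) (hor c) p - gam nabla' (hor a) (hor b) (hor c) p.
  suff : D a b c = 0 by move=> /eqP; rewrite subr_eq0 => /eqP.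
  apply: koszul_unique => {}a {}b {}c; rewrite /D.
    by rewrite (biquard_skew bq) (biquard_skew bq'); ring.
  have := biquard_torsion_hor bq a b c p; have := biquard_torsion_hor bq' a b c p; lra.
have vh s a b : gam nabla (vert s) (hor a) (hor b) p = gam nabla' (vert s) (hor a) (hor b) p.
  have := biquard_torsion_zero bq a b s p; have := biquard_torsion_zero bq' a b s p.
  rewrite (biquard_torsion_mixed bq) (biquard_torsion_mixed bq'); lra.
have split7 l : (exists a, l = hor a) \/ (exists s, l = vert s).
  move: l; apply: ix_ind.
  - by left; exists h1; rewrite horE.
  - by left; exists h2; rewrite horE.
  - by left; exists h3; rewrite horE.
  - by left; exists h4; rewrite horE.
  - by right; exists o1; rewrite vertE.
  - by right; exists o2; rewrite vertE.
  - by right; exists o3; rewrite vertE.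
have ih l a b : gam nabla l (hor a) (hor b) p = gam nabla' l (hor a) (hor b) p.
  by have [[c ->]|[s ->]] := split7 l; [exact: hh|exact: vh].
have [[a ->]|[s ->]] := split7 j; have [[b ->]|[t ->]] := split7 k.
- exact: ih.
- by rewrite (biquard_hor_vert bq) (biquard_hor_vert bq').
- by rewrite (biquard_vert_hor bq) (biquard_vert_hor bq').
- rewrite (biquard_vert bq) (biquard_vert bq') ih; congr (_ - _).
  have I1 l : gam nabla i (hor h1) l p = gam nabla' i (hor h1) l p.
    have [[b ->]|[u ->]] := split7 l; first exact: ih.
    by rewrite (biquard_hor_vert bq) (biquard_hor_vert bq').
  by congr (L1_I _ _ _); apply: boolp.funext => l.
Qed.

Lemma biquard_L1_coefficients nabla : is_biquard_connection q nabla ->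
  has_L1_coefficients e nabla.
Proof.
move=> bq A B SA SB k p; have [nL _] := bq.
rewrite (nabla_frame e_smooth E_smooth dual nL _ _ SA SB); congr (_ + _).
rewrite -(L1_conn_bilinear k); apply: eq_bigr => i _; apply: eq_bigr => j _.
congr (_ * _); have bq0 := L1_nabla_biquard e_smooth E_smooth dual L1_eqs.
rewrite (biquard_unique_christoffel i j k p bq bq0) /christoffel.
rewrite (L1_nabla_coefficients e_smooth dual (E_smooth i) (E_smooth j)) (lieder_form_frame dual).
by rewrite !(coord_frame dual) add0r.
Qed.

Lemma L1_conn_sub3 k (u v w y : 'I_7 -> R) :
  L1_conn k (fun i => u i - v i - w i) y = L1_conn k u y - L1_conn k v y - L1_conn k w y.
Proof. by move: k; apply: ix_ind; rewrite !L1_connE; ring. Qed.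

Lemma curv_coord nabla A B C k p : is_biquard_connection q nabla ->
  smooth_vf A -> smooth_vf B -> smooth_vf C ->
  let a := coord p (A p) in let b := coord p (B p) in let c := coord p (C p) in
  e k p (curv nabla A B C p) =
  L1_conn k a (fun j => L1_conn j b c) - L1_conn k b (fun j => L1_conn j a c) +
  L1_conn k (fun j => L1_d j a b) c.
Proof.
move=> bq SA SB SC a b c; have [nL _] := bq.
have cf := biquard_L1_coefficients bq.
have SL := lie_bracket_smooth SA SB.
have Sc i : smooth_fun_at (fun y => e i y (C y)) p by exact: form_smooth.
have half A' B' : smooth_vf A' -> smooth_vf B' ->
    e k p (nabla A' (nabla B' C) p) = lieder A' (lieder B' (fun y => e k y (C y))) p +
    (L1_conn k (fun i => lieder A' (fun y => coord y (B' y) i) p) c +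
     L1_conn k (coord p (B' p)) (fun i => lieder A' (fun y => coord y (C y) i) p)) +
    (L1_conn k (coord p (A' p)) (fun i => lieder B' (fun y => coord y (C y) i) p) +
     L1_conn k (coord p (A' p)) (fun j => L1_conn j (coord p (B' p)) c)).
  move=> SA' SB'; have SBC := nabla_smooth nL SB' SC.
  rewrite (cf _ _ SA' SBC).
  have -> : (fun y => e k y (nabla B' C y)) = (fun y => lieder B' (fun y => e k y (C y)) y +
      L1_conn k (coord y (B' y)) (coord y (C y))).
    by apply: boolp.funext => y; exact: cf.
  have SbC : smooth_fun_at (lieder B' (fun y => e k y (C y))) p by exact: lieder_smooth.
  have Sb i : smooth_fun_at (fun y => coord y (B' y) i) p by exact: coord_smooth.
  have Sc' i : smooth_fun_at (fun y => coord y (C y) i) p by exact: coord_smooth.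
  have Sconn : smooth_fun_at (fun y => L1_conn k (coord y (B' y)) (coord y (C y))) p.
    exact: (@L1_conn_smooth _ _ k (fun i y => coord y (B' y) i) (fun i y => coord y (C y) i)).
  rewrite [X in X + _]liederE (dfun_addf _ SbC Sconn).
  rewrite (@L1_conn_derivation _ _ k (fun i y => coord y (B' y) i) (fun i y => coord y (C y) i)) //.
  have -> : coord p (nabla B' C p) = (fun i => 1 * lieder B' (fun y => coord y (C y) i) p +
      L1_conn i (coord p (B' p)) c).
    by apply: boolp.funext => i; rewrite mul1r; exact: cf.
  by rewrite L1_conn_linearr mul1r -!liederE.
rewrite /curv !(formB e_smooth) (half _ _ SA SB) (half _ _ SB SA) (cf _ _ SL SC).
rewrite (lie_bracket_commutator SA SB (Sc k)).
have -> : coord p (lie_bracket A B p) = (fun i => lieder A (fun y => coord y (B y) i) p -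
    lieder B (fun y => coord y (A y) i) p - L1_d i a b).
  by apply: boolp.funext => i; exact: (bracket_coord L1_eqs).
rewrite L1_conn_sub3 -/a -/b -/c.
have collect (x1 x2 u1 u2 u3 u4 v1 v4 d : R) :
    x1 + (u1 + u2) + (u3 + u4) - (x2 + (v1 + u3) + (u2 + v4)) -
    (x1 - x2 + (u1 - v1 - d)) = u4 - v4 + d by ring.
exact: collect.
Qed.

Lemma L1_curvature nabla X Y Z W p : is_biquard_connection q nabla ->
  H_section q X -> H_section q Y -> H_section q Z -> H_section q W ->
  curv4 q nabla X Y Z W p =
  qg q p (X p) (Z p) * qg q p (Y p) (W p) - qg q p (Y p) (Z p) * qg q p (X p) (W p).
Proof.
move=> bq [SX hX] [SY hY] [SZ hZ] [SW hW].
rewrite -(L1_curvature_horizontal (hX p) (hY p) (hZ p) (hW p)) /curv4 /=.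
by apply: eq_bigr => k _; rewrite (curv_coord _ _ bq SX SY SZ).
Qed.

Lemma L1_scalar nabla : is_biquard_connection q nabla ->
  is_normalized_qc_scalar q nabla (fun _ => - 2^-1).
Proof.
move=> bq p x [Hx on].
have cE a b : curv4 q nabla (x b) (x a) (x a) (x b) p =
    (b == a)%:R * (a == b)%:R - (a == a)%:R * (b == b)%:R.
  by rewrite L1_curvature // !on.
by rewrite !sum4E !cE /=; field.
Qed.

(** The curvature on H is half of [g * g] (star product), and applying the [I_s] to
    the first two arguments gives half of the star squares of the fundamental
    forms; a quarter of the total cancels against the term in [S = - 1/2]. *)
Lemma L1_Wqc_zero nabla : is_biquard_connection q nabla -> qc_conformal_curvature_zero q nabla.
Proof.
move=> bq S HS X Y Z W HX HY HZ HW p.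
have S2 : S p = - 2^-1.
  have on : orthonormal_H q (fun a => E (hor a)) p.
    split=> [c|c d]; first exact: frame_horizontal.
    by rewrite (qg_frame dual) hor_eq.
  have := HS p _ on; rewrite -(L1_scalar bq on); lra.
have Tz := torsion_mixed_zero e_smooth dual L1_eqs (biquard_L1_coefficients bq).
have [_ HI _ _ _] := L1_is_hyperhermitian e_smooth E_smooth dual.
have T0z A B : H_section q A -> T0 q nabla A B p = 0.
  move=> HA; rewrite /T0; set t := \sum_s _; have -> : t = 0.
    by apply: big1 => s _; apply: Tz; [exact: frame_vertical|exact: HI].
  by rewrite /=; apply: big1 => i _; rewrite (form0 e_smooth) mul0r.
pose F s := fundamental_form q s p.
have cI s : curv4 q nabla (actI q s X) (actI q s Y) Z W p =
    F s (X p) (Z p) * F s (Y p) (W p) - F s (Y p) (Z p) * F s (X p) (W p).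
  by apply: (L1_curvature p bq _ _ HZ HW); exact: HI.
rewrite /Wqc (L1_curvature p bq HX HY HZ HW) S2 !sum3E !cI /star -/(F o1) -/(F o2) -/(F o3).
rewrite !(T0z _ _ HX) !T0z; try exact: HI.
by field.
Qed.

End L1_uniqueness.

(** * The quaternionic Heisenberg group *)

(** The horizontal 2-forms in coordinates: the cocycle that defines the central
    extension of R^4 by R^3. *)
Definition heis_b (R : realFieldType) (k : 'I_7) (x y : 'I_7 -> R) : R :=
  let w := wedge_coord x y in
  match val k with
  | 4 => w 1%N 2%N + w 3%N 4%N
  | 5 => w 1%N 3%N + w 4%N 2%N
  | 6 => w 1%N 4%N + w 2%N 3%N
  | _ => 0
  end.

Lemma heis_bE (R : realFieldType) (x y : 'I_7 -> R) : let w := wedge_coord x y in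
  (heis_b (ix 1) x y = 0) * (heis_b (ix 2) x y = 0) * (heis_b (ix 3) x y = 0) *
  (heis_b (ix 4) x y = 0) * (heis_b (ix 5) x y = w 1%N 2%N + w 3%N 4%N) *
  (heis_b (ix 6) x y = w 1%N 3%N + w 4%N 2%N) *
  (heis_b (ix 7) x y = w 1%N 4%N + w 2%N 3%N).
Proof. by []. Qed.

Lemma heis_b_bilinear (R : realFieldType) k (x y : 'I_7 -> R) :
  \sum_i \sum_j x i * y j * heis_b k (unit_coord R i) (unit_coord R j) = heis_b k x y.
Proof.
have linr u : \sum_j y j * heis_b k u (unit_coord R j) = heis_b k u y.
  by move: k; apply: ix_ind; rewrite !sum7E !heis_bE /wedge_coord /unit_coord ?ix_eq /=; ring.
have linl : \sum_i x i * heis_b k (unit_coord R i) y = heis_b k x y.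
  by move: k {linr}; apply: ix_ind; rewrite !sum7E !heis_bE /wedge_coord /unit_coord ?ix_eq /=; ring.
rewrite -linl; apply: eq_bigr => i _; rewrite -linr mulr_sumr.
by apply: eq_bigr => j _; rewrite mulrA.
Qed.

Lemma heis_b_linearr (R : realFieldType) k (a : R) x (y y' : 'I_7 -> R) :
  heis_b k x (fun i => a * y i + y' i) = a * heis_b k x y + heis_b k x y'.
Proof. by move: k; apply: ix_ind; rewrite !heis_bE /wedge_coord; ring. Qed.

Lemma heis_b_anti (R : realFieldType) k (x y : 'I_7 -> R) : heis_b k y x = - heis_b k x y.
Proof. by move: k; apply: ix_ind; rewrite !heis_bE /wedge_coord; ring. Qed.

(** Balls of radius [1 / (n + 1)] around rational points form a base. *)
Lemma second_countable_row (R : realType) n : @second_countable 'rV[R]_n.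
Proof.
pose b (z : 'rV[rat]_n * nat) : set 'rV[R]_n :=
  ball (map_mx (@ratr R) z.1) (z.2.+1%:R^-1).
exists (range b).
  by apply: (sub_countable (card_image_le b setT)); exact: countableP.
split=> [_ [z _ <-]|x U]; first exact: ball_open.
move=> /nbhs_ballP[r /= r0 rU].
have [N] := @ltr_add_invr R 0 (r / 2) (divr_gt0 r0 (ltr0Sn _ 1)).
rewrite add0r => Nr.
have N0 : 0 < N.+1%:R^-1 :> R by rewrite invr_gt0.
have /choice[z zP] : forall i, exists z : rat, `|x 0 i - ratr z| < N.+1%:R^-1 :> R.
  move=> i; have lt : x 0 i - N.+1%:R^-1 < x 0 i + N.+1%:R^-1 by rewrite ltrD2l gtrN.
  have [z] := rat_in_itvoo lt; rewrite in_itv /= => /andP[z1 z2]; exists z.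
  by rewrite ltr_distlC; apply/andP; split.
have xz : ball (map_mx (@ratr R) (\row_i z i)) (N.+1%:R^-1) x.
  split=> // i j; rewrite ord1 !mxE -ball_normE /= distrC; exact: zP.
exists (b (\row_i z i, N)); first by split=> //; exists (\row_i z i, N).
move=> y; rewrite /b /= => zy; apply: rU; rewrite [r]splitr.
apply: (@ball_triangle _ _ (map_mx (@ratr R) (\row_i z i))).
  by apply: (le_ball (ltW Nr)); exact: ball_sym.
by apply: (le_ball (ltW Nr)).
Qed.

Section heisenberg.
Variable R : realType.
Local Notation V := 'rV[R]_7.
Implicit Types (x y v w : V).

Definition rc x : 'I_7 -> R := fun i => x 0 i.

Lemma Coo_id_set (U : set V) : Coo U (fun x : V => x).
Proof. by apply: Coo_of_Coo_at => x _; exact: Coo_at_id. Qed.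

Lemma hm_chart_open (p : V) : open ((fun x : V => x) @` setT).
Proof. by rewrite image_id; exact: openT. Qed.

Definition heis_manifold : manifold7 R.
Proof.
refine (@Manifold7 R V (fun _ x => x) (fun _ x => x) (fun _ => setT)
  (@norm_hausdorff _ _) (@second_countable_row R 7) (fun _ => openT)
  (fun _ => I) hm_chart_open (fun _ _ _ => erefl) _ _ _).
- by move=> p q _; exact: cvg_id.
- by move=> p x _; exact: cvg_id.
- by move=> p q; exact: Coo_id_set.
Defined.

Definition heis_mul x y : V := \row_k (x 0 k + y 0 k - heis_b k (rc x) (rc y)).
Definition heis_inv x : V := - x.

Lemma heis_mulA : associative heis_mul.
Proof.
move=> x y z; apply/rowP; apply: ix_ind;
  by rewrite /heis_mul !mxE !heis_bE /wedge_coord /rc ?mxE ?heis_bE; ring.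
Qed.

Lemma heis_mul1 : left_id 0 heis_mul.
Proof.
move=> x; apply/rowP; apply: ix_ind;
  by rewrite /heis_mul /heis_inv !mxE !heis_bE /wedge_coord /rc ?mxE; ring.
Qed.

Lemma heis_mulV : left_inverse 0 heis_inv heis_mul.
Proof.
move=> x; apply/rowP; apply: ix_ind;
  by rewrite /heis_mul /heis_inv !mxE !heis_bE /wedge_coord /rc ?mxE; ring.
Qed.

Lemma heis_b_Coo (W : normedModType R) k (f g : W -> V) (z : W) : Coo_at f z -> Coo_at g z ->
  Coo_at (fun y : W => heis_b k (rc (f y)) (rc (g y))) z.
Proof.
move=> /Coo_at_rowP Cf /Coo_at_rowP Cg.
have -> : (fun y : W => heis_b k (rc (f y)) (rc (g y))) = (fun y : W =>
  \sum_i \sum_j f y 0 i * g y 0 j * heis_b k (unit_coord R i) (unit_coord R j)).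
  by apply: boolp.funext => y; rewrite -heis_b_bilinear.
apply: Coo_at_sum => i _; apply: Coo_at_sum => j _; apply: Coo_atM; last exact: Coo_at_cst.
by apply: Coo_atM; [exact: Cf|exact: Cg].
Qed.

Lemma heis_mul_Coo (W : normedModType R) (f g : W -> V) (z : W) : Coo_at f z -> Coo_at g z ->
  Coo_at (fun y : W => heis_mul (f y) (g y)) z.
Proof.
move=> Cf Cg; apply/Coo_at_rowP => k.
have Cfk := (Coo_at_rowP _ _).1 Cf k; have Cgk := (Coo_at_rowP _ _).1 Cg k.
have := Coo_atB (Coo_atD Cfk Cgk) (heis_b_Coo k Cf Cg).
by apply: Coo_at_eq; near=> y; rewrite mxE.
Unshelve. all: by end_near. Qed.

Lemma Coo_at_fst (z : V * V) : Coo_at (fun z : V * V => z.1) z.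
Proof.
have lf : linear (fun z : V * V => z.1) by [].
pose L : {linear (V * V)%type -> V} := HB.pack (fun z : V * V => z.1) (GRing.isLinear.Build _ _ _ _ _ lf).
exact: (@Coo_at_linear _ _ _ L z (fun z => cvg_fst)).
Qed.

Lemma Coo_at_snd (z : V * V) : Coo_at (fun z : V * V => z.2) z.
Proof.
have lf : linear (fun z : V * V => z.2) by [].
pose L : {linear (V * V)%type -> V} := HB.pack (fun z : V * V => z.2) (GRing.isLinear.Build _ _ _ _ _ lf).
exact: (@Coo_at_linear _ _ _ L z (fun z => cvg_snd)).
Qed.

Lemma heis_mul_smooth (z : V * V) : Coo_at (fun z : V * V => heis_mul z.1 z.2) z.
Proof. by apply: heis_mul_Coo; [exact: Coo_at_fst|exact: Coo_at_snd]. Qed.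

Lemma heis_inv_smooth (p : heis_manifold) : @smooth_map_at R heis_manifold heis_manifold heis_inv p.
Proof.
have CI : Coo_at heis_inv (p : V) by apply: Coo_atN; exact: Coo_at_id.
by split; [exact: (Coo_at_continuous CI)|exact: CI].
Qed.

Definition heis_group : lieGroup7 R.
Proof.
refine (@LieGroup7 R heis_manifold heis_mul heis_inv 0 heis_mulA heis_mul1 heis_mulV _ _ heis_inv_smooth).
- by move=> z; exact: (Coo_at_continuous (heis_mul_smooth z)).
- by move=> p q; exact: heis_mul_smooth.
Defined.

End heisenberg.

(** * Left invariant forms on the Heisenberg group *)

Section heisenberg_forms.
Variable R : realType.
Local Notation V := 'rV[R]_7.
Local Notation N := (heis_group R).

(** The underlying space is a vector space, contracted along segments. *)
Lemma heis_simply_connected : simply_connected N.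
Proof.
split=> [x y|c /subspace_continuousP cc c01].
  exists (fun t : R => (x : V) + t *: ((y : V) - (x : V)) : N); split.
  - apply: continuous_subspaceT => t; apply: (@cvgD _ V); first exact: cvg_cst.
    by apply: cvgZr_tmp; exact: cvg_id.
  - by rewrite scale0r addr0.
  - by rewrite scale1r addrC subrK.
exists (fun z : R * R => (c 0 : V) + (1 - z.1) *: ((c z.2 : V) - (c 0 : V)) : N).
split.
- apply/subspace_continuousP => -[s t] [/= s01 t01].
  have ct : c z.2 @[z --> within (`[0, 1] `*` `[0, 1]) (nbhs (s, t))] --> c t.
    apply: cvg_trans (cc t t01) => P /= cP; rewrite /nbhs /=.
    exists (setT, [set u | `[0, 1]%classic u -> P (c u)]) => /=.
      by split=> //; exact: filterT.
    by move=> z [/= _ zP] [/= _]; exact: zP.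
  have cs : (1 - z.1) @[z --> within (`[0, 1] `*` `[0, 1]) (nbhs (s, t))] --> 1 - s.
    apply: cvg_within_filter; apply: cvgB; [exact: cvg_cst|exact: cvg_fst].
  apply: (@cvgD _ V); first exact: cvg_cst.
  apply: (@cvgZ _ V _ _ _ _ _ _ _ cs); apply: (@cvgB _ V); [exact: ct|exact: cvg_cst].
- by move=> t _ /=; rewrite subr0 scale1r addrC subrK.
- by move=> t _ /=; rewrite subrr scale0r addr0.
- by move=> s _ /=; rewrite -c01 subrr scaler0 addr0.
Qed.

(** The forms [dx_k] and [dz_s + b_s(x, dx)], which left translations
    [y |-> g + y - b(g, y)] preserve. *)
Definition heis_form (k : 'I_7) : form1 N :=
  fun p v => v 0 k + heis_b k (rc (p : V)) (rc v).

Definition heis_field (j : 'I_7) : vfield N :=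
  fun p => \row_k ((k == j)%:R - heis_b k (rc (p : V)) (unit_coord R j)).

Lemma tangent_heis_mul (g p : N) (v : V) :
  tangent_map (lg_mul g) p v = \row_k (v 0 k - heis_b k (rc (g : V)) (rc v)).
Proof.
have lf : linear (fun v : V => \row_k (v 0 k - heis_b k (rc (g : V)) (rc v))).
  move=> a x y; apply/rowP => k; rewrite !mxE.
  have -> : rc (a *: x + y) = fun i => a * rc x i + rc y i.
    by apply: boolp.funext => i; rewrite /rc !mxE.
  by rewrite heis_b_linearr; ring.
pose L : {linear V -> V} := HB.pack
  (fun v : V => \row_k (v 0 k - heis_b k (rc (g : V)) (rc v))) (GRing.isLinear.Build _ _ _ _ _ lf).
have LE x : L x = \row_k (x 0 k - heis_b k (rc (g : V)) (rc x)) by [].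
rewrite -LE /tangent_map /=.
have Lc : continuous L by exact: row_linear_continuous.
have -> : (@id V) \o heis_mul g \o (@id V) = fun x : V => (g : V) + L x.
  by apply: boolp.funext => x; apply/rowP => k; rewrite /heis_mul LE !mxE addrA.
have [|_ ->] // := @differentiable_of_expansion R V V (fun x => (g : V) + L x) L p Lc.
by move=> eps e0; near=> u; rewrite linearD [L u + _]addrC addrA subrr normr0 mulr_ge0 // ltW.
Unshelve. all: by end_near. Qed.

Lemma heis_lieder_coord (A : vfield N) (p q : N) i : lieder A (coordfun p i) q = A q 0 i.
Proof. exact: (dfun_coordfun q (A q) i). Qed.

Lemma heis_component_smooth (A : vfield N) p i : smooth_vf A -> smooth_fun_at (fun q => A q 0 i) p.
Proof.
move=> /(_ p i).
by have -> : lieder A (coordfun p i) = (fun q => A q 0 i) by apply: boolp.funext => q; exact: heis_lieder_coord.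
Qed.

Lemma heis_coord_smooth (p : N) i : smooth_fun_at (fun q : N => (q : V) 0 i) p.
Proof. exact: (smooth_coordfun i (cdom_center p)). Qed.

Lemma heis_b_unit k (x : 'I_7 -> R) j :
  heis_b k x (fun i => (i == j)%:R - heis_b i x (unit_coord R j)) = heis_b k x (unit_coord R j).
Proof. by move: k; apply: ix_ind; rewrite !heis_bE /wedge_coord ?heis_bE /unit_coord; ring. Qed.

Lemma heis_dual_frames : left_invariant_dual_frames heis_form heis_field.
Proof.
split.
- move=> k; split; first split.
  + move=> p a x y; rewrite /heis_form !mxE.
    have -> : rc (a *: x + y) = fun i => a * rc x i + rc y i.
      by apply: boolp.funext => i; rewrite /rc !mxE.
    by rewrite heis_b_linearr /GRing.scale /=; ring.
  + move=> A SA p; apply: smoothD; first exact: heis_component_smooth.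
    apply: (@bilinear_smooth _ N _ (@heis_b_bilinear R k) (fun i q => (q : V) 0 i) (fun i q => A q 0 i)) => i.
      exact: heis_coord_smooth.
    exact: heis_component_smooth.
  + move=> g p v; rewrite tangent_heis_mul /heis_form mxE /=.
    by move: k; apply: ix_ind; rewrite !heis_bE /wedge_coord /rc /heis_mul ?mxE ?heis_bE; ring.
- move=> j; split.
  + move=> p i.
    have -> : lieder (heis_field j) (coordfun p i) =
      (fun q : N => (i == j)%:R - heis_b i (rc (q : V)) (unit_coord R j)).
      by apply: boolp.funext => q; rewrite heis_lieder_coord mxE.
    apply: smoothB; first exact: smooth_cst.
    apply: (@bilinear_smooth _ N _ (@heis_b_bilinear R i) (fun i q => (q : V) 0 i) (fun i q => unit_coord R j i)) => k.
      exact: heis_coord_smooth.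
    exact: smooth_cst.
  + move=> g p; rewrite tangent_heis_mul; apply/rowP => k; rewrite !mxE.
    have -> : rc (heis_field j p) = fun i => (i == j)%:R - heis_b i (rc (p : V)) (unit_coord R j).
      by apply: boolp.funext => i; rewrite /rc mxE.
    by move: k; apply: ix_ind; rewrite !heis_bE /wedge_coord /rc /= /heis_mul ?mxE ?heis_bE; ring.
- move=> k j p; rewrite /heis_form mxE.
  have -> : rc (heis_field j p) = fun i => (i == j)%:R - heis_b i (rc (p : V)) (unit_coord R j).
    by apply: boolp.funext => i; rewrite /rc mxE.
  by rewrite heis_b_unit subrK.
Qed.

(** Differentiating [b(x, dx)] gives [b(dx, dx)], and the skew-symmetry of [b]
    doubles it. *)
Lemma heis_d k : d_eq (heis_form k) (fun p v w => 2 * heis_b k (rc v) (rc w)).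
Proof.
move=> A B SA SB p; rewrite /dform /heis_form.
have D (C C' : vfield N) : smooth_vf C -> smooth_vf C' ->
  lieder C (fun q : N => C' q 0 k + heis_b k (rc (q : V)) (rc (C' q))) p =
  lieder C (fun q => C' q 0 k) p + (heis_b k (rc (C p)) (rc (C' p)) +
    heis_b k (rc (p : V)) (fun i => lieder C (fun q => C' q 0 i) p)).
  move=> SC SC'; rewrite liederE dfun_addf; first last.
  - apply: (@bilinear_smooth _ N _ (@heis_b_bilinear R k) (fun i q => (q : V) 0 i) (fun i q => C' q 0 i)) => i.
      exact: heis_coord_smooth.
    exact: heis_component_smooth.
  - exact: heis_component_smooth.
  congr (_ + _).
  rewrite (@bilinear_derivation _ N _ (@heis_b_bilinear R k) (fun i q => (q : V) 0 i) (fun i q => C' q 0 i)); first last.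
  - by move=> i; exact: heis_component_smooth.
  - by move=> i; exact: heis_coord_smooth.
  congr (heis_b k _ _ + _); apply: boolp.funext => i.
  exact: (dfun_coordfun p (C p) i).
rewrite !D //.
have br i : lie_bracket A B p 0 i = lieder A (fun q => B q 0 i) p - lieder B (fun q => A q 0 i) p.
  by rewrite mxE; congr (_ - _); apply: lieder_eq; near=> q; rewrite heis_lieder_coord.
have -> : rc (lie_bracket A B p) = fun i => - 1 * lieder B (fun q => A q 0 i) p + lieder A (fun q => B q 0 i) p.
  by apply: boolp.funext => i; rewrite /rc br; ring.
by rewrite heis_b_linearr br (heis_b_anti k (rc (B p))); ring.
Unshelve. all: by end_near. Qed.

Lemma heis_is_quaternionic_heisenberg : is_quaternionic_heisenberg heis_form.
Proof.
have cc p v j : frame_coord heis_form p v j = heis_form j p v by [].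
have b0 (a : 'I_4) x y : heis_b (hor a) x y = 0 :> R.
  by case: (ord4E a) => ->; rewrite horE heis_bE.
split; first exact: heis_simply_connected.
- by exists heis_field; exact: heis_dual_frames.
- move=> a A B SA SB p; rewrite heis_d // b0 mulr0 //.
move=> s A B SA SB p; rewrite heis_d //; congr (2 * _).
have f0 (a : 'I_4) v : heis_form (hor a) p v = v 0 (hor a).
  by rewrite /heis_form b0 addr0.
move: (f0 h1) (f0 h2) (f0 h3) (f0 h4); rewrite !horE => f1 f2 f3 f4.
by case: (ord3E s) => ->; rewrite vertE heis_bE /omega /wedge_coord /wedge /= !f1 ?f2 ?f3 ?f4.
Qed.

End heisenberg_forms.

(** * Right invariant fields on a Lie group *)

Section right_invariant_fields.
Variables (R : realType) (G : lieGroup7 R).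
Local Notation V := 'rV[R]_7.
Local Notation one := (lg_one G).
Local Notation mul := (@lg_mul R G).
Implicit Types (g p q : G) (f : G -> R).

Lemma lg_mulVr g : mul g (lg_inv g) = one.
Proof.
rewrite -[LHS]lg_mul1 -{1}(lg_mulV (lg_inv g)) -lg_mulA (lg_mulA (lg_inv g)).
by rewrite lg_mulV lg_mul1 lg_mulV.
Qed.

Lemma lg_mulr1 g : mul g one = g.
Proof. by rewrite -(lg_mulV g) lg_mulA lg_mulVr lg_mul1. Qed.

Lemma mul_cvg g p : mul z.1 z.2 @[z --> (g, p)] --> mul g p.
Proof. exact: (@lg_mul_continuous R G (g, p)). Qed.

Lemma mul_cinv_cvg g p :
  mul (cinv g z.1) (cinv p z.2) @[z --> (chart g g, chart p p)] --> mul g p.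
Proof.
apply: (@cvg_comp _ _ _ (fun z : V * V => (cinv g z.1, cinv p z.2)) (fun z => mul z.1 z.2));
  last exact: mul_cvg.
apply: cvg_pair => /=.
  by apply: (cvg_comp _ _ (@cvg_fst _ _ _ _ _)); exact: (cinv_cvg (cdom_center g)).
by apply: (cvg_comp _ _ (@cvg_snd _ _ _ _ _)); exact: (cinv_cvg (cdom_center p)).
Qed.

Lemma mul_chart_Coo f g p : smooth_fun_at f (mul g p) ->
  Coo_at (fun z : V * V => f (mul (cinv g z.1) (cinv p z.2))) (chart g g, chart p p).
Proof.
move=> Sf; have H := lg_mul_smooth g p.
have Sf' : Coo_at (f \o cinv (mul g p)) (chart (mul g p)
   (mul (cinv g (chart g g, chart p p).1) (cinv p (chart g g, chart p p).2))).
  by rewrite /= !cinv_center.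
apply: Coo_at_eq (Coo_at_comp H Sf').
have D : \forall z \near (chart g g, chart p p),
    cdom (mul g p) (mul (cinv g z.1) (cinv p z.2)).
  exact: mul_cinv_cvg (near_cdom (cdom_center (mul g p))).
by move: D; apply: filterS => z zd; rewrite /= cinv_chart.
Qed.

Lemma left_translation_smooth g p : smooth_map_at (mul g) p.
Proof.
split.
  apply: (@cvg_comp _ _ _ (fun q => (g, q)) (fun z => mul z.1 z.2)); last exact: mul_cvg.
  by apply: cvg_pair; [exact: cvg_cst|exact: cvg_id].
have := Coo_at_pairr (lg_mul_smooth g p).
by apply: Coo_at_eq; near=> y; rewrite /= cinv_center.
Unshelve. all: by end_near. Qed.

(** The infinitesimal generator of left translations by a curve through the unit
    with velocity [w]: it commutes with every left invariant field because left
    and right translations commute. *)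
Definition right_field (w : V) : vfield G := fun g =>
  'D_w (fun x => chart g (mul (cinv one x) g)) (chart one one).

Lemma right_orbit_Coo f g : smooth_fun_at f g ->
  Coo_at (fun x => f (mul (cinv one x) g)) (chart one one).
Proof.
rewrite -{1}[g]lg_mul1 => /mul_chart_Coo /Coo_at_pairl.
by apply: Coo_at_eq; near=> x; rewrite /= cinv_center.
Unshelve. all: by end_near. Qed.

Lemma right_orbit_cvg g : mul (cinv one x) g @[x --> chart one one] --> g.
Proof.
have C : mul q g @[q --> one] --> mul one g.
  apply: (@cvg_comp _ _ _ (fun q => (q, g)) (fun z => mul z.1 z.2)); last exact: mul_cvg.
  by apply: cvg_pair; [exact: cvg_id|exact: cvg_cst].
rewrite lg_mul1 in C; exact: cvg_comp (cinv_cvg (cdom_center one)) C.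
Qed.

Lemma dfun_right_field w f g : smooth_fun_at f g ->
  dfun f g (right_field w g) = 'D_w (fun x => f (mul (cinv one x) g)) (chart one one).
Proof.
move=> Sf; pose F x := chart g (mul (cinv one x) g).
have CF : Coo_at F (chart one one).
  by apply/Coo_at_rowP => i; exact: (right_orbit_Coo (smooth_coordfun i (cdom_center g))).
have F1 : F (chart one one) = chart g g by rewrite /F cinv_center lg_mul1.
have Sf' : differentiable (f \o cinv g) (F (chart one one)).
  by rewrite F1; exact: (Coo_at_differentiable Sf).
have := derive_chain w (Coo_at_differentiable CF) Sf'.
rewrite F1 => D1; rewrite -[LHS]/('D_('D_w F (chart one one)) (f \o cinv g) (chart g g)) -D1.
apply: near_eq_derive.
have D : \forall x \near chart one one, cdom g (mul (cinv one x) g).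
  exact: right_orbit_cvg (near_cdom (cdom_center g)).
by move: D; apply: filterS => x xd; rewrite /= /F cinv_chart.
Qed.

Lemma right_field_unit w : right_field w one = w.
Proof.
rewrite /right_field; have -> : (fun x => chart one (mul (cinv one x) one)) = chart one \o cinv one.
  by apply: boolp.funext => x; rewrite /= lg_mulr1.
have D := Coo_at_differentiable (transition_Coo_at (cdom_center one) (cdom_center one)).
by apply/rowP => i; rewrite (derive_coord _ _ D); exact: (dfun_coordfun one w i).
Qed.

Section commutation.
Variables (w : V) (f : G -> R) (p : G).
Hypothesis Sf : smooth_fun_at f p.
Let F (z : V * V) : R := f (mul (cinv one z.1) (cinv p z.2)).

Let F_Coo : Coo_at F (chart one one, chart p p).
Proof. by apply: mul_chart_Coo; rewrite lg_mul1. Qed.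

Let right_derivative_near :
  \forall y \near chart p p, (lieder (right_field w) f \o cinv p) y = 'D_(w, 0) F (chart one one, y).
Proof.
have := near_cinv (cdom_center p) (smooth_fun_at_near Sf).
apply: filterS => y Sy; rewrite /= liederE (dfun_right_field w Sy).
exact: (derive_pairl F).
Qed.

Lemma right_field_smooth_at : smooth_fun_at (lieder (right_field w) f) p.
Proof.
apply: Coo_at_eq (Coo_at_pairr (Coo_at_derive (w, 0) F_Coo)).
by apply: filterS right_derivative_near => y ->.
Qed.

(** Both sides are mixed derivatives at [(1, p)] of the function [f (x y)]: left
    invariance makes [E] act on [y], the right invariant field acts on [x]. *)
Lemma right_field_commutes (E : vfield G) : left_invariant_vf E -> smooth_vf E ->
  lieder E (lieder (right_field w) f) p = lieder (right_field w) (lieder E f) p.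
Proof.
move=> LE SE.
have -> : lieder E (lieder (right_field w) f) p =
   'D_(0, E p) ('D_(w, 0) F) (chart one one, chart p p).
  by rewrite -derive_pairr; exact: near_eq_derive right_derivative_near.
rewrite liederE (dfun_right_field w (lieder_smooth SE Sf)).
rewrite (Coo_at_schwarz _ _ F_Coo) -derive_pairl; apply: near_eq_derive.
have D : \forall x \near chart one one, smooth_fun_at f (mul (cinv one x) p).
  exact: right_orbit_cvg (smooth_fun_at_near Sf).
move: D; apply: filterS => x Sx.
rewrite liederE LE -(dfun_chain _ (left_translation_smooth _ _) Sx).2.
by rewrite -derive_pairr.
Qed.

End commutation.

Lemma right_field_smooth w : smooth_vf (right_field w).
Proof.
by move=> p i; apply: right_field_smooth_at; exact: (smooth_coordfun i (cdom_center p)).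
Qed.

Lemma right_field_bracket w E p : left_invariant_vf E -> smooth_vf E ->
  lie_bracket E (right_field w) p = 0.
Proof.
move=> LE SE; apply/rowP => i; rewrite !mxE (right_field_commutes _ _ LE SE) ?subrr //.
exact: (smooth_coordfun i (cdom_center p)).
Qed.

End right_invariant_fields.

(** * Differentiating and integrating functions on a manifold *)

Section differentiation.
Variables (R : realType) (M : manifold7 R).
Implicit Types (f g : M -> R) (p : M) (v : tvec R).

(** A relational form of differentiation: derivatives of an expression are
    assembled along its syntax, and implicit differentiation is uniqueness. *)
Definition has_deriv f p v (a : R) := smooth_fun_at f p /\ dfun f p v = a.

Lemma has_deriv_eq f p v a b : a = b -> has_deriv f p v a -> has_deriv f p v b.
Proof. by move=> ->. Qed.

Lemma has_deriv_near f g p v a : (\forall q \near p, f q = g q) ->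
  has_deriv f p v a -> has_deriv g p v a.
Proof.
move=> fg [Sf <-]; split; first exact: smooth_fun_at_eq Sf.
by rewrite (dfun_eq v fg).
Qed.

Lemma has_deriv_unique f p v a b : has_deriv f p v a -> has_deriv f p v b -> a = b.
Proof. by move=> [_ <-] [_ <-]. Qed.

Lemma has_deriv_cst (c : R) p v : has_deriv (fun=> c) p v 0.
Proof. by split; [exact: smooth_cst|exact: dfun_cst]. Qed.

Lemma has_derivD f g p v a b : has_deriv f p v a -> has_deriv g p v b ->
  has_deriv (fun q => f q + g q) p v (a + b).
Proof. by move=> [Sf <-] [Sg <-]; split; [exact: smoothD|exact: dfun_addf]. Qed.

Lemma has_derivB f g p v a b : has_deriv f p v a -> has_deriv g p v b ->
  has_deriv (fun q => f q - g q) p v (a - b).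
Proof. by move=> [Sf <-] [Sg <-]; split; [exact: smoothB|exact: dfun_subf]. Qed.

Lemma has_derivM f g p v a b : has_deriv f p v a -> has_deriv g p v b ->
  has_deriv (fun q => f q * g q) p v (f p * b + g p * a).
Proof. by move=> [Sf <-] [Sg <-]; split; [exact: smoothM|exact: dfun_mulf]. Qed.

Lemma has_derivZ (c : R) f p v a : has_deriv f p v a -> has_deriv (fun q => c * f q) p v (c * a).
Proof. by move=> [Sf <-]; split; [exact: smooth_cstM|exact: dfun_cstM]. Qed.

Lemma has_deriv_sum (n : nat) (f : 'I_n -> M -> R) p v (a : 'I_n -> R) :
  (forall i, has_deriv (f i) p v (a i)) ->
  has_deriv (fun q => \sum_i f i q) p v (\sum_i a i).
Proof.
move=> fa; split; first by apply: smooth_sum => i _; exact: (fa i).1.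
rewrite dfun_sumf => [|i _]; last exact: (fa i).1.
by apply: eq_bigr => i _; exact: (fa i).2.
Qed.

Lemma has_deriv_dfun f p v : smooth_fun_at f p -> has_deriv f p v (dfun f p v).
Proof. by []. Qed.

Lemma chart_Coo_cvg (W : normedModType R) (h : M -> W) p :
  Coo_at (h \o cinv p) (chart p p) -> h q @[q --> p] --> h p.
Proof.
move=> Sf; have C := Coo_at_continuous Sf.
have D := chart_continuous (cdom_center p).
have E : h q @[q --> p] `=>` (h \o cinv p) (chart p q) @[q --> p].
  move=> P; rewrite /= /nbhs /= => H.
  by apply: filterS2 (near_cdom (cdom_center p)) H => q qp; rewrite /= cinv_chart.
apply: cvg_trans E _; rewrite -[X in h X](cinv_center p).
exact: cvg_comp D C.
Qed.

Lemma smooth_cvg f p : smooth_fun_at f p -> f q @[q --> p] --> f p.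
Proof. exact: chart_Coo_cvg. Qed.

Lemma smooth_near_gt0 f p : smooth_fun_at f p -> 0 < f p -> \forall q \near p, 0 < f q.
Proof. by move=> /smooth_cvg C f0; exact: cvgr_gt C _ f0. Qed.

(** In a chart the function has zero derivative on a ball. *)
Lemma locally_constant f p : smooth_fun_at f p ->
  (\forall q \near p, forall v, dfun f q v = 0) -> \forall q \near p, f q = f p.
Proof.
move=> Sf D0.
have H : \forall q \near p, [/\ cdom p q, smooth_fun_at f q & forall v, dfun f q v = 0].
  by apply: filterS3 (near_cdom (cdom_center p)) (smooth_fun_at_near Sf) D0.
have H' : \forall y \near chart p p, Coo_at (f \o cinv p) y /\ forall v, 'D_v (f \o cinv p) y = 0.
  apply: filterS2 (near_cinv (cdom_center p) H) (near_chart_cinv (cdom_center p)).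
  move=> y [yd Sy y0] yE; rewrite -yE; split; first exact: (smooth_fun_atP f yd).1 Sy.
  move=> v; set q := cinv p y in yd Sy y0 *.
  have T := transition_Coo_at yd (cdom_center q).
  have Sq : differentiable (f \o cinv q) ((chart q \o cinv p) (chart p q)).
    by rewrite /= cinv_chart //; exact: (Coo_at_differentiable Sy).
  have := derive_chain v (Coo_at_differentiable T) Sq.
  rewrite /= cinv_chart // => DC.
  rewrite -(near_eq_derive _ (near_change_chart f (cdom_center q) yd)) DC.
  exact: y0.
have [r r0 rH] := (nbhs_ballP _ _).1 H'.
have cst y : ball (chart p p) r y -> (f \o cinv p) y = (f \o cinv p) (chart p p).
  apply: derive0_constant_ball.
    by move=> z /rH [/Coo_at_differentiable].
  by move=> z v /rH [_].
have nb : \forall y \near chart p p, ball (chart p p) r y by exact: nbhsx_ballx.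
apply: filterS2 (near_cdom (cdom_center p)) (near_chart (cdom_center p) nb).
by move=> q qp /cst; rewrite /= cinv_chart // cinv_center.
Qed.

End differentiation.

(** * Rotations and unit quaternions *)

Section rotations.
Variable R : realFieldType.
Implicit Types (x y z : 'I_3 -> R) (O : 'I_3 -> 'I_3 -> R).

Definition dot x y : R := \sum_k x k * y k.

Definition cross x y (k : 'I_3) : R :=
  match val k with
  | 0 => x o2 * y o3 - x o3 * y o2
  | 1 => x o3 * y o1 - x o1 * y o3
  | _ => x o1 * y o2 - x o2 * y o1
  end.

Lemma crossE x y : (cross x y o1 = x o2 * y o3 - x o3 * y o2) *
  (cross x y o2 = x o3 * y o1 - x o1 * y o3) * (cross x y o3 = x o1 * y o2 - x o2 * y o1).
Proof. by []. Qed.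

Lemma ord3_ind (P : 'I_3 -> Prop) : P o1 -> P o2 -> P o3 -> forall k, P k.
Proof. by move=> P1 P2 P3 k; case: (ord3E k) => ->. Qed.

Lemma det3E O : \det (\matrix_(i, j) O i j) = dot (O o1) (cross (O o2) (O o3)).
Proof.
(* Reading the entries at natural numbers lets the minors' indices compute. *)
pose B (i j : nat) := O (inord i) (inord j).
have OB i j : O i j = B (val i) (val j) by rewrite /B !inord_val.
rewrite (expand_det_row _ o1) sum3E /cofactor !(expand_det_row _ ord0) !big_ord_recl !big_ord0.
rewrite /cofactor !det_mx11 !mxE /dot sum3E !crossE !OB /=.
by rewrite /bump /= !(addn0, add0n) /= !exprS !expr0; ring.
Qed.

Section special_orthogonal.
Variable O : 'I_3 -> 'I_3 -> R.
Hypothesis rows : forall i j, dot (O i) (O j) = (i == j)%:R.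
Hypothesis det1 : dot (O o1) (cross (O o2) (O o3)) = 1.

(** When [x], [y], [z] are unit vectors, [y] and [z] are orthogonal and the
    determinant is 1, the vector [x - y x z] has square norm 0. *)
Lemma rotation_cross :
  [/\ cross (O o2) (O o3) = O o1, cross (O o3) (O o1) = O o2 & cross (O o1) (O o2) = O o3].
Proof.
have key x y z : dot x x = 1 -> dot y y = 1 -> dot z z = 1 -> dot y z = 0 ->
    dot x (cross y z) = 1 -> cross y z = x.
  move=> xx yy zz yz; rewrite /dot sum3E => xyz.
  have : dot (fun k => x k - cross y z k) (fun k => x k - cross y z k) = 0.
    have -> : dot (fun k => x k - cross y z k) (fun k => x k - cross y z k) =
      dot x x + (dot y y * dot z z - dot y z ^+ 2) - 2 * (x o1 * cross y z o1 + x o2 * cross y z o2 + x o3 * cross y z o3).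
      by rewrite /dot !sum3E !crossE; ring.
    by rewrite xx yy zz yz xyz; ring.
  rewrite /dot sum3E => /eqP.
  rewrite !paddr_eq0 ?addr_ge0 ?sqr_ge0 -?expr2 ?sqr_ge0 // !sqrf_eq0 !subr_eq0.
  move=> /andP[/andP[/eqP e1 /eqP e2] /eqP e3].
  by apply: boolp.funext; apply: ord3_ind.
have r i : dot (O i) (O i) = 1 by rewrite rows eqxx.
split; apply: key => //; try exact: rows; rewrite -det1 /dot !sum3E !crossE; ring.
Qed.

Lemma rotation_columns i j : dot (O ^~ i) (O ^~ j) = (i == j)%:R.
Proof.
have /mulmx1C : (\matrix_(i, j) O i j) *m (\matrix_(i, j) O i j)^T = 1%:M.
  by apply/matrixP => a b; rewrite !mxE -rows; apply: eq_bigr => k _; rewrite !mxE.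
by move=> /matrixP /(_ i j); rewrite !mxE => <-; apply: eq_bigr => k _; rewrite !mxE.
Qed.

Variables u0 u1 u2 u3 : R.
Hypothesis u0_gt0 : 0 < u0.
Hypothesis trace : 4 * (u0 * u0) = 1 + O o1 o1 + O o2 o2 + O o3 o3.
Hypothesis axis1 : 4 * (u0 * u1) = O o3 o2 - O o2 o3.
Hypothesis axis2 : 4 * (u0 * u2) = O o1 o3 - O o3 o1.
Hypothesis axis3 : 4 * (u0 * u3) = O o2 o1 - O o1 o2.

(** The quaternion of a rotation that is not a half-turn: its real part comes from
    the trace and its imaginary part from the skew part of the matrix. The
    other products of components follow from orthogonality and from the
    cofactor identities, after multiplication by [4 u0^2 = 1 + trace]. *)
Lemma rotation_quaternion :
  (u0 * u0 + u1 * u1 + u2 * u2 + u3 * u3 = 1) *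
  ((O o1 o1 = u0 * u0 + u1 * u1 - u2 * u2 - u3 * u3) *
   (O o2 o2 = u0 * u0 - u1 * u1 + u2 * u2 - u3 * u3) *
   (O o3 o3 = u0 * u0 - u1 * u1 - u2 * u2 + u3 * u3)) *
  ((O o1 o2 = 2 * (u1 * u2 - u0 * u3)) * (O o2 o1 = 2 * (u1 * u2 + u0 * u3)) *
   (O o1 o3 = 2 * (u1 * u3 + u0 * u2)) * (O o3 o1 = 2 * (u1 * u3 - u0 * u2)) *
   (O o2 o3 = 2 * (u2 * u3 - u0 * u1)) * (O o3 o2 = 2 * (u2 * u3 + u0 * u1))).
Proof.
have [x1 x2 x3] := rotation_cross.
have E x y k : x = y -> x k = y k :> R by move=> ->.
move: (E _ _ o1 x1) (E _ _ o2 x1) (E _ _ o3 x1) (E _ _ o1 x2) (E _ _ o2 x2) (E _ _ o3 x2).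
move: (E _ _ o1 x3) (E _ _ o2 x3) (E _ _ o3 x3); rewrite !crossE => c31 c32 c33 c11 c12 c13 c21 c22 c23.
move: (rows o1 o1) (rows o2 o2) (rows o3 o3) (rows o1 o2) (rows o1 o3) (rows o2 o3).
rewrite /dot !sum3E /= => r11 r22 r33 r12 r13 r23.
move: (rotation_columns o1 o1) (rotation_columns o2 o2) (rotation_columns o3 o3).
move: (rotation_columns o1 o2) (rotation_columns o1 o3) (rotation_columns o2 o3).
rewrite /dot !sum3E /= => k12 k13 k23 k11 k22 k33.
have c0 : 4 * (u0 * u0) != 0 by rewrite !mulf_neq0 ?pnatr_eq0 // gt_eqF.
(* Each quadratic identity is linear in the relations between the entries once multiplied by [4 u0^2]. *)
have sq1 : 4 * (u1 * u1) = 1 + O o1 o1 - O o2 o2 - O o3 o3.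
  apply: (mulfI c0); rewrite {2}trace.
  have -> : 4 * (u0 * u0) * (4 * (u1 * u1)) = (4 * (u0 * u1)) * (4 * (u0 * u1)) by ring.
  by rewrite axis1; lra.
have sq2 : 4 * (u2 * u2) = 1 - O o1 o1 + O o2 o2 - O o3 o3.
  apply: (mulfI c0); rewrite {2}trace.
  have -> : 4 * (u0 * u0) * (4 * (u2 * u2)) = (4 * (u0 * u2)) * (4 * (u0 * u2)) by ring.
  by rewrite axis2; lra.
have sq3 : 4 * (u3 * u3) = 1 - O o1 o1 - O o2 o2 + O o3 o3.
  apply: (mulfI c0); rewrite {2}trace.
  have -> : 4 * (u0 * u0) * (4 * (u3 * u3)) = (4 * (u0 * u3)) * (4 * (u0 * u3)) by ring.
  by rewrite axis3; lra.
have p12 : 4 * (u1 * u2) = O o1 o2 + O o2 o1.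
  apply: (mulfI c0); rewrite {2}trace.
  have -> : 4 * (u0 * u0) * (4 * (u1 * u2)) = (4 * (u0 * u1)) * (4 * (u0 * u2)) by ring.
  by rewrite axis1 axis2; lra.
have p13 : 4 * (u1 * u3) = O o1 o3 + O o3 o1.
  apply: (mulfI c0); rewrite {2}trace.
  have -> : 4 * (u0 * u0) * (4 * (u1 * u3)) = (4 * (u0 * u1)) * (4 * (u0 * u3)) by ring.
  by rewrite axis1 axis3; lra.
have p23 : 4 * (u2 * u3) = O o2 o3 + O o3 o2.
  apply: (mulfI c0); rewrite {2}trace.
  have -> : 4 * (u0 * u0) * (4 * (u2 * u3)) = (4 * (u0 * u2)) * (4 * (u0 * u3)) by ring.
  by rewrite axis2 axis3; lra.
move: trace axis1 axis2 axis3 => tr a1 a2 a3.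
clear c31 c32 c33 c11 c12 c13 c21 c22 c23 r11 r22 r33 r12 r13 r23 k12 k13 k23 k11 k22 k33.
split; [split|]; repeat split; lra.
Qed.

End special_orthogonal.
End rotations.

(** * A rotation-valued function on the group *)

Section L1_split.
Variable R : realFieldType.
Implicit Types x y : 'I_7 -> R.

(** The forms [B_s = e^(4+s) + 2 e^(1+s)] satisfy the structure equations of
    so(3) up to scale, and the algebra is the semidirect product of so(3) with
    the solvable algebra of translations of hyperbolic 4-space. *)
Definition axis_part x (k : 'I_3) : R := x (hor (second_axis k)).
Definition spin_part x (k : 'I_3) : R := x (vert k) + 2 * x (hor (second_axis k)).

Lemma L1_d_frame i x y : \sum_k x k * L1_d i (unit_coord R k) y = L1_d i x y.
Proof. by move: i; apply: ix_ind; rewrite sum7E !L1_dE /wedge_coord /unit_coord ?ix_eq /=; ring. Qed.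

Lemma L1_d_spin x y k : L1_d (vert k) x y + 2 * L1_d (hor (second_axis k)) x y =
  - 2^-1 * cross (spin_part x) (spin_part y) k.
Proof.
by case: (ord3E k) => ->; rewrite second_axisE crossE /spin_part !second_axisE vertE ?horE !L1_dE
  /wedge_coord ?vertE; field.
Qed.

Lemma L1_d_axis x y k : L1_d (hor (second_axis k)) x y =
  - x (ix 1) * axis_part y k + y (ix 1) * axis_part x k -
  2^-1 * cross (axis_part x) (spin_part y) k + 2^-1 * cross (axis_part y) (spin_part x) k.
Proof.
by case: (ord3E k) => ->; rewrite second_axisE !crossE /spin_part /axis_part !second_axisE ?horE !L1_dE
  /wedge_coord ?vertE; field.
Qed.

Lemma dot_cross_skew (c : R) (x y b : 'I_3 -> R) :
  dot x (fun k => c * cross y b k) + dot y (fun k => c * cross x b k) = 0.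
Proof. by rewrite /dot !sum3E !crossE; ring. Qed.

Lemma volume_cross_skew (c : R) (x y z b : 'I_3 -> R) :
  dot x (fun k => cross y (fun j => c * cross z b j) k - cross z (fun j => c * cross y b j) k) +
  dot (cross y z) (fun k => c * cross x b k) = 0.
Proof. by rewrite /dot !sum3E !crossE; ring. Qed.

End L1_split.

Section vector_calculus.
Variables (R : realType) (M : manifold7 R) (p : M) (v : tvec R).
Variables (f g : 'I_3 -> M -> R) (a b : 'I_3 -> R).
Hypotheses (Df : forall k, has_deriv (f k) p v (a k)) (Dg : forall k, has_deriv (g k) p v (b k)).

Lemma has_deriv_dot :
  has_deriv (fun q => dot (f ^~ q) (g ^~ q)) p v (dot (f ^~ p) b + dot (g ^~ p) a).
Proof.
have := has_deriv_sum (fun k => has_derivM (Df k) (Dg k)).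
by apply: has_deriv_eq; rewrite /dot -big_split.
Qed.

Lemma has_deriv_cross k : has_deriv (fun q => cross (f ^~ q) (g ^~ q) k) p v
  (cross (f ^~ p) b k - cross (g ^~ p) a k).
Proof.
have C i j := has_derivB (has_derivM (Df i) (Dg j)) (has_derivM (Df j) (Dg i)).
by case: (ord3E k) => ->; [move: (C o2 o3)|move: (C o3 o1)|move: (C o1 o2)];
  apply: has_deriv_eq; rewrite !crossE; ring.
Qed.

End vector_calculus.

Section flat_functions.
Variables (R : realType) (G : lieGroup7 R).
Variables (e : 'I_7 -> form1 G) (E : 'I_7 -> vfield G).
Hypothesis e_smooth : forall i, smooth_form1 (e i).
Hypothesis E_smooth : forall i, smooth_vf (E i).
Hypothesis dual : forall i j p, e i p (E j p) = (i == j)%:R.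
Hypothesis L1_eqs : L1_structure_equations e.
Hypothesis E_left : forall i, left_invariant_vf (E i).
Local Notation one := (lg_one G).
Local Notation coord := (frame_coord e).
Implicit Types (p : G) (v w : tvec R).

(** The components of a right invariant field in the left invariant frame, that
    is, matrix coefficients of the adjoint representation. As the field commutes
    with the frame, the structure equations give all its derivatives. *)
Definition rfun w i p : R := e i p (right_field w p).

Lemma rfun_deriv w i p v :
  has_deriv (rfun w i) p v (L1_d i (coord p v) (rfun w ^~ p)).
Proof.
have Xs := right_field_smooth (G := G) w.
have Sr : smooth_fun_at (rfun w i) p by exact: (form_smooth e_smooth _ _ Xs).
split=> //; rewrite {1}(frame_expand e_smooth dual p v) (dfun_sumv _ _ _ Sr) -L1_d_frame.
apply: eq_bigr => k _; rewrite (dfunZ _ _ Sr); congr (_ * _).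
have := bracket_coord L1_eqs i p (E_smooth k) Xs.
rewrite right_field_bracket // (form0 e_smooth) (lieder_form_frame dual) subr0.
by rewrite (coord_frame dual) => /esym/eqP; rewrite subr_eq0 => /eqP.
Qed.

Lemma rfun_one w i : rfun w i one = e i one w.
Proof. by rewrite /rfun right_field_unit. Qed.

Lemma spin_part_deriv w k p v : has_deriv (fun q => spin_part (rfun w ^~ q) k) p v
  (- 2^-1 * cross (spin_part (coord p v)) (spin_part (rfun w ^~ p)) k).
Proof.
rewrite -L1_d_spin; apply: has_derivD; first exact: rfun_deriv.
by apply: has_derivZ; exact: rfun_deriv.
Qed.

(** The spin part turns by a cross product, so its norm is locally constant. *)
Lemma spin_vanishes w : (forall k, spin_part (rfun w ^~ one) k = 0) ->
  \forall p \near one, forall k, spin_part (rfun w ^~ p) k = 0.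
Proof.
move=> b1; pose b k p := spin_part (rfun w ^~ p) k.
pose N p := \sum_k b k p * b k p.
have D p v : has_deriv N p v 0.
  have := has_deriv_sum (fun k => has_derivM (spin_part_deriv w k p v) (spin_part_deriv w k p v)).
  by apply: has_deriv_eq; rewrite sum3E !crossE; ring.
have : \forall p \near one, N p = N one.
  by apply: locally_constant (D one 0).1 _; near=> p => v; exact: (D p v).2.
apply: filterS => p; rewrite {2}/N big1 => [|k _]; last by rewrite /b b1 mulr0.
rewrite /N sum3E => /eqP; rewrite !paddr_eq0 ?addr_ge0 -?expr2 ?sqr_ge0 // !sqrf_eq0.
by move=> /andP[/andP[/eqP e1 /eqP e2] /eqP e3]; apply: ord3_ind.
Unshelve. all: by end_near. Qed.

Lemma head_constant w : \forall p \near one, rfun w (ix 1) p = e (ix 1) one w.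
Proof.
rewrite -rfun_one; apply: locally_constant (rfun_deriv w (ix 1) one 0).1 _.
by near=> p => v; exact: (rfun_deriv w (ix 1) p v).2.
Unshelve. all: by end_near. Qed.

(** Both kinds of initial vector have zero spin part at the unit, hence nearby,
    which makes the equations of the axis parts linear. *)
Definition shift_vec : tvec R := E (ix 1) one.
Definition column_vec (j : 'I_3) : tvec R := E (hor (second_axis j)) one - 2 *: E (vert j) one.

Definition yfun k p := axis_part (rfun shift_vec ^~ p) k.
Definition cfun j k p := axis_part (rfun (column_vec j) ^~ p) k.
Definition sigma p := dot (cfun o1 ^~ p) (cfun o1 ^~ p).

Definition regular p :=
  [/\ (forall j k, spin_part (rfun (column_vec j) ^~ p) k = 0),
      (forall j, rfun (column_vec j) (ix 1) p = 0),
      (forall k, spin_part (rfun shift_vec ^~ p) k = 0),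
      rfun shift_vec (ix 1) p = 1 & 0 < sigma p].

Lemma shift_coord i : e i one shift_vec = (i == ix 1)%:R.
Proof. exact: dual. Qed.

Lemma column_coord i j :
  e i one (column_vec j) = (i == hor (second_axis j))%:R - 2 * (i == vert j)%:R.
Proof. by rewrite (formB e_smooth) (formZ e_smooth) !dual. Qed.

Lemma cfun_one j k : cfun j k one = (k == j)%:R.
Proof.
rewrite /cfun /axis_part rfun_one column_coord.
by case: (ord3E k) => ->; case: (ord3E j) => ->; rewrite !second_axisE !horE ?vertE ?ix_eq /=; ring.
Qed.

Lemma near_regular : \forall p \near one, regular p.
Proof.
have c1 : \forall p \near one, forall j k, spin_part (rfun (column_vec j) ^~ p) k = 0.
  apply: near_forall => j; apply: spin_vanishes => k.
  rewrite /spin_part !rfun_one !column_coord.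
  by case: (ord3E k) => ->; case: (ord3E j) => ->; rewrite !second_axisE !horE ?vertE ?ix_eq /=; ring.
have c2 : \forall p \near one, forall j, rfun (column_vec j) (ix 1) p = 0.
  apply: near_forall => j; apply: filterS (head_constant (column_vec j)) => p ->.
  by rewrite column_coord; case: (ord3E j) => ->; rewrite !second_axisE !horE ?vertE ?ix_eq /=; ring.
have c3 : \forall p \near one, forall k, spin_part (rfun shift_vec ^~ p) k = 0.
  apply: spin_vanishes => k; rewrite /spin_part !rfun_one !shift_coord.
  by case: (ord3E k) => ->; rewrite !second_axisE !horE ?vertE ?ix_eq /=; ring.
have c4 : \forall p \near one, rfun shift_vec (ix 1) p = 1.
  by apply: filterS (head_constant shift_vec) => p ->; rewrite shift_coord eqxx.
have c5 : \forall p \near one, 0 < sigma p.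
  apply: smooth_near_gt0.
    apply: smooth_sum => k _.
    by apply: smoothM; exact: (rfun_deriv (column_vec o1) (hor (second_axis k)) one 0).1.
  by rewrite /sigma /dot sum3E !cfun_one /=; lra.
near=> p; split.
- by near: p.
- by near: p.
- by near: p.
- by near: p.
- by near: p.
Unshelve. all: by end_near. Qed.

Section at_regular.
Variable p : G.
Hypothesis reg : regular p.

Lemma cross_spin0 (x y : 'I_3 -> R) k : (forall k, y k = 0) -> cross x y k = 0.
Proof. by move=> y0; case: (ord3E k) => ->; rewrite !crossE !y0; ring. Qed.

Lemma cfun_deriv j k v : has_deriv (cfun j k) p v
  (- coord p v (ix 1) * cfun j k p + 2^-1 * cross (cfun j ^~ p) (spin_part (coord p v)) k).
Proof.
have [b0 a0 _ _ _] := reg.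
have := rfun_deriv (column_vec j) (hor (second_axis k)) p v.
apply: has_deriv_eq; rewrite L1_d_axis a0 (cross_spin0 _ _ (b0 j)).
by rewrite /cfun; ring.
Qed.

Lemma yfun_deriv k v : has_deriv (yfun k) p v
  (- coord p v (ix 1) * yfun k p + axis_part (coord p v) k +
   2^-1 * cross (yfun ^~ p) (spin_part (coord p v)) k).
Proof.
have [_ _ b0 a1 _] := reg.
have := rfun_deriv shift_vec (hor (second_axis k)) p v.
apply: has_deriv_eq; rewrite L1_d_axis a1 (cross_spin0 _ _ b0).
by rewrite /yfun; ring.
Qed.

Lemma sigma_deriv v : has_deriv sigma p v (- 2 * coord p v (ix 1) * sigma p).
Proof.
have := has_deriv_sum (fun k => has_derivM (cfun_deriv o1 k v) (cfun_deriv o1 k v)).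
by apply: has_deriv_eq; rewrite /sigma /dot !sum3E !crossE; field.
Qed.

End at_regular.

(** The power of [sigma] for which the vectors [scale^2 cfun i] are orthonormal. *)
Definition scale p : R := Num.sqrt (Num.sqrt (sigma p))^-1.

Lemma scale_gt0 p : regular p -> 0 < scale p.
Proof. by move=> [_ _ _ _ s0]; rewrite sqrtr_gt0 invr_gt0 sqrtr_gt0. Qed.

Lemma scale_sigma p : regular p -> (scale p * scale p) * (scale p * scale p) * sigma p = 1.
Proof.
move=> [_ _ _ _ s0]; have q0 : 0 < Num.sqrt (sigma p) by rewrite sqrtr_gt0.
rewrite -!expr2 sqr_sqrtr ?invr_ge0 ?ltW // -{2}(sqr_sqrtr (ltW s0)) -exprMn mulVf ?expr1n //.
by rewrite gt_eqF.
Qed.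

Section near_regular_point.
Variable p : G.
Hypothesis nreg : \forall q \near p, regular q.
Let reg : regular p := nbhs_singleton nreg.

(** Implicit differentiation of [scale^4 sigma = 1]. *)
Lemma scale_deriv v : has_deriv scale p v (2^-1 * coord p v (ix 1) * scale p).
Proof.
have s0 := scale_gt0 reg; have sn := lt0r_neq0 s0.
have [_ _ _ _ sg0] := reg; have sgn := lt0r_neq0 sg0.
have Ss : smooth_fun_at scale p.
  have q0 : 0 < Num.sqrt (sigma p) by rewrite sqrtr_gt0.
  apply: smooth_sqrt; first by rewrite invr_gt0.
  apply: smoothV; first by rewrite gt_eqF.
  exact: smooth_sqrt sg0 (sigma_deriv reg v).1.
have D := has_deriv_dfun v Ss.
have D2 := has_derivM D D.
have D4 := has_derivM (has_derivM D2 D2) (sigma_deriv reg v).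
have D0 : has_deriv (fun q => scale q * scale q * (scale q * scale q) * sigma q) p v 0.
  apply: has_deriv_near (has_deriv_cst 1 p v).
  by apply: filterS nreg => q rq; rewrite scale_sigma.
have := has_deriv_unique D4 D0; set d := dfun scale p v in D D2 D4 * => dE.
apply: has_deriv_eq D.
have c0 : 4 * (scale p * scale p * scale p * sigma p) != 0.
  by rewrite !mulf_neq0 ?pnatr_eq0.
apply: (mulfI c0); apply/eqP; rewrite -subr_eq0 -[X in _ == X]dE; apply/eqP; field=> //.
Qed.

Definition rot i k p := scale p * scale p * cfun i k p.

(** The dilation factors of [scale^2] and of [cfun] cancel, which leaves an
    infinitesimal rotation. *)
Lemma rot_deriv i k v : has_deriv (rot i k) p v
  (2^-1 * cross (rot i ^~ p) (spin_part (coord p v)) k).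
Proof.
have := has_derivM (has_derivM (scale_deriv v) (scale_deriv v)) (cfun_deriv reg i k v).
by apply: has_deriv_eq; rewrite /rot; case: (ord3E k) => ->; rewrite !crossE; field.
Qed.

Lemma gram_deriv i j v : has_deriv (fun q => dot (rot i ^~ q) (rot j ^~ q)) p v 0.
Proof.
have := has_deriv_dot (fun k => rot_deriv i k v) (fun k => rot_deriv j k v).
by apply: has_deriv_eq; exact: dot_cross_skew.
Qed.

Lemma volume_deriv v :
  has_deriv (fun q => dot (rot o1 ^~ q) (cross (rot o2 ^~ q) (rot o3 ^~ q))) p v 0.
Proof.
have D i k := rot_deriv i k v.
have := has_deriv_dot (D o1) (has_deriv_cross (D o2) (D o3)).
by apply: has_deriv_eq; exact: volume_cross_skew.
Qed.

End near_regular_point.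

Lemma scale_one : scale one = 1.
Proof. by rewrite /scale /sigma /dot sum3E !cfun_one /= mulr0 mulr1 !addr0 sqrtr1 invr1 sqrtr1. Qed.

Lemma rot_one i k : rot i k one = (i == k)%:R.
Proof. by rewrite /rot scale_one !mul1r cfun_one eq_sym. Qed.

Definition orthogonal_at p :=
  [/\ (forall i j, dot (rot i ^~ p) (rot j ^~ p) = (i == j)%:R),
      dot (rot o1 ^~ p) (cross (rot o2 ^~ p) (rot o3 ^~ p)) = 1 &
      0 < 1 + rot o1 o1 p + rot o2 o2 p + rot o3 o3 p].

(** The inner products and the determinant of the [rot i] have zero derivative
    and their values at the unit are those of the identity matrix. *)
Lemma near_orthogonal : \forall p \near one, orthogonal_at p.
Proof.
have nn := near_join near_regular.
have n1 := nbhs_singleton nn.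
have g : \forall p \near one, forall i j, dot (rot i ^~ p) (rot j ^~ p) = (i == j)%:R.
  apply: near_forall => i; apply: near_forall => j.
  have -> : (i == j)%:R = dot (rot i ^~ one) (rot j ^~ one).
    by rewrite /dot sum3E !rot_one; case: (ord3E i) => ->; case: (ord3E j) => ->; rewrite /=; ring.
  apply: locally_constant (gram_deriv n1 i j 0).1 _.
  by apply: filterS nn => q nq v; exact: (gram_deriv nq i j v).2.
have d : \forall p \near one, dot (rot o1 ^~ p) (cross (rot o2 ^~ p) (rot o3 ^~ p)) = 1.
  have -> : 1 = dot (rot o1 ^~ one) (cross (rot o2 ^~ one) (rot o3 ^~ one)).
    by rewrite /dot sum3E !crossE !rot_one /=; ring.
  apply: locally_constant (volume_deriv n1 0).1 _.
  by apply: filterS nn => q nq v; exact: (volume_deriv nq v).2.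
have t : \forall p \near one, 0 < 1 + rot o1 o1 p + rot o2 o2 p + rot o3 o3 p.
  apply: smooth_near_gt0; last by rewrite !rot_one /=; lra.
  have S i := (rot_deriv n1 i i 0).1.
  by apply: smoothD => //; apply: smoothD => //; apply: smoothD => //; exact: smooth_cst.
near=> p; split.
- by near: p.
- by near: p.
- by near: p.
Unshelve. all: by end_near. Qed.

End flat_functions.

(** * The contact map to the Heisenberg group *)

Section quaternion_algebra.
Variable R : realFieldType.
Implicit Types (x y b h u : 'I_3 -> R) (O : 'I_3 -> 'I_3 -> R).

Definition axial O (k : 'I_3) : R :=
  match val k with
  | 0 => O o3 o2 - O o2 o3
  | 1 => O o1 o3 - O o3 o1
  | _ => O o2 o1 - O o1 o2
  end.

Lemma axialE O : (axial O o1 = O o3 o2 - O o2 o3) * (axial O o2 = O o1 o3 - O o3 o1) *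
  (axial O o3 = O o2 o1 - O o1 o2).
Proof. by []. Qed.

Lemma trace_cross O b : \sum_i cross (O i) b i = - dot (axial O) b.
Proof. by rewrite /dot !sum3E !crossE !axialE; ring. Qed.

Lemma dot_shift (x1 s : R) o y h b :
  - 2^-1 * (s * s * (dot o (fun k => - x1 * y k + h k + 2^-1 * cross y b k) +
                     dot y (fun k => 2^-1 * cross o b k)) +
            dot o y * (s * (2^-1 * x1 * s) + s * (2^-1 * x1 * s))) =
  - 2^-1 * (s * s * dot o h).
Proof. by rewrite /dot !sum3E !crossE; field. Qed.

(** The horizontal coordinates form a quaternion [x0 + x], the vertical ones a
    vector [z] of imaginary quaternions. *)
Definition heis_pack (x0 : R) (x z : 'I_3 -> R) (i : 'I_7) : R :=
  match val i with
  | 0 => x0 | 1 => x o1 | 2 => x o2 | 3 => x o3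
  | 4 => z o1 | 5 => z o2 | _ => z o3
  end.

Lemma heis_packE (x0 : R) x (z : 'I_3 -> R) : (heis_pack x0 x z (ix 1) = x0) * (heis_pack x0 x z (ix 2) = x o1) *
  (heis_pack x0 x z (ix 3) = x o2) * (heis_pack x0 x z (ix 4) = x o3) *
  (heis_pack x0 x z (ix 5) = z o1) * (heis_pack x0 x z (ix 6) = z o2) *
  (heis_pack x0 x z (ix 7) = z o3).
Proof. by []. Qed.

Lemma heis_pack_vert (x0 : R) x (z : 'I_3 -> R) s : heis_pack x0 x z (vert s) = z s.
Proof. by case: (ord3E s) => ->. Qed.

(** The horizontal 2-forms are the components of the imaginary part of
    [y * conj x]. *)
Lemma heis_b_pack (x0 y0 : R) x y (z w : 'I_3 -> R) s : heis_b (vert s) (heis_pack x0 x z) (heis_pack y0 y w) =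
  x0 * y s - x s * y0 + cross x y s.
Proof.
case: (ord3E s) => ->; rewrite vertE heis_bE /wedge_coord !heis_packE crossE; ring.
Qed.

(** With [x = c u], the derivative of the quaternion [x] is [x (x1 / 2 + b / 4)];
    the dilation part is real and drops out of the imaginary part of the
    derivative times [conj x]. *)
Lemma contact_transport (c x1 u0 D : R) u b s :
  - 2^-1 * (c * c * D) + (c * u0 * (c * (2^-1 * x1 * u s + 4^-1 * (u0 * b s + cross u b s))) -
    c * u s * (c * (2^-1 * x1 * u0 - 4^-1 * dot u b)) +
    cross (fun k => c * u k) (fun k => c * (2^-1 * x1 * u k + 4^-1 * (u0 * b k + cross u b k))) s) =
  4^-1 * (c * c) * (u0 * (u0 * b s + cross u b s) + u s * dot u b +
    cross u (fun k => u0 * b k + cross u b k) s - 2 * D).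
Proof. by case: (ord3E s) => ->; rewrite /dot sum3E !crossE; field. Qed.

Section lift.
Variables (O : 'I_3 -> 'I_3 -> R) (u0 : R) (u : 'I_3 -> R).
Hypothesis rows : forall i j, dot (O i) (O j) = (i == j)%:R.
Hypothesis det1 : dot (O o1) (cross (O o2) (O o3)) = 1.
Hypothesis u0_gt0 : 0 < u0.
Hypothesis trace : 4 * (u0 * u0) = 1 + O o1 o1 + O o2 o2 + O o3 o3.
Hypothesis axis : forall k, 4 * (u0 * u k) = axial O k.

Let Q := rotation_quaternion rows det1 u0_gt0 trace (axis o1) (axis o2) (axis o3).

(** The skew part of an infinitesimally rotated matrix, in terms of the quaternion
    of the rotation. *)
Lemma axial_cross b k : 2^-1 * axial (fun i => cross (O i) b) k =
  - dot u b * u k + u0 * (u0 * b k + cross u b k).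
Proof.
have QQ := Q.
case: (ord3E k) => ->; rewrite axialE /dot sum3E !crossE !QQ; field=> //.
Qed.

(** The rotation [O] is the conjugation [b |-> u b (conj u)] by its unit quaternion. *)
Lemma spin_transport b i :
  u0 * (u0 * b i + cross u b i) + u i * dot u b +
  cross u (fun k => u0 * b k + cross u b k) i = dot (O i) b.
Proof.
have QQ := Q.
case: (ord3E i) => ->; rewrite /dot !sum3E !crossE !QQ; ring.
Qed.

End lift.
End quaternion_algebra.

(* From here on these functions are only used through the properties above. *)
Opaque rot scale cfun yfun sigma rfun.

Section flat_map.
Variables (R : realType) (G : lieGroup7 R).
Variables (e : 'I_7 -> form1 G) (E : 'I_7 -> vfield G).
Hypothesis e_smooth : forall i, smooth_form1 (e i).
Hypothesis E_smooth : forall i, smooth_vf (E i).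
Hypothesis dual : forall i j p, e i p (E j p) = (i == j)%:R.
Hypothesis L1_eqs : L1_structure_equations e.
Hypothesis E_left : forall i, left_invariant_vf (E i).
Local Notation one := (lg_one G).
Local Notation coord := (frame_coord e).
Local Notation rot := (rot e E).
Local Notation scale := (scale e E).
Local Notation yfun := (yfun e E).
Implicit Types (p : G) (v w : tvec R).

(** [spin0 + spin] is the unit quaternion of [rot], near the identity. *)
Definition spin0 p : R := 2^-1 * Num.sqrt (1 + rot o1 o1 p + rot o2 o2 p + rot o3 o3 p).
Definition spin (k : 'I_3) p : R := axial (fun i j => rot i j p) k / (4 * spin0 p).
(** A vertical coordinate whose derivative only involves the axis part. *)
Definition zfun (i : 'I_3) p : R := - 2^-1 * (scale p * scale p * dot (rot i ^~ p) (yfun ^~ p)).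

Definition flat_coord (i : 'I_7) p : R :=
  heis_pack (scale p * spin0 p) (fun k => scale p * spin k p) (zfun ^~ p) i.

Definition flat_point p := regular e E p /\ orthogonal_at e E p.

Lemma near_flat_point : \forall p \near one, flat_point p.
Proof.
near=> p; split.
- by near: p; exact: (near_regular e_smooth E_smooth dual L1_eqs E_left).
- by near: p; exact: (near_orthogonal e_smooth E_smooth dual L1_eqs E_left).
Unshelve. all: by end_near. Qed.

Lemma spin0_gt0 p : flat_point p -> 0 < spin0 p.
Proof. by move=> [_ [_ _ t0]]; rewrite mulr_gt0 ?invr_gt0 ?sqrtr_gt0. Qed.

Lemma spin0_sqr p : flat_point p ->
  4 * (spin0 p * spin0 p) = 1 + rot o1 o1 p + rot o2 o2 p + rot o3 o3 p.
Proof.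
move=> [_ [_ _ t0]]; rewrite -[RHS](sqr_sqrtr (ltW t0)) /spin0.
by set a := Num.sqrt _; field.
Qed.

Lemma spin_axial p k : flat_point p -> 4 * (spin0 p * spin k p) = axial (fun i j => rot i j p) k.
Proof.
move=> fp; have n0 := lt0r_neq0 (spin0_gt0 fp); rewrite /spin.
by set a := axial _ _; field.
Qed.

Section at_flat_point.
Variable p : G.
Hypothesis nfp : \forall q \near p, flat_point q.
Let fp : flat_point p := nbhs_singleton nfp.
Let nreg : \forall q \near p, regular e E q.
Proof. by apply: filterS nfp => q []. Qed.
Let s0 : 0 < spin0 p := spin0_gt0 fp.
Let rotD i k v := rot_deriv e_smooth E_smooth dual L1_eqs E_left nreg i k v.
Let scaleD v := scale_deriv e_smooth E_smooth dual L1_eqs E_left nreg v.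
Let yD k v := yfun_deriv e_smooth E_smooth dual L1_eqs E_left fp.1 k v.

Variable v : tvec R.
Let x1 := coord p v (ix 1).
Let b := spin_part (coord p v).
Let h := axis_part (coord p v).

Lemma spin0_deriv : has_deriv spin0 p v (- 4^-1 * dot (spin ^~ p) b).
Proof.
have [_ [_ _ t0]] := fp.
have T := has_derivD (has_derivD (has_derivD (has_deriv_cst 1 p v) (rotD o1 o1 v)) (rotD o2 o2 v)) (rotD o3 o3 v).
have S : smooth_fun_at spin0 p by apply: smooth_cstM; exact: smooth_sqrt t0 T.1.
have D := has_deriv_dfun v S; apply: has_deriv_eq D.
have D2 := has_derivZ 4 (has_derivM (has_deriv_dfun v S) (has_deriv_dfun v S)).
have T' : has_deriv (fun q => 4 * (spin0 q * spin0 q)) p v (2^-1 * \sum_i cross (rot i ^~ p) b i).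
  apply: has_deriv_near (has_deriv_eq _ T).
    by apply: filterS nfp => q fq; rewrite spin0_sqr.
  by rewrite add0r -!mulrDr -[X in _ * X](sum3E (fun i => cross (rot i ^~ p) b i)).
have := has_deriv_unique D2 T'; rewrite trace_cross.
have -> : dot (axial (fun i => rot i ^~ p)) b = 4 * spin0 p * dot (spin ^~ p) b.
  rewrite /dot mulr_sumr; apply: eq_bigr => k _.
  by rewrite -(spin_axial k fp); ring.
have n0 := lt0r_neq0 s0.
set d := dfun _ _ _; set a := dot _ _ => H.
have c0 : 8 * spin0 p != 0 by rewrite mulf_neq0 // pnatr_eq0.
apply: (mulfI c0); move: H; set s := spin0 p => H.
have -> : 8 * s * d = 4 * (s * d + s * d) by ring.
by rewrite H; field.
Qed.

Lemma spin_deriv k : has_deriv (spin k) p v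
  (4^-1 * (spin0 p * b k + cross (spin ^~ p) b k)).
Proof.
have n0 := lt0r_neq0 s0; have [_ [rows det1 _]] := fp.
have D i j := rotD i j v.
have A : has_deriv (fun q => axial (fun i j => rot i j q) k) p v
   (2^-1 * axial (fun i => cross (rot i ^~ p) b) k).
  by case: (ord3E k) => ->; rewrite !axialE mulrBr; exact: has_derivB.
have S : smooth_fun_at (spin k) p.
  apply: smoothM A.1 _; apply: smoothV; first by rewrite mulf_neq0 // pnatr_eq0.
  exact: smooth_cstM spin0_deriv.1.
have Dk := has_deriv_dfun v S; apply: has_deriv_eq Dk.
have D2 := has_derivZ 4 (has_derivM spin0_deriv (has_deriv_dfun v S)).
have A' : has_deriv (fun q => 4 * (spin0 q * spin k q)) p v
   (2^-1 * axial (fun i => cross (rot i ^~ p) b) k).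
  by apply: has_deriv_near A; apply: filterS nfp => q fq; rewrite spin_axial.
have := has_deriv_unique D2 A'.
rewrite (axial_cross rows det1 s0 (spin0_sqr fp) (fun k => spin_axial k fp)).
set d := dfun _ _ _; set a := dot _ _; set c := cross _ _ _; set t := spin k p; set bk := b k.
set s := spin0 p in n0 * => H.
have c0 : 4 * s != 0 by rewrite mulf_neq0 // pnatr_eq0.
apply: (mulfI c0).
have -> : 4 * s * d = 4 * (s * d + t * (- 4^-1 * a)) + a * t by field.
by rewrite H; field.
Qed.

Definition flat_deriv : 'I_7 -> R :=
  heis_pack (scale p * (2^-1 * x1 * spin0 p - 4^-1 * dot (spin ^~ p) b))
    (fun k => scale p * (2^-1 * x1 * spin k p + 4^-1 * (spin0 p * b k + cross (spin ^~ p) b k)))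
    (fun k => - 2^-1 * (scale p * scale p * dot (rot k ^~ p) h)).

Lemma zfun_deriv i : has_deriv (zfun i) p v (- 2^-1 * (scale p * scale p * dot (rot i ^~ p) h)).
Proof.
have D := has_derivZ (- 2^-1) (has_derivM (has_derivM (scaleD v) (scaleD v))
  (has_deriv_dot (fun k => rotD i k v) (fun k => yD k v))).
by apply: has_deriv_eq D; exact: dot_shift.
Qed.

(** The quaternion [u = spin0 + spin] satisfies [u' = u b / 4] and [scale' = x1 / 2 * scale]. *)
Lemma flat_coord_deriv i : has_deriv (flat_coord i) p v (flat_deriv i).
Proof.
have Q k : has_deriv (fun q => scale q * spin k q) p v
   (scale p * (2^-1 * x1 * spin k p + 4^-1 * (spin0 p * b k + cross (spin ^~ p) b k))).
  have := has_derivM (scaleD v) (spin_deriv k); apply: has_deriv_eq.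
  by rewrite -/x1; set c := 2^-1; set d := 4^-1; ring.
have Q0 : has_deriv (fun q => scale q * spin0 q) p v
   (scale p * (2^-1 * x1 * spin0 p - 4^-1 * dot (spin ^~ p) b)).
  have := has_derivM (scaleD v) spin0_deriv; apply: has_deriv_eq.
  by rewrite -/x1; set c := 2^-1; set d := 4^-1; ring.
by move: i; apply: ix_ind; [exact: Q0|exact: Q|exact: Q|exact: Q|exact: zfun_deriv|
  exact: zfun_deriv|exact: zfun_deriv].
Qed.

(** The imaginary part of the derivative of the quaternion times its conjugate is
    [1/4 scale^2 O b]. Since [b] is the Reeb part plus twice the axis part, the
    derivative of [zfun] removes the axis part. *)
Lemma flat_contact s : flat_deriv (vert s) + heis_b (vert s) (flat_coord ^~ p) flat_deriv =
  4^-1 * (scale p * scale p) * \sum_k rot s k p * coord p v (vert k).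
Proof.
have [_ [rows det1 _]] := fp.
have T := spin_transport rows det1 s0 (spin0_sqr fp) (fun k => spin_axial k fp) b s.
have -> : \sum_k rot s k p * coord p v (vert k) = dot (rot s ^~ p) b - 2 * dot (rot s ^~ p) h.
  rewrite /dot mulr_sumr -sumrB; apply: eq_bigr => k _.
  by rewrite /b /h /spin_part /axis_part; ring.
rewrite -T -(contact_transport _ x1) -(heis_b_pack _ _ _ _ (zfun ^~ p)
  (fun k => - 2^-1 * (scale p * scale p * dot (rot k ^~ p) h))) /flat_deriv heis_pack_vert.
by congr (_ + _); apply: heis_b_pack.
Qed.

End at_flat_point.

Lemma spin0_one : spin0 one = 1.
Proof.
rewrite /spin0 !rot_one //= (_ : 1 + 1%:R + 1%:R + 1%:R = 2 ^+ 2); last by ring.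
by rewrite sqrtr_sqr ger0_norm // mulVf // pnatr_eq0.
Qed.

Lemma spin_one k : spin k one = 0.
Proof. by rewrite /spin; case: (ord3E k) => ->; rewrite axialE !rot_one //= subrr mul0r. Qed.

Lemma flat_deriv_inj v : (forall i, flat_deriv one v i = 0) -> v = 0.
Proof.
move=> D0; apply: (frame_ext e_smooth dual (p := one)) => i; rewrite (form0 e_smooth) -[LHS]/(coord one v i).
have sp k := spin_one k.
have d0 : dot (spin ^~ one) (spin_part (coord one v)) = 0.
  by rewrite /dot big1 // => k _; rewrite sp mul0r.
have c0 k : cross (spin ^~ one) (spin_part (coord one v)) k = 0.
  by case: (ord3E k) => ->; rewrite crossE !sp !mul0r subrr.
have r0 k : dot (rot k ^~ one) (axis_part (coord one v)) = axis_part (coord one v) k.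
  rewrite /dot sum3E !rot_one //; move: (axis_part _) => h.
  by case: (ord3E k) => ->; rewrite /= !mul0r mul1r ?add0r ?addr0.
have x1 : coord one v (ix 1) = 0.
  move: (D0 (ix 1)); rewrite /flat_deriv heis_packE d0 spin0_one scale_one //.
  by move: (coord one v (ix 1)) => x; lra.
have b0 k : spin_part (coord one v) k = 0.
  have : scale one * (2^-1 * coord one v (ix 1) * spin k one + 4^-1 *
      (spin0 one * spin_part (coord one v) k + cross (spin ^~ one) (spin_part (coord one v)) k)) = 0.
    by case: (ord3E k) => ->; [exact: (D0 (ix 2))|exact: (D0 (ix 3))|exact: (D0 (ix 4))].
  rewrite c0 sp spin0_one scale_one //.
  by move: (coord one v (ix 1)) (spin_part _ k) => x y; lra.
have h0 k : axis_part (coord one v) k = 0.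
  have : - 2^-1 * (scale one * scale one * dot (rot k ^~ one) (axis_part (coord one v))) = 0.
    by case: (ord3E k) => ->; [exact: (D0 (ix 5))|exact: (D0 (ix 6))|exact: (D0 (ix 7))].
  rewrite r0 scale_one //.
  by move: (axis_part _ k) => y; lra.
move: (b0 o1) (b0 o2) (b0 o3) (h0 o1) (h0 o2) (h0 o3).
rewrite /spin_part /axis_part !second_axisE !horE !vertE.
by move: i x1; apply: ix_ind; move: (coord one v) => x *; lra.
Qed.

End flat_map.

(** * Local qc conformal flatness *)

Section smooth_maps_of_manifolds.
Variable R : realType.
Implicit Types M N K : manifold7 R.

Lemma smooth_map_comp M N K (F : M -> N) (H : N -> K) p :
  smooth_map_at F p -> smooth_map_at H (F p) -> smooth_map_at (H \o F) p.
Proof.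
move=> SF [cH CH]; split; first exact: continuous_comp SF.1 cH.
apply/Coo_at_rowP => i.
have Si : smooth_fun_at (coordfun (H (F p)) i \o H) (F p) by exact: ((Coo_at_rowP _ _).1 CH i).
exact: (dfun_chain 0 SF Si).1.
Qed.

Lemma heis_map_smooth M (F : M -> heis_group R) p :
  (forall i, smooth_fun_at (fun q => (F q : 'rV[R]_7) 0 i) p) ->
  smooth_map_at F p /\
  forall v i, tangent_map F p v 0 i = dfun (fun q => (F q : 'rV[R]_7) 0 i) p v.
Proof.
move=> SF.
have C : Coo_at ((F : M -> 'rV[R]_7) \o cinv p) (chart p p).
  by apply/Coo_at_rowP => i; exact: SF.
split; first by split; [exact: chart_Coo_cvg C|exact: C].
by move=> v i; exact: derive_coord (Coo_at_differentiable C).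
Qed.

End smooth_maps_of_manifolds.

Section flatness.
Variables (R : realType) (G : lieGroup7 R).
Variables (e : 'I_7 -> form1 G) (E : 'I_7 -> vfield G).
Hypothesis e_smooth : forall i, smooth_form1 (e i).
Hypothesis E_smooth : forall i, smooth_vf (E i).
Hypothesis dual : forall i j p, e i p (E j p) = (i == j)%:R.
Hypothesis L1_eqs : L1_structure_equations e.
Hypothesis E_left : forall i, left_invariant_vf (E i).
Hypothesis e_left : forall i, left_invariant_form1 (e i).
Local Notation one := (lg_one G).
Local Notation V := 'rV[R]_7.
Local Notation fp_at := (fun p => \forall q \near p, flat_point e E q).
Implicit Types (p q g : G).

Definition flat_map p : heis_group R := \row_i flat_coord e E i p.

Let coordD p (H : fp_at p) v i :=
  flat_coord_deriv e_smooth E_smooth dual L1_eqs E_left H v i.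

Lemma flat_map_coord i : (fun q => (flat_map q : V) 0 i) = flat_coord e E i.
Proof. by apply: boolp.funext => q; rewrite mxE. Qed.

Opaque flat_map.

Lemma flat_map_smooth p : fp_at p -> smooth_map_at flat_map p.
Proof.
move=> H; apply: (heis_map_smooth _).1 => i; rewrite flat_map_coord.
exact: (coordD H 0 i).1.
Qed.

(** At the unit the derivative is injective, and the inverse function theorem
    applies in the chart at the unit. *)
Lemma flat_map_inverse : exists (U : set G) (h : heis_group R -> G),
  [/\ open U, U one, open (flat_map @` U) & forall p, U p ->
     [/\ fp_at p, h (flat_map p) = p & smooth_map_at h (flat_map p)]].
Proof.
have F1 := near_join (near_flat_point e_smooth E_smooth dual L1_eqs E_left).
pose F (x : V) : V := flat_map (cinv one x).
have S1 i : smooth_fun_at (fun q => (flat_map q : V) 0 i) one.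
  by rewrite flat_map_coord; exact: (coordD (nbhs_singleton F1) 0 i).1.
have CF : Coo_at F (chart one one) by exact: (heis_map_smooth S1).1.2.
have dF v : 'D_v F (chart one one) = 0 -> v = 0.
  move=> D0; apply: (flat_deriv_inj e_smooth dual) => i.
  rewrite -(coordD (nbhs_singleton F1) v i).2 -flat_map_coord.
  by rewrite -((heis_map_smooth S1).2 v i) -[tangent_map _ _ _]/('D_v F (chart one one)) D0 mxE.
have nO : nbhs (chart one one) ((chart one @` cdom one) `&` [set x | fp_at (cinv one x)]).
  apply: filterI; last exact: near_cinv (cdom_center one) F1.
  apply: open_nbhs_nbhs; split; first exact: chart_open.
  by exists one => //; exact: cdom_center.
have [B [h [[oB B1 BO] [BF oFB hF hC]]]] := inverse_function nO CF dF.
pose U := [set q | cdom one q /\ B (chart one q)].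
have FU : flat_map @` U = F @` B.
  apply/seteqP; split=> y /=.
    by move=> [q [qd qB] <-]; exists (chart one q); [exact: qB|rewrite /F (cinv_chart qd)].
  move=> [x xB <-]; have [[q qd qx] _] := BO x xB; exists q; last by rewrite /F -qx (cinv_chart qd).
  by split; [exact: qd|rewrite qx].
exists U, (cinv one \o h); split.
- rewrite openE => q [qd qB]; apply: filterI; first exact: near_cdom.
  by apply: near_chart => //; exact: open_nbhs_nbhs.
- by split=> //; exact: cdom_center.
- by rewrite FU.
move=> p [pd pB].
have Fp : F (chart one p) = flat_map p by rewrite /F cinv_chart.
have hp : h (flat_map p) = chart one p by rewrite -Fp hF.
have hhp : (cinv one \o h) (flat_map p) = p by rewrite /= hp cinv_chart.
have Ch : Coo_at h (flat_map p : V) by rewrite -Fp; exact: hC.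
split; [by have [_] := BO _ pB; rewrite /= cinv_chart|exact: hhp|split].
  apply: continuous_comp; first exact: (Coo_at_continuous Ch).
  by rewrite hp; apply: cinv_continuous; exists p.
have T : Coo_at (chart p \o cinv one) (h (flat_map p)).
  by rewrite hp; exact: transition_Coo_at pd (cdom_center p).
rewrite hhp; exact: (Coo_at_comp_row Ch T).
Qed.

Lemma flat_map_pullback g p (s : 'I_3) (v : V) : fp_at (lg_mul g p) ->
  pullback (flat_map \o lg_mul g) (heis_form (vert s)) p v =
  4^-1 * (scale e E (lg_mul g p) * scale e E (lg_mul g p)) *
    \sum_k rot e E s k (lg_mul g p) * e (vert k) p v.
Proof.
move=> H; have L := left_translation_smooth g p.
have C i : flat_coord e E i \o lg_mul g = fun q => (flat_map (lg_mul g q) : V) 0 i.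
  by rewrite -flat_map_coord.
have S i : smooth_fun_at (fun q => (flat_map (lg_mul g q) : V) 0 i) p.
  by rewrite -C; exact: (dfun_chain 0 L (coordD H 0 i).1).1.
have T i : tangent_map (flat_map \o lg_mul g) p v 0 i =
    flat_deriv e E (lg_mul g p) (tangent_map (lg_mul g) p v) i.
  rewrite ((heis_map_smooth S).2 v i) -C -(coordD H _ i).2.
  exact: (dfun_chain _ L (coordD H 0 i).1).2.
have -> : pullback (flat_map \o lg_mul g) (heis_form (vert s)) p v =
   flat_deriv e E (lg_mul g p) (tangent_map (lg_mul g) p v) (vert s) +
   heis_b (vert s) (flat_coord e E ^~ (lg_mul g p))
      (flat_deriv e E (lg_mul g p) (tangent_map (lg_mul g) p v)).
  rewrite /pullback /heis_form T; congr (_ + heis_b _ _ _).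
    by apply: boolp.funext => i; rewrite -flat_map_coord.
  by apply: boolp.funext => i; rewrite /rc T.
rewrite (flat_contact H); congr (_ * _); apply: eq_bigr => k _.
by congr (_ * _); exact: e_left.
Qed.

(** Near an arbitrary point [p] the map is the one near the unit, composed with
    the left translation by the inverse of [p]; the contact forms are invariant
    under it. *)
Lemma L1_flat : locally_qc_conformally_flat (coframe_qc e E).
Proof.
exists (heis_group R), (@heis_form R); split; first exact: heis_is_quaternionic_heisenberg.
move=> p; have [U [h [oU U1 oFU UP]]] := flat_map_inverse.
pose L := lg_mul (lg_inv p); pose L' := lg_mul p.
have LK q : L' (L q) = q by rewrite /L' /L lg_mulA lg_mulVr lg_mul1.
have LK' q : L (L' q) = q by rewrite /L' /L lg_mulA lg_mulV lg_mul1.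
have LS q : smooth_map_at L q by exact: left_translation_smooth.
have SL f q : smooth_fun_at f (L q) -> smooth_fun_at (fun y => f (L y)) q.
  by move=> Sf; exact: (dfun_chain 0 (LS q) Sf).1.
exists (L @^-1` U), (flat_map \o L),
  (fun y => 4^-1 * (scale e E (L y) * scale e E (L y))),
  (fun y => \matrix_(s, k) rot e E s k (L y)).
have reg q : U (L q) -> \forall y \near L q, regular e E y.
  by move=> /UP [H _ _]; apply: filterS H => y [].
split.
- by rewrite /L /= lg_mulV.
- split.
  + by apply: open_comp => // q _; exact: (LS q).1.
  + have -> : (flat_map \o L) @` (L @^-1` U) = flat_map @` U; last by [].
    apply/seteqP; split=> y /=; first by move=> [q qU <-]; exists (L q); [exact: qU|].
    by move=> [q qU <-]; exists (L' q); rewrite LK'; [exact: qU|].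
  + move=> q /UP [H _ _]; apply: smooth_map_comp (LS q) _; exact: flat_map_smooth.
  exists (L' \o h) => q /UP [_ hE hS]; split; first by rewrite /= hE LK.
  apply: smooth_map_comp hS _; exact: left_translation_smooth.
- move=> y yU; have Sy := (scale_deriv e_smooth E_smooth dual L1_eqs E_left (reg y yU) 0).1.
  have s0 := scale_gt0 (nbhs_singleton (reg y yU)).
  split; last by rewrite mulr_gt0 ?invr_gt0 // mulr_gt0.
  by apply: smooth_cstM; apply: smoothM; exact: (SL _ _ Sy).
- move=> y yU; split.
    move=> s k; have := (rot_deriv e_smooth E_smooth dual L1_eqs E_left (reg y yU) s k 0).1.
    by move=> /SL; congr (smooth_fun_at _ _); apply: boolp.funext => z; rewrite mxE.
  have [H _ _] := UP _ yU; have [_ [rows det1 _]] := nbhs_singleton H.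
  split; last by rewrite (det3E (fun s k => rot e E s k (L y))).
  by apply/matrixP => i j; rewrite !mxE -rows; apply: eq_bigr => k _; rewrite !mxE.
- move=> y yU s v; have [H _ _] := UP _ yU.
  rewrite (flat_map_pullback s v H); congr (_ * _).
  by apply: eq_bigr => k _; rewrite mxE.
Qed.

End flatness.

Theorem theorem3p2 (R : realType) (G1 : lieGroup7 R)
    (e : 'I_7 -> form1 G1) (E : 'I_7 -> vfield G1)
    (G1_simply_connected : simply_connected G1)
    (eE_dual : left_invariant_dual_frames e E)
    (L1_eqs : L1_structure_equations e) :
  let q := coframe_qc e E in
  is_qc_structure q /\
  (exists nabla, is_biquard_connection q nabla) /\
  (forall nabla, is_biquard_connection q nabla ->
     torsion_endomorphism_zero q nabla /\
     is_normalized_qc_scalar q nabla (fun _ => - 2^-1)) /\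
  (forall nabla, is_biquard_connection q nabla ->
     qc_conformal_curvature_zero q nabla) /\
  locally_qc_conformally_flat q.
Proof.
have [e_inv E_inv dual] := eE_dual.
have e_smooth i : smooth_form1 (e i) := (e_inv i).1.
have e_left i : left_invariant_form1 (e i) := (e_inv i).2.
have E_smooth i : smooth_vf (E i) := (E_inv i).1.
have E_left i : left_invariant_vf (E i) := (E_inv i).2.
split; first exact: (L1_is_qc e_smooth E_smooth dual L1_eqs).
split.
  by exists (L1_nabla e E); exact: (L1_nabla_biquard e_smooth E_smooth dual L1_eqs).
split=> [nabla bq|].
  split.
    apply: (torsion_mixed_zero e_smooth dual L1_eqs).
    exact: (biquard_L1_coefficients e_smooth E_smooth dual L1_eqs bq).
  exact: (L1_scalar e_smooth E_smooth dual L1_eqs bq).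
split=> [nabla bq|].
  exact: (L1_Wqc_zero e_smooth E_smooth dual L1_eqs bq).
exact: (L1_flat e_smooth E_smooth dual L1_eqs E_left e_left).
Qed.
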